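(* There exists a constant $\epsilon>0$ such that the following holds. Let $m\le n$, let $\mathbf{A}\in[-1,1]^{m\times n}$ and let $\mathbf{x}\in(-1,1)^n$. Run the procedure $\textsc{PrefixPartialColoring}(\mathbf{x},\mathbf{A})$ described in the context (with this $\epsilon$). Then with high probability its output $\mathbf{x}'\in[-1,1]^n$ satisfies: (1) at least an $\epsilon/4$ fraction of the entries of $\mathbf{x}'$ lie in $\{-1,1\}$, i.e. $|\{i\in[n]:\mathbf{x}'(i)\in\{\pm1\}\}|\ge \frac{\epsilon}{4}n$; (2) the prefix discrepancy of $\mathbf{x}'-\mathbf{x}$ is $O(\sqrt m)$: \[\sup_{\ell\le n}\big\|\mathbf{A}(\cdot,[\ell])\cdot(\mathbf{x}'([\ell])-\mathbf{x}([\ell]))\big\|_\infty=O(\sqrt m),\] where the implied constant is absolute.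
   Context: Notation: $[n]=\{1,\dots,n\}$; $\mathbf{A}(\cdot,i)$ is column $i$ of $\mathbf{A}$, $\mathbf{A}(j,\cdot)$ is row $j$, $\mathbf{A}(\cdot,[\ell])$ is the submatrix of the first $\ell$ columns and $\mathbf{x}([\ell])$ the vector of the first $\ell$ entries, so $\mathbf{A}(\cdot,[\ell])\mathbf{x}([\ell])=\sum_{i\le\ell}\mathbf{A}(\cdot,i)\mathbf{x}(i)$. For a finite index set $S$, $N(0,1)^S$ is the standard Gaussian vector in $\mathbb{R}^S$. Procedure $\textsc{PrefixPartialColoring}(\mathbf{x},\mathbf{A})$: if fewer than half of the entries of $\mathbf{x}$ are nonnegative, run the procedure on $-\mathbf{x}$ and return the negation of the result. Otherwise let $I$ be the set of indices $i$ with $\mathbf{x}(i)\ge0$, listed increasingly as $I(1)<\dots<I(|I|)$. Let $Q=\{\mathbf{g}\in\mathbb{R}^I:\max_{j\in[m]}\max_{1\le k\le|I|}|\sum_{i\in I,\,i\le I(k)}\mathbf{g}(i)\mathbf{A}(j,i)|\le 112\sqrt m\}$. Let $T:\mathbb{R}^I\to\mathbb{R}^I$ be the linear map $T(\mathbf{y})(i)=\mathbf{y}(i)/(1-\mathbf{x}(i))$, and $K=T(Q)$. Sample $\mathbf{y}^*\sim N(0,1)^I$ and let $\mathbf{x}^*=\arg\min_{\mathbf{z}\in K\cap[-1,1]^I}\|\mathbf{y}^*-\mathbf{z}\|_2$. If the number of entries of $\mathbf{x}^*$ equal to $1$ is less than $\frac{\epsilon}{2}|I|$, replace $\mathbf{x}^*$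 by $-\mathbf{x}^*$. Output $\mathbf{x}'$ with $\mathbf{x}'(i)=\mathbf{x}(i)+(1-\mathbf{x}(i))\mathbf{x}^*(i)$ for $i\in I$ and $\mathbf{x}'(i)=\mathbf{x}(i)$ for $i\notin I$. *)

(* Defs.v *)
From HB Require Import structures.
From mathcomp Require Import all_boot all_order all_algebra.
From mathcomp Require Import all_classical all_reals all_analysis.
Set Implicit Arguments. Unset Strict Implicit. Unset Printing Implicit Defensive.
Import Order.TTheory GRing.Theory Num.Theory.
Local Open Scope classical_set_scope.
Local Open Scope ring_scope.

Section PPC.
Variable R : realType.

Definition nonneg_idx n (x : 'I_n -> R) : {set 'I_n} := [set i | 0 <= x i].

(* Q, viewed inside R^n as the vectors supported on I:
   max_j max_{1<=k<=|I|} |sum_{i in I, i <= I(k)} g(i) A(j,i)| <= 112 sqrt m.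
   (I(k) ranges exactly over the elements t of I.) *)
Definition Qset m n (A : 'M[R]_(m, n)) (I : {set 'I_n}) : set ('I_n -> R) :=
  [set g | (forall i, i \notin I -> g i = 0) /\
           (forall (j : 'I_m) (t : 'I_n), t \in I ->
              `| \sum_(i in I | (i <= t)%N) g i * A j i | <= 112 * Num.sqrt (m%:R))].

Definition Tmap n (x : 'I_n -> R) (g : 'I_n -> R) : 'I_n -> R :=
  fun i => g i / (1 - x i).

Definition Kset m n (A : 'M[R]_(m, n)) (x : 'I_n -> R) : set ('I_n -> R) :=
  Tmap x @` Qset A (nonneg_idx x).

Definition feasible m n (A : 'M[R]_(m, n)) (x : 'I_n -> R) (z : 'I_n -> R) : Prop :=
  Kset A x z /\ (forall i, i \in nonneg_idx x -> -1 <= z i <= 1).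

Definition distI n (I : {set 'I_n}) (u v : 'I_n -> R) : R :=
  Num.sqrt (\sum_(i in I) (u i - v i) ^+ 2).

Definition is_proj m n (A : 'M[R]_(m, n)) (x y z : 'I_n -> R) : Prop :=
  feasible A x z /\
  (forall w, feasible A x w -> distI (nonneg_idx x) y z <= distI (nonneg_idx x) y w).

Definition flip n (eps : R) (I : {set 'I_n}) (xs : 'I_n -> R) : 'I_n -> R :=
  if (#|[set i in I | xs i == 1]|%:R < eps / 2 * #|I|%:R) then (fun i => - xs i) else xs.

(* the procedure in the case where at least half of the entries are nonnegative;
   x' is the output when the Gaussian sample is y (its entries in I form ystar) *)
Definition ppc_main m n (eps : R) (A : 'M[R]_(m, n)) (x y x' : 'I_n -> R) : Prop :=
  exists xs, is_proj A x y xs /\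
    forall i, x' i = if i \in nonneg_idx x
                     then x i + (1 - x i) * flip eps (nonneg_idx x) xs i
                     else x i.

Definition ppc_output m n (eps : R) (A : 'M[R]_(m, n)) (x y x' : 'I_n -> R) : Prop :=
  if (2 * #|nonneg_idx x| < n)%N
  then exists x'', ppc_main eps A (fun i => - x i) y x'' /\ (forall i, x' i = - x'' i)
  else ppc_main eps A x y x'.

Definition iid_std_gaussian d (Omega : measurableType d) (P : probability Omega R)
  n (y : 'I_n -> Omega -> R) : Prop :=
  (forall i, measurable_fun setT (y i)) /\
  (forall B : 'I_n -> set R, (forall i, measurable (B i)) ->
     P (\bigcap_i (y i @^-1` B i)) = (\prod_(i < n) normal_prob 0 1 (B i))%E).

Definition good_output m n (eps C : R) (A : 'M[R]_(m, n)) (x x' : 'I_n -> R) : Prop :=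
  (forall i, -1 <= x' i <= 1) /\
  eps / 4 * n%:R <= #|[set i | (x' i == 1) || (x' i == -1)]|%:R /\
  (forall l : nat, (l <= n)%N -> forall j : 'I_m,
     `| \sum_(i : 'I_n | (i < l)%N) A j i * (x' i - x i) | <= C * Num.sqrt (m%:R)).

End PPC.

(* Main.v *)
(** Let [gamma] be the standard Gaussian measure, [I] the set of nonnegative
    coordinates and [N = #|I| >= n / 2].  For [S] included in [I] let [K_S] be
    the symmetric body of all [y] satisfying the prefix constraints (with the
    columns of [A] scaled by [1 - x i]) and [|y i| <= 1] for [i] in [S].

    Both halves of the argument rest on a "difference" form of the
    Prekopa-Leindler inequality: if
    [f x * g y <= h ((x - y) / 2) ^ 2 * exp (|x + y|^2 / 4)] then
    [gamma f * gamma g <= (gamma h) ^ 2].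

    (1) [gamma K_S >= exp (- delta N - 4 #|S| - 1) / 5] with [delta = 0.0042].
    Each row walk is quantized at the multiples of a power of two [2 ^ k0] close
    to [m] by a sigma-delta scheme, whose expected number of resets is controlled
    by an energy inequality, and between these multiples by the truncated sums
    over dyadic blocks; the coordinates in [S] are truncated as well.  By
    Markov's inequality the weighted size of all these integers is typically
    small, so by pigeonhole a single value of them is taken on a cell [B] with
    [gamma B >= exp (- delta N - 4 #|S| - 1) / 5].  Since
    [(B - B) / 2] is contained in [K_S], [gamma B <= gamma K_S].

    (2) With [f = exp (r^2 / 4) 1_F], [g = 1_(K_S)], [h = 1] the same inequality
    shows that the set [F] of points at distance at least [r] from [K_S] has
    measure at most [exp (- r^2 / 4) / gamma K_S].  A union bound over all
    [S] with [#|S| <= eps N] then gives, with high probability, points of every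
    such [K_S] at squared distance at most [0.02445 N] from the sample [y].

    On the other hand, with high probability more than [0.02446 N] entries of
    [y] exceed [2] in absolute value, so that the cube is farther than that.  If
    the projection of [y] had fewer than [eps N] entries in [{-1, 1}], then, with
    [S] the set of these, a small step from the projection towards the point of
    [K_S] would remain feasible, whence the projection would be at least as
    close to [y] as that point: a contradiction.

    For bounded [n] it suffices that one entry of [y] lies in [[2, 3]] while all
    others are tiny: then [y] satisfies the prefix constraints and is outside
    the cube, and its projection has at least one tight entry. *)

Require Import Defs.
From HB Require Import structures.
From mathcomp Require Import all_boot all_order all_algebra.
From mathcomp Require Import all_classical all_reals all_analysis.
From mathcomp Require Import measurable_realfun ring lra.
Set Implicit Arguments. Unset Strict Implicit. Unset Printing Implicit Defensive.
Import Order.TTheory GRing.Theory Num.Theory numFieldNormedType.Exports.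
Local Open Scope classical_set_scope.
Local Open Scope ring_scope.

(** * The Prekopa-Leindler inequality *)

Section Affine.
Variable R : realType.
Notation mu := (@lebesgue_measure R).

Lemma measurable_affine (a b : R) :
  measurable_fun setT ((fun x => a * x + b) : measurableTypeR R -> measurableTypeR R).
Proof. by apply: measurable_funD => //; apply: measurable_funM. Qed.

(** The image measure scaled by [|a|] agrees with Lebesgue measure on half-open intervals, and
    uniqueness extends this to all measurable sets. *)
Lemma lebesgue_measure_affine (a b : R) (A : set R) : a != 0 -> measurable A ->
  mu ((fun x => a * x + b) @^-1` A) = ((`|a|^-1)%:E * mu A)%E.
Proof.
move=> a0 mA.
pose nu := pushforward mu ((fun x => a * x + b) : measurableTypeR R -> measurableTypeR R).
have h : forall X, ocitv X -> mu X = (`|a|%:E * nu X)%E.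
  move=> _ [[u v] _ <-] /=.
  rewrite /nu /pushforward.
  have [uv|vu] := ltP u v; last first.
    by rewrite set_itv_ge ?bnd_simp -?leNgt// preimage_set0 !measure0 mule0.
  have [ap|an] := ltP 0 a.
    have -> : (fun x => a * x + b) @^-1` `]u, v] = `](u - b) / a, (v - b) / a]%classic.
      apply/seteqP; split => x /=; rewrite !in_itv/= ltr_pdivrMr// ler_pdivlMr//; lra.
    rewrite !lebesgue_measure_itv/= !lte_fin uv ltr_pM2r ?invr_gt0//.
    rewrite ifT; last by lra.
    by rewrite -!EFinB -EFinM; congr EFin; rewrite gtr0_norm//; field.
  (* A negative slope exchanges the endpoints, so the preimage becomes closed on the left. *)
  have {an}an : a < 0 by rewrite lt_neqAle a0.
  have -> : (fun x => a * x + b) @^-1` `]u, v] = `[(v - b) / a, (u - b) / a[%classic.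
    apply/seteqP; split => x /=; rewrite !in_itv/= ltr_ndivlMr// ler_ndivrMr//; lra.
  rewrite !lebesgue_measure_itv/= !lte_fin uv ltr_nM2r ?invr_lt0//.
  rewrite ifT; last by lra.
  by rewrite -!EFinB -EFinM; congr EFin; rewrite ltr0_norm//; field.
pose na := NngNum (normr_ge0 a).
have ma : measurable_fun setT ((fun x => a * x + b) : measurableTypeR R -> measurableTypeR R).
  exact: measurable_affine.
pose f : {mfun measurableTypeR R >-> measurableTypeR R} :=
  HB.pack ((fun x => a * x + b) : measurableTypeR R -> measurableTypeR R)
   (isMeasurableFun.Build _ _ _ _ _ ma).
have := @lebesgue_measure_unique R (mscale na (pushforward mu f)) h A mA.
rewrite /mscale /= /pushforward => ->.
by rewrite muleA -EFinM mulVf ?mul1e// normr_eq0.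
Qed.
End Affine.

(** * One-dimensional Brunn-Minkowski inequality for half differences *)

Section BrunnMinkowski.
Variable R : realType.
Notation mu := (@lebesgue_measure R).

(* With [a'], [b'] near the suprema of [A], [B], the sets [(A - b') / 2] and
   [(a' - B) / 2] lie in [C] and overlap in a short interval at most. *)
Lemma lebesgue_halfdiff_bounded (A B C : set R) (k : R) :
  measurable A -> measurable B -> measurable C ->
  A !=set0 -> B !=set0 -> A `<=` `[-k, k] -> B `<=` `[-k, k] ->
  (forall a b, A a -> B b -> C ((a - b) / 2)) ->
  (mu A + mu B <= 2%:E * mu C)%E.
Proof.
move=> mA mB mC A0 B0 Ak Bk ABC.
have supA : has_sup A by split => //; exists k => x /Ak; rewrite /= in_itv/= => /andP[].
have supB : has_sup B by split => //; exists k => x /Bk; rewrite /= in_itv/= => /andP[].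
apply/lee_addgt0Pr => e e0.
have e4 : 0 < e / 4 by lra.
have [a' Aa' ha] := sup_adherent e4 supA.
have [b' Bb' hb] := sup_adherent e4 supB.
set al := sup A in ha; set be := sup B in hb.
have Aal x : A x -> x <= al by move=> ?; apply: sup_upper_bound.
have Bbe x : B x -> x <= be by move=> ?; apply: sup_upper_bound.
have n2 : (2 : R) != 0 by rewrite pnatr_eq0.
have n2' : (-2 : R) != 0 by rewrite oppr_eq0.
pose P1 := (fun x => 2 * x + b') @^-1` A.
pose P2 := (fun x => -2 * x + a') @^-1` B.
have mP1 : measurable P1.
  by rewrite -[P1]setTI; exact: (measurable_affine 2 b').
have mP2 : measurable P2.
  by rewrite -[P2]setTI; exact: (measurable_affine (-2) a').
have e1 : mu P1 = (2^-1%:E * mu A)%E.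
  by rewrite lebesgue_measure_affine// ger0_norm.
have e2 : mu P2 = (2^-1%:E * mu B)%E.
  by rewrite lebesgue_measure_affine// normrN ger0_norm.
(* All of [P2] lies to the right of [c], while [P1] exceeds [c] by less than [e / 4]. *)
pose c := (a' - be) / 2.
have mP1' : measurable (P1 `&` `]-oo, c[) by apply: measurableI.
have dj : [disjoint (P1 `&` `]-oo, c[) & P2].
  apply/disj_setPS => x [[_ /=]]; rewrite in_itv/= => xc /Bbe; rewrite /c in xc; lra.
have le1 : (mu P1 <= mu (P1 `&` `]-oo, c[) + (e / 4)%:E)%E.
  have sub : P1 `<=` (P1 `&` `]-oo, c[) `|` `[c, c + e / 4].
    move=> x P1x; have [xc|cx] := ltP x c; [left|right]; rewrite /= ?in_itv//=.
    rewrite cx /=; have := Aal _ P1x; rewrite /c; lra.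
  apply: (@le_trans _ _ (mu ((P1 `&` `]-oo, c[) `|` `[c, c + e / 4]))).
    by apply: le_measure; rewrite ?inE//; apply: measurableU.
  apply: (le_trans (measureU2 _ _ _)) => //.
  apply: leeD2l; have := lebesgue_measure_itv `[c, c + e / 4]; rewrite /= lte_fin ltrDl e4 => ->.
  rewrite -EFinB lee_fin; lra.
have le2 : (mu (P1 `&` `]-oo, c[) + mu P2 <= mu C)%E.
  rewrite -measureU//; last by apply/eqP; rewrite -disj_set2E.
  apply: le_measure; rewrite ?inE//; first exact: measurableU.
  move=> x [[P1x _]|P2x].
    have -> : x = (2 * x + b' - b') / 2 by field.
    exact: ABC.
  have -> : x = (a' - (-2 * x + a')) / 2 by field.
  exact: ABC.
have -> : (mu A = 2%:E * mu P1)%E by rewrite e1 muleA -EFinM divff// mul1e.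
have -> : (mu B = 2%:E * mu P2)%E by rewrite e2 muleA -EFinM divff// mul1e.
apply: (@le_trans _ _ (2%:E * (mu C + (e/4)%:E))%E).
  rewrite -ge0_muleDr// lee_pmul2l//.
  apply: (@le_trans _ _ (mu (P1 `&` `]-oo, c[) + (e / 4)%:E + mu P2)%E).
    exact: leeD2r.
  by rewrite addeAC; exact: leeD2r.
rewrite ge0_muleDr//; last by rewrite lee_fin; lra.
by apply: leeD2l; rewrite -EFinM lee_fin; lra.
Qed.

(** Both sets are cut to growing windows, and the measure is continuous from below. *)
Lemma lebesgue_halfdiff (A B C : set R) :
  measurable A -> measurable B -> measurable C ->
  A !=set0 -> B !=set0 ->
  (forall a b, A a -> B b -> C ((a - b) / 2)) ->
  (mu A + mu B <= 2%:E * mu C)%E.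
Proof.
move=> mA mB mC [a0 Aa0] [b0 Bb0] ABC.
(* Every window contains [a0] and [b0], so the cut sets stay nonempty, as the bounded case
   requires. *)
pose K := `|a0| + `|b0|.
pose I (k : nat) : set R := `[- (K + k%:R), K + k%:R]%classic.
have mI k : measurable (I k) by exact: measurable_itv.
have ndI : nondecreasing_seq I.
  move=> i j ij; apply/subsetPset => x; rewrite /I/= !in_itv/=.
  have : (i%:R : R) <= j%:R by rewrite ler_nat.
  lra.
have UI (X : set R) : \bigcup_k (X `&` I k) = X.
  apply/seteqP; split => [x [k _ []//]|x Xx].
  exists (Num.truncn `|x|).+1 => //; split => //.
  rewrite /I/= in_itv/= -ler_norml (le_trans (ltW (truncnS_gt _)))//.
  by rewrite lerDr addr_ge0.
have cvgI (X : set R) : measurable X -> mu (X `&` I k) @[k --> \oo] --> mu X.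
  move=> mX; rewrite -[in X in _ --> X](UI X).
  apply: nondecreasing_cvg_mu => //.
  - by move=> k; apply: measurableI => //; exact: mI.
  - by rewrite UI.
  - move=> i j ij; apply/subsetPset; apply: setIS; exact/subsetPset/ndI.
have cAB : mu (A `&` I k) + mu (B `&` I k) @[k --> \oo] --> (mu A + mu B)%E.
  by apply: cvgeD; [rewrite ge0_adde_def// inE| exact: cvgI|exact: cvgI].
rewrite -(cvg_lim _ cAB)//; apply: lime_le; first by apply/cvg_ex; eexists; exact: cAB.
apply: nearW => k.
apply: (@lebesgue_halfdiff_bounded _ _ _ (K + k%:R)) => //; try by apply: measurableI => //; exact: mI.
- exists a0; split=> //; rewrite /I/= in_itv/= -ler_norml /K -addrA lerDl.
  by rewrite addr_ge0.
- exists b0; split=> //; rewrite /I/= in_itv/= -ler_norml /K addrAC lerDr.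
  by rewrite addr_ge0.
- by move=> a b [Aa _] [Bb _]; exact: ABC.
Qed.

(** Tonelli on the region under the graph. The levels stop at 1 because functions with supremum 1
    have nonempty superlevel sets exactly up to there. *)
Lemma layer_cake01 (w : R -> R) : measurable_fun setT w -> (forall x, 0 <= w x) ->
  (\int[mu]_x (Num.min (w x) 1)%:E =
   \int[mu]_(t in `]0%R, 1%R[) mu [set x | t < w x]%R)%E.
Proof.
move=> mw w0.
pose G : set (measurableTypeR R * measurableTypeR R) :=
  [set p | p.2 < w p.1] `&` ([set p | 0 < p.2] `&` [set p | p.2 < 1]).
have mG : measurable G.
  have mlt (f g : measurableTypeR R * measurableTypeR R -> R) : measurable_fun setT f -> measurable_fun setT g ->
     measurable [set p | f p < g p].
    move=> mf mg; have := measurable_fun_ltr mf mg.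
    by move=> /(_ measurableT [set true]); rewrite setTI; exact.
  apply: measurableI; [|apply: measurableI].
  - apply: mlt => //; exact: (measurableT_comp mw).
  - exact: mlt.
  - exact: mlt.
transitivity (\int[mu]_x \int[mu]_t (\1_G (x, t))%:E)%E.
  apply: eq_integral => x _.
  transitivity (\int[mu]_t (\1_(`]0%R, (Num.min (w x) 1)[%classic : set R) t)%:E)%E; last first.
    apply: eq_integral => t _; rewrite !indicE; congr ((_ : bool)%:R%:E).
    apply/idP/idP; rewrite !inE /G/= in_itv/= lt_min.
      by move=> /and3P[? ? ?].
    by move=> [? [? ?]]; apply/and3P.
  rewrite integral_indic// setIT.
  have := lebesgue_measure_itv `]0%R, (Num.min (w x) 1)[; rewrite /= lte_fin => ->.
  have : 0 <= Num.min (w x) 1 by rewrite le_min w0 ler01.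
  by rewrite le_eqVlt => /predU1P[<-|->]; rewrite ?ltxx// oppr0 adde0.
rewrite (fubini_tonelli (fun p => (\1_G p)%:E))//=; last first.
  exact/measurable_EFinP/measurable_indic.
rewrite [RHS]integral_mkcond; apply: eq_integral => t _.
rewrite patchE; case: ifPn => [|] ; rewrite (inE, notin_setE)/= in_itv/=.
  move=> /andP[t0 t1]; rewrite -[X in mu X]setIT -integral_indic//; last first.
    by have := mw measurableT `]t, +oo[%classic (measurable_itv _); rewrite setTI /preimage/=; under eq_set do rewrite in_itv/= andbT.
  apply: eq_integral => x _; rewrite !indicE; congr ((_ : bool)%:R%:E).
  by apply/idP/idP; rewrite !inE /G/= => // -[].
move=> t01; rewrite integral0_eq// => x _; rewrite indicE memNset//.
by rewrite /G /= => -[_ [t0 t1]]; apply: t01; rewrite t0.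
Qed.
End BrunnMinkowski.

(** * The functional inequality for Lebesgue measure *)

Section PrekopaLeindlerLebesgue.
Variable R : realType.
Notation mu := (@lebesgue_measure R).
Notation gam := (@normal_prob R 0 1).
Notation phi := (@normal_pdf R 0 1).

(** The Radon-Nikodym derivative of the Gaussian measure equals its density almost everywhere, since
    both have the same integral over every measurable set. *)
Lemma ge0_integral_normal_prob (f : R -> \bar R) :
  measurable_fun setT f -> (forall x, 0 <= f x)%E ->
  (\int[gam]_x f x = \int[mu]_x (f x * (phi x)%:E))%E.
Proof.
move=> mf f0.
have dom := @normal_prob_dominates R 0 1.
rewrite -(@Radon_Nikodym_SigmaFinite.change_of_variables _ _ _ gam mu dom f setT)//.
apply: ae_eq_integral => //.
- apply: emeasurable_funM => //; apply: measurable_int.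
  exact: Radon_Nikodym_SigmaFinite.f_integrable.
- by apply: emeasurable_funM => //=; apply/measurable_EFinP; exact: measurable_normal_pdf.
- apply: ae_eqe_mul2l; apply: integral_ae_eq => //.
  + exact: Radon_Nikodym_SigmaFinite.f_integrable.
  + by apply/measurable_EFinP; exact: measurable_normal_pdf.
  + by move=> E _ mE; rewrite -Radon_Nikodym_SigmaFinite.f_integral.
Qed.

Lemma measurable_superlevel (w : measurableTypeR R -> R) : measurable_fun setT w ->
  measurable_fun setT (fun t : measurableTypeR R => mu [set x | t < w x]).
Proof.
move=> mw.
pose G : set (measurableTypeR R * measurableTypeR R) := [set p | p.2 < w p.1].
have mG : measurable G.
  have mf : measurable_fun setT (fun p : measurableTypeR R * measurableTypeR R => w p.1).
    exact: (measurableT_comp mw).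
  have mg : measurable_fun setT (fun p : measurableTypeR R * measurableTypeR R => p.2 : R) by exact: measurable_snd.
  have := measurable_fun_ltr mg mf.
  by move=> /(_ measurableT [set true]); rewrite setTI; exact.
have := measurable_fun_ysection mu mG.
congr (measurable_fun _ _); apply/funext => t /=; congr (mu _).
by apply/seteqP; split=> x; rewrite /ysection/= inE.
Qed.

(** If [t < u a] and [t < v b] with [0 < t], then [t < w ((a - b) / 2)]. Hence the half-difference
    inequality holds between superlevel sets, and integrating over [t] gives this additive form. *)
Lemma prekopa_leindler_normalized (u v w : R -> R) :
  measurable_fun setT u -> measurable_fun setT v -> measurable_fun setT w ->
  (forall x, 0 <= u x <= 1) -> (forall x, 0 <= v x <= 1) -> (forall x, 0 <= w x) ->
  (forall t, t < 1 -> exists x, t < u x) -> (forall t, t < 1 -> exists x, t < v x) ->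
  (forall x y, u x * v y <= w ((x - y) / 2) ^+ 2) ->
  (\int[mu]_x (u x)%:E + \int[mu]_x (v x)%:E <= 2%:E * \int[mu]_x (w x)%:E)%E.
Proof.
move=> mu_ mv mw u01 v01 w0 su sv uvw.
have min1 (f : R -> R) : (forall x, 0 <= f x <= 1) ->
    (\int[mu]_x (f x)%:E = \int[mu]_x (Num.min (f x) 1)%:E)%E.
  by move=> f01; apply: eq_integral => x _; rewrite min_l//; have /andP[] := f01 x.
have mslev (f : measurableTypeR R -> R) : measurable_fun setT f ->
    measurable_fun (`]0, 1[%classic : set (measurableTypeR R)) (fun t => mu [set x | t < f x]).
  by move=> mf; apply: (@measurable_funS _ _ _ _ setT) => //; exact: measurable_superlevel.
rewrite (min1 u)// (min1 v)// !layer_cake01//; try by move=> x; case/andP: (u01 x); case/andP: (v01 x).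
rewrite -ge0_integralD//=; [|exact: (mslev _ mu_)|exact: (mslev _ mv)].
apply: (@le_trans _ _ (2%:E * \int[mu]_x (Num.min (w x) 1)%:E)%E); last first.
  rewrite lee_pmul2l//; apply: ge0_le_integral => //.
  - by move=> x _; rewrite lee_fin le_min w0 ler01.
  - by apply/measurable_EFinP; apply: measurable_minr.
  - exact/measurable_EFinP.
  - by move=> x _; rewrite lee_fin ge_min lexx.
rewrite layer_cake01// -ge0_integralZl//=; last by exact: (mslev _ mw).
have mlev (f : R -> R) t : measurable_fun setT f -> measurable [set x | t < f x].
  move=> mf; have := mf measurableT `]t, +oo[%classic (measurable_itv _).
  by rewrite setTI /preimage/=; under eq_set do rewrite in_itv/= andbT.
apply: ge0_le_integral => //=.
- by move=> t _; exact: adde_ge0.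
- by apply: emeasurable_funD; [exact: (mslev _ mu_)|exact: (mslev _ mv)].
- by apply: emeasurable_funM => //; exact: (mslev _ mw).
move=> t; rewrite in_itv/= => /andP[t0 t1].
apply: lebesgue_halfdiff; try exact: mlev.
- by have [x] := su t t1; exists x.
- by have [x] := sv t t1; exists x.
move=> a b /= ta tb.
have h := uvw a b.
have : t ^+ 2 < w ((a - b) / 2) ^+ 2.
  by apply: lt_le_trans h; rewrite expr2; apply: ltr_pM => //; exact: ltW.
by rewrite ltr_pXn2r ?nnegrE//; exact: ltW.
Qed.

(** Dividing [u] and [v] by their suprema and [w] by the geometric mean of these reduces to the
    normalized case; the inequality [4 U V <= (U + V) ^ 2] then turns the sum into a product. *)
Lemma prekopa_leindler_lebesgue (u v w : R -> R) (M : R) :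
  measurable_fun setT u -> measurable_fun setT v -> measurable_fun setT w ->
  (forall x, 0 <= u x <= M) -> (forall x, 0 <= v x <= M) -> (forall x, 0 <= w x) ->
  (forall x y, u x * v y <= w ((x - y) / 2) ^+ 2) ->
  (\int[mu]_x (u x)%:E * \int[mu]_x (v x)%:E <= (\int[mu]_x (w x)%:E) ^+ 2)%E.
Proof.
move=> mu_ mv mw u0M v0M w0 uvw.
have hs (f : R -> R) : (forall x, 0 <= f x <= M) -> has_sup (range f).
  move=> f0M; split; first by exists (f 0), 0.
  by exists M => _ [x _ <-]; case/andP: (f0M x).
pose a := sup (range u); pose b := sup (range v).
have ua x : u x <= a by apply: (sup_upper_bound (hs _ u0M)); exists x.
have vb x : v x <= b by apply: (sup_upper_bound (hs _ v0M)); exists x.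
have u0 x : 0 <= u x by case/andP: (u0M x).
have v0 x : 0 <= v x by case/andP: (v0M x).
have zero (f : R -> R) (s : R) : s <= 0 -> (forall x, 0 <= f x) -> (forall x, f x <= s) ->
    (\int[mu]_x (f x)%:E = 0)%E.
  move=> s0 f0 fs; apply: integral0_eq => x _; congr EFin.
  by apply/eqP; rewrite eq_le f0 (le_trans (fs x)).
(* A nonpositive supremum forces the function to vanish, so the left-hand side is zero. *)
have [a0|a0] := leP a 0; first by rewrite (zero u a)// mul0e expe_ge0// integral_ge0// => x _; rewrite lee_fin.
have [b0|b0] := leP b 0; first by rewrite (zero v b)// mule0 expe_ge0// integral_ge0// => x _; rewrite lee_fin.
pose c := Num.sqrt (a * b).
have c0 : 0 < c by rewrite sqrtr_gt0 mulr_gt0.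
have c2 : c ^+ 2 = a * b by rewrite sqr_sqrtr// mulr_ge0// ltW.
have scal (f : R -> R) s : 0 < s -> measurable_fun setT f -> (forall x, 0 <= f x) ->
   (\int[mu]_x (f x)%:E = s%:E * \int[mu]_x (f x / s)%:E)%E.
  move=> s0 mf f0; rewrite -ge0_integralZl//.
  - by apply: eq_integral => x _; rewrite -EFinM mulrC divfK// gt_eqF.
  - by apply/measurable_EFinP; apply: measurable_funM.
  - by move=> x _; rewrite lee_fin divr_ge0// ltW.
  - by rewrite lee_fin ltW.
have sdiv (f : R -> R) s : 0 < s -> s = sup (range f) -> has_sup (range f) -> forall t, t < 1 -> exists x, t < f x / s.
  move=> s0 sE hsf t t1.
  have e0 : 0 < s * (1 - t) by rewrite mulr_gt0// subr_gt0.
  have [_ [x _ <-]] := sup_adherent e0 hsf.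
  rewrite -sE => h; exists x; rewrite ltr_pdivlMr//; lra.
have H := @prekopa_leindler_normalized (fun x => u x / a) (fun x => v x / b) (fun x => w x / c).
rewrite (scal u a)// (scal v b)// (scal w c)//.
move: H => /(_ _ _ _ _ _ _ (sdiv _ _ a0 erefl (hs _ u0M)) (sdiv _ _ b0 erefl (hs _ v0M))).
set U := integral _ _ _; set V := integral _ _ _; set W := integral _ _ _ => H.
have U0 : (0 <= U)%E by apply: integral_ge0 => x _; rewrite lee_fin divr_ge0// ltW.
have V0 : (0 <= V)%E by apply: integral_ge0 => x _; rewrite lee_fin divr_ge0// ltW.
have W0 : (0 <= W)%E by apply: integral_ge0 => x _; rewrite lee_fin divr_ge0// ltW.
have {}H : (U + V <= 2%:E * W)%E.
  apply: H.
  - by apply: measurable_funM.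
  - by apply: measurable_funM.
  - by apply: measurable_funM.
  - by move=> x; rewrite divr_ge0//= ?ler_pdivrMr// ?mul1r// ltW.
  - by move=> x; rewrite divr_ge0//= ?ler_pdivrMr// ?mul1r// ltW.
  - by move=> x; rewrite divr_ge0// ltW.
  - move=> x y; rewrite expr_div_n c2 mulf_div ler_pM2r ?invr_gt0 ?mulr_gt0//.
move: U V W U0 V0 W0 H => [U| |] [V| |] [W| |]//; rewrite ?lee_fin => U0 V0 W0 H;
  try (by rewrite ?gt0_muley ?lte_fin// leey).
- have {}H : U + V <= 2 * W by [].
  rewrite (_ : a * U * (b * V) = a * b * (U * V)); last by ring.
  rewrite (_ : c * W * (c * W) = c ^+ 2 * W ^+ 2); last by ring.
  have U0' : 0 <= U by []. have V0' : 0 <= V by [].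
  rewrite c2 ler_pM2l ?mulr_gt0//.
  have h1 : (U + V) ^+ 2 <= (2 * W) ^+ 2.
    by rewrite ler_sqr ?nnegrE ?addr_ge0// (le_trans _ H)// addr_ge0.
  have := sqr_ge0 (U - V); nra.
- have -> : (c%:E * +oo = +oo :> \bar R)%E by rewrite gt0_muley ?lte_fin.
  by rewrite expe2 mulyy leey.
Qed.
End PrekopaLeindlerLebesgue.

(** * Gaussian form of the inequality and its tensorization *)

Section PrekopaLeindlerGauss.
Variable R : realType.
Notation mu := (@lebesgue_measure R).
Notation gam := (@normal_prob R 0 1).
Notation phi := (@normal_pdf R 0 1).

(** The bound keeps suprema and partial integrals finite, so the class is stable under integrating
    out a factor. *)
Definition bounded_mfun d (T : measurableType d) (f : T -> R) :=
  measurable_fun setT f /\ exists M, forall x, 0 <= f x <= M.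

(* For a Gaussian measure one takes [dif x y = (x - y) / 2] and
   [cost x y = |x + y|^2 / 4], because
   [|x|^2 / 2 + |y|^2 / 2 = |(x - y) / 2|^2 + |x + y|^2 / 4]. *)
Definition prekopa_leindler d (T : measurableType d) (P : probability T R)
    (dif : T -> T -> T) (cost : T -> T -> R) :=
  forall f g h : T -> R, bounded_mfun f -> bounded_mfun g -> bounded_mfun h ->
  (forall x y, f x * g y <= h (dif x y) ^+ 2 * expR (cost x y)) ->
  (\int[P]_x (f x)%:E * \int[P]_x (g x)%:E <= (\int[P]_x (h x)%:E) ^+ 2)%E.

Lemma normal_pdf01E x : phi x = normal_peak 1 * expR (- x ^+ 2 / 2).
Proof.
by rewrite normal_pdfE ?oner_eq0// /normal_fun subr0 expr1n.
Qed.

Lemma prekopa_leindler_gauss :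
  prekopa_leindler (gam : probability _ R) (fun x y => (x - y) / 2) (fun x y => (x + y) ^+ 2 / 4).
Proof.
move=> f g h [mf [Mf fM]] [mg [Mg gM]] [mh [Mh hM]] fgh.
have p0 x : 0 <= phi x by exact: normal_pdf_ge0.
have pk x : phi x <= normal_peak 1 by apply: normal_pdf_ub; exact: oner_neq0.
have mphi := @measurable_normal_pdf R 0 1.
have E (k : R -> R) M : measurable_fun setT k -> (forall x, 0 <= k x <= M) ->
    (\int[gam]_x (k x)%:E = \int[mu]_x (k x * phi x)%:E)%E.
  move=> mk kM; rewrite ge0_integral_normal_prob//; first exact/measurable_EFinP.
  by move=> x; rewrite lee_fin; case/andP: (kM x).
rewrite (E f Mf)// (E g Mg)// (E h Mh)//.
pose M := Num.max Mf Mg * normal_peak 1.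
have bd (k : R -> R) K x : (forall x, 0 <= k x <= K) -> K <= Num.max Mf Mg -> 0 <= k x * phi x <= M.
  move=> kK KM; have /andP[k0 k1] := kK x; rewrite mulr_ge0//= /M ler_pM// (le_trans k1)//.
apply: (@prekopa_leindler_lebesgue _ _ _ _ M).
- exact: measurable_funM.
- exact: measurable_funM.
- exact: measurable_funM.
- by move=> x; apply: (bd f Mf) => //; rewrite le_max lexx.
- by move=> x; apply: (bd g Mg) => //; rewrite le_max lexx orbT.
- by move=> x; rewrite mulr_ge0//; case/andP: (hM x).
move=> x y; rewrite mulrACA exprMn.
have -> : phi ((x - y) / 2) ^+ 2 = expR ((x + y) ^+ 2 / 4) * (phi x * phi y).
  rewrite !normal_pdf01E; set A := - _ / 2; set B := - _ / 2; set D := - _ / 2.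
  have : expR A ^+ 2 = expR ((x + y) ^+ 2 / 4) * (expR B * expR D).
    by rewrite -expRM_natl -!expRD; congr expR; rewrite /A /B /D; field.
  by rewrite exprMn => ->; ring.
by rewrite [leRHS]mulrA ler_wpM2r// mulr_ge0.
Qed.

Lemma measurable_curry_l d1 d2 (T1 : measurableType d1) (T2 : measurableType d2) d3 (T3 : measurableType d3)
  (f : T1 * T2 -> T3) x : measurable_fun setT f -> measurable_fun setT (fun y => f (x, y)).
Proof. by move=> mf; apply: (measurableT_comp mf); exact: measurable_pair1. Qed.

(** For fixed [x] and [y] the inequality on the second factor yields the pointwise hypothesis for
    the partial integrals, to which the inequality on the first factor applies. *)
Lemma prekopa_leindler_prod d1 d2 (T1 : measurableType d1) (T2 : measurableType d2)
   (P1 : probability T1 R) (P2 : probability T2 R) dif1 cost1 dif2 cost2 (P : probability (T1 * T2)%type R) :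
   (forall A, measurable A -> P A = (P1 \x P2)%E A) ->
   prekopa_leindler P1 dif1 cost1 -> prekopa_leindler P2 dif2 cost2 ->
   prekopa_leindler P (fun x y => (dif1 x.1 y.1, dif2 x.2 y.2))
      (fun x y => cost1 x.1 y.1 + cost2 x.2 y.2).
Proof.
move=> PE H1 H2 f g h bf bg bh fgh.
have EP (k : T1 * T2 -> R) : bounded_mfun k ->
   (exists2 K : T1 -> R, bounded_mfun K & (forall x, (\int[P2]_y (k (x, y))%:E = (K x)%:E)%E) /\
    (\int[P]_z (k z)%:E = \int[P1]_x (K x)%:E)%E).
  move=> [mk [M kM]].
  have k0 z : 0 <= k z by case/andP: (kM z).
  have M0 x : (\int[P2]_y (k (x, y))%:E <= M%:E)%E.
    apply: (@le_trans _ _ (\int[P2]_y (cst M%:E) y)%E).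
      apply: ge0_le_integral => //.
      - by move=> y _; rewrite lee_fin.
      - by apply/measurable_EFinP; exact: measurable_curry_l.
      - by move=> y Dy; have /andP[_] := kM (x, y); rewrite lee_fin.
    by rewrite integral_cst//= probability_setT mule1.
  have I0 x : (0 <= \int[P2]_y (k (x, y))%:E)%E by apply: integral_ge0 => y _; rewrite lee_fin.
  have fin x : (\int[P2]_y (k (x, y))%:E)%E \is a fin_num.
    by rewrite ge0_fin_numE//; apply: le_lt_trans (M0 x) _; rewrite ltry.
  exists (fun x => fine (\int[P2]_y (k (x, y))%:E)).
    split.
      apply: measurableT_comp => //.
      by apply: (measurable_fun_fubini_tonelli_F (fun z => (k z)%:E)) => //; exact/measurable_EFinP.
    exists M => x; rewrite fine_ge0//=.
    by rewrite -lee_fin fineK.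
  split; first by move=> x; rewrite fineK.
  transitivity (\int[(P1 \x P2)%E]_z (k z)%:E)%E.
    by apply: eq_measure_integral => A mA _; exact: PE.
  rewrite fubini_tonelli1//=; last exact/measurable_EFinP.
  by apply: eq_integral => x _; rewrite /fubini_F fineK.
have [F bF [FE ->]] := EP f bf.
have [G bG [GE ->]] := EP g bg.
have [H bH [HE ->]] := EP h bh.
apply: H1 => // x y.
have sec (k : T1 * T2 -> R) z : bounded_mfun k -> bounded_mfun (fun y => k (z, y)).
  by move=> [mk [M kM]]; split; [exact: measurable_curry_l|exists M => t].
(* The first cost is absorbed into [h], which enters squared; hence the factor 1/2. *)
pose c := expR (cost1 x y / 2).
have c0 : 0 < c by exact: expR_gt0.
have c2 : c ^+ 2 = expR (cost1 x y) by rewrite -expRM_natl; congr expR; field.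
have := H2 (fun t => f (x, t)) (fun t => g (y, t)) (fun t => h (dif1 x y, t) * c) (sec _ _ bf) (sec _ _ bg).
rewrite FE GE.
have -> : (\int[P2]_t (h (dif1 x y, t) * c)%:E = (H (dif1 x y) * c)%:E)%E.
  rewrite EFinM -HE -ge0_integralZr//.
  - by apply/measurable_EFinP; apply: measurable_curry_l; case: bh.
  - by move=> t _; rewrite lee_fin; case: bh => _ [M hM]; case/andP: (hM (dif1 x y, t)).
  - by rewrite lee_fin ltW.
rewrite -EFinM -EFin_expe lee_fin exprMn c2; apply.
  have [mh [M hM]] := sec _ (dif1 x y) bh; split; first exact: measurable_funM.
  by exists (M * c) => t; have /andP[h0 h1] := hM t; rewrite mulr_ge0 ?ler_pM2r//= ltW.
move=> t t'; rewrite exprMn c2 -mulrA -expRD.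
exact: (fgh (x, t) (y, t')).
Qed.
End PrekopaLeindlerGauss.

(** * Gaussian space *)

Section ProductProbability.
Context d1 d2 (T1 : measurableType d1) (T2 : measurableType d2) (R : realType).
Variables (P1 : probability T1 R) (P2 : probability T2 R).
Definition prod_prob : set (T1 * T2) -> \bar R := (P1 \x P2)%E.
HB.instance Definition _ := Measure.on prod_prob.
Lemma prod_prob_setT : prod_prob setT = 1%E.
Proof.
rewrite /prod_prob -setXTT product_measure1E//.
by rewrite -[RHS]mule1; congr (_ * _)%E; exact: probability_setT.
Qed.
HB.instance Definition _ := Measure_isProbability.Build _ _ R prod_prob prod_prob_setT.
End ProductProbability.

Section GaussianSpace.
Variable R : realType.
Notation gam := (@normal_prob R 0 1).

(** The display of the sigma-algebra changes with [n], so the recursion has to produce it together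
    with the type. *)
Fixpoint rn_pack (n : nat) : {d : measure_display & measurableType d} :=
  if n is n'.+1
  then existT (fun d => measurableType d) _ ((measurableTypeR R * projT2 (rn_pack n'))%type : measurableType _)
  else existT (fun d => measurableType d) default_measure_display (unit : measurableType _).

Definition rn_disp n := projT1 (rn_pack n).
Definition rn n : measurableType (rn_disp n) := projT2 (rn_pack n).

Fixpoint gauss_rn (n : nat) : probability (rn n) R :=
  match n return probability (rn n) R with
  | 0 => (@dirac _ unit tt R : probability unit R)
  | n'.+1 => (prod_prob (gam : probability _ R) (gauss_rn n') : probability _ R)
  end.

(* The head of the tuple carries the last coordinate, so that the past of a
   process is the tail. *)
Fixpoint coordn (n : nat) : rn n -> nat -> R :=
  match n return rn n -> nat -> R with
  | 0 => fun _ _ => 0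
  | n'.+1 => fun p i => if i == n' then p.1 else coordn p.2 i
  end.

Fixpoint mk_rn (n : nat) (y : nat -> R) : rn n :=
  match n return rn n with
  | 0 => tt
  | n'.+1 => (y n', mk_rn n' y)
  end.

Lemma coordn_mk_rn n y i : (i < n)%N -> coordn (mk_rn n y) i = y i.
Proof.
elim: n => [//|n IH]; rewrite ltnS leq_eqVlt /= => /predU1P[->|lt]; first by rewrite eqxx.
by rewrite ltn_eqF// IH.
Qed.

Lemma coordn_inj n (x y : rn n) : (forall i, (i < n)%N -> coordn x i = coordn y i) -> x = y.
Proof.
elim: n x y => [[] []//|n IH] [x xs] [y ys] /= H.
have := H n (ltnSn n); rewrite eqxx => ->; congr (_, _); apply: IH => i ni.
by have := H i (ltnW ni); rewrite ltn_eqF.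
Qed.

Lemma measurable_coordn n i : measurable_fun setT (fun x : rn n => coordn x i).
Proof.
elim: n => [|n IH] /=; first exact: measurable_cst.
case: (i == n); first exact: measurable_fst.
exact: (measurableT_comp IH).
Qed.

Definition half_diff n (x y : rn n) : rn n := mk_rn n (fun i => (coordn x i - coordn y i) / 2).

Definition half_sum_cost n (x y : rn n) : R := \sum_(i < n) (coordn x i + coordn y i) ^+ 2 / 4.

Lemma eq_mk_rn n y z : (forall i, (i < n)%N -> y i = z i) -> mk_rn n y = mk_rn n z.
Proof. by move=> H; apply: coordn_inj => i ni; rewrite !coordn_mk_rn// H. Qed.

Lemma prekopa_leindler_rn n : prekopa_leindler (gauss_rn n) (@half_diff n) (@half_sum_cost n).
Proof.
elim: n => [|n IH] f g h bf bg bh fgh.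
  have E (k : rn 0 -> R) : bounded_mfun k -> (\int[gauss_rn 0]_x (k x)%:E = (k tt)%:E)%E.
    by case=> mk _; rewrite integral_dirac ?diracT ?mul1e//; exact/measurable_EFinP.
  rewrite !E// -EFinM -EFin_expe lee_fin (le_trans (fgh tt tt))//.
  by rewrite /half_sum_cost big_ord0 expR0 mulr1.
have := @prekopa_leindler_prod R _ _ (measurableTypeR R) (rn n) (gam : probability _ R) (gauss_rn n)
  _ _ _ _ (prod_prob (gam : probability _ R) (gauss_rn n) : probability _ R) _ (@prekopa_leindler_gauss R) IH.
apply => // -[x xs] [y ys].
apply: le_trans (fgh _ _) _.
rewrite /half_diff/= eqxx /half_sum_cost big_ord_recr/= eqxx addrC.
rewrite (eq_mk_rn (z := fun i => (coordn xs i - coordn ys i) / 2)); last first.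
  by move=> i ni; rewrite ltn_eqF.
by under eq_bigr => i _ do rewrite ltn_eqF//.
Qed.

Lemma ge0_integral_gauss_rn_recr n (f : rn n.+1 -> \bar R) :
  measurable_fun setT f -> (forall x, 0 <= f x)%E ->
  (\int[gauss_rn n.+1]_x f x = \int[gauss_rn n]_y \int[gam]_t f (t, y))%E.
Proof.
move=> mf f0.
transitivity (\int[(gam \x gauss_rn n)%E]_x f x)%E; first by [].
by rewrite fubini_tonelli2.
Qed.

Lemma integral_prod_gauss_rn n (g : nat -> R -> R) :
  (forall i, measurable_fun setT (g i)) -> (forall i x, 0 <= g i x) ->
  (\int[gauss_rn n]_x (\prod_(i < n) g i (coordn x i))%:E = \prod_(i < n) \int[gam]_t (g i t)%:E)%E.
Proof.
move=> mg g0.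
have mprod n' : measurable_fun setT (fun x : rn n' => \prod_(i < n') g i (coordn x i)).
  by apply: measurable_prod => i _; apply: measurableT_comp => //; exact: measurable_coordn.
elim: n => [|n IH].
  rewrite big_ord0; under eq_integral do rewrite big_ord0.
  by rewrite integral_cst//= diracT mule1.
rewrite ge0_integral_gauss_rn_recr; last 2 first.
- exact/measurable_EFinP/mprod.
- by move=> x; rewrite lee_fin prodr_ge0.
rewrite big_ord_recr/= -IH -ge0_integralZr//; last 3 first.
- exact/measurable_EFinP/mprod.
- by move=> x _; rewrite lee_fin prodr_ge0.
- by apply: integral_ge0 => x _; rewrite lee_fin.
apply: eq_integral => y _.
have P0 : (0 <= (\prod_(i < n) g i (coordn y i))%:E)%E by rewrite lee_fin prodr_ge0.
have mgn : measurable_fun setT (fun t : measurableTypeR R => (g n t)%:E) by apply/measurable_EFinP; exact: mg.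
rewrite -(@ge0_integralZl _ _ _ gam setT measurableT (fun t => (g n t)%:E) _ _ _ P0)//; last first.
  by move=> x _; rewrite lee_fin.
apply: eq_integral => t _; rewrite big_ord_recr/= eqxx EFinM.
by under eq_bigr => i _ do rewrite ltn_eqF//.
Qed.
End GaussianSpace.

(** * Transfer from an arbitrary sample to the canonical Gaussian space *)

Section Law.
Variable R : realType.
Notation gam := (@normal_prob R 0 1).

Lemma measurable_mk_rn d (Om : measurableType d) n (y : nat -> Om -> R) :
  (forall i, measurable_fun setT (y i)) ->
  measurable_fun setT (fun w => mk_rn n (fun i => y i w)).
Proof.
move=> my; elim: n => [|n IH] /=; first exact: measurable_cst.
by apply: measurable_fun_pair => //; exact: my.
Qed.

(* The factor [c] lets the induction apply to [nu] restricted to the event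
   that the last coordinate lies in a given set. *)
Lemma law_mk_rn d (Om : measurableType d) n (y : nat -> Om -> R)
  (nu : {measure set Om -> \bar R}) (c : R) :
  (forall i, measurable_fun setT (y i)) -> 0 <= c ->
  (forall B : nat -> set R, (forall i, measurable (B i)) ->
    nu [set w | forall i, (i < n)%N -> B i (y i w)] = (c%:E * \prod_(i < n) gam (B i))%E) ->
  forall A, measurable A -> nu ((fun w => mk_rn n (fun i => y i w)) @^-1` A) = (c%:E * gauss_rn R n A)%E.
Proof.
move=> my; elim: n nu c => [|n IH] nu c c0 H A mA.
  have := H (fun _ => setT) (fun _ => measurableT); rewrite big_ord0 mule1 => <-.
  have [->|At] : A = set0 \/ A tt.
      by have [|nA] := pselect (A tt); [right|left; apply/seteqP; split=> // -[]].
    by rewrite preimage_set0 measure0 /= dirac0 mule0.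
  have -> : A = setT by apply/seteqP; split => // -[].
  by rewrite preimage_setT /= diracT mule1; congr (nu _); apply/seteqP; split.
have mY k := @measurable_mk_rn _ _ k _ my.
have gfin (B : set R) : measurable B -> (fine (gam B))%:E = gam B.
  by move=> mB; rewrite fineK//; exact: fin_num_measure.
have rect (B0 : set R) (B : set (rn R n)) : measurable B0 -> measurable B ->
   nu ((fun w => mk_rn n.+1 (fun i => y i w)) @^-1` (B0 `*` B)) = (c%:E * (gam B0 * gauss_rn R n B))%E.
  move=> mB0 mB.
  have mD : measurable (y n @^-1` B0) by rewrite -[_ @^-1` _]setTI; exact: my.
  have c'0 : 0 <= c * fine (gam B0) by rewrite mulr_ge0// fine_ge0.
  have := IH (mrestr nu mD) (c * fine (gam B0)) c'0 _ B mB.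
  rewrite /mrestr/= EFinM gfin// muleA => <-.
    by congr (nu _); apply/seteqP; split=> w /= [].
  move=> B' mB'.
  pose B'' i := if i == n then B0 else B' i.
  transitivity (nu [set w | forall i, (i < n.+1)%N -> B'' i (y i w)]).
    congr (nu _); apply/seteqP; split => w /=.
      move=> [H1 H2] i; rewrite ltnS leq_eqVlt /B'' => /predU1P[->|lt]; first by rewrite eqxx.
      by rewrite ltn_eqF//; exact: H1.
    move=> H1; split=> [i lt|]; last by have := H1 n (ltnSn n); rewrite /B'' eqxx.
    by have := H1 i (ltnW lt); rewrite /B'' ltn_eqF.
  rewrite H; last by move=> i; rewrite /B''; case: ifP.
  rewrite big_ord_recr/= {2}/B'' eqxx -muleA; congr (_ * _)%E.
  rewrite muleC; congr (_ * _)%E; apply: eq_bigr => i _.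
  by rewrite /B'' ltn_eqF.
(* The case [c = 0] is separate because uniqueness of the product measure is applied to [nu] divided
   by [c]. *)
have [c_0|c_n0] := eqVneq c 0.
  rewrite c_0 mul0e; apply/eqP; rewrite eq_le measure_ge0 andbT.
  apply: (@le_trans _ _ (nu setT)).
    apply: le_measure; rewrite ?inE//; rewrite -[_ @^-1` _]setTI; exact: mY.
  have := H (fun _ => setT) (fun _ => measurableT); rewrite c_0 mul0e => <-.
  by rewrite (_ : [set w | _] = setT)//; apply/seteqP; split.
have cp : 0 < c by rewrite lt_neqAle eq_sym c_n0.
have ci0 : 0 <= c^-1 by rewrite invr_ge0.
pose f : {mfun Om >-> rn R n.+1} := HB.pack (fun w => mk_rn n.+1 (fun i => y i w))
   (isMeasurableFun.Build _ _ _ _ _ (mY n.+1)).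
pose m' : {measure set (measurableTypeR R * rn R n) -> \bar R} := mscale (NngNum ci0) (pushforward nu f).
have := @product_measure_unique _ _ (measurableTypeR R) (rn R n) R gam (gauss_rn R n) (m' (mY n.+1)) _ A mA.
change (gauss_rn R n.+1 A) with ((gam \x gauss_rn R n)%E A); rewrite /m' /mscale /= /pushforward => ->.
  by rewrite muleA -EFinM mulfV// mul1e.
move=> B0 B mB0 mB; have e := rect B0 B mB0 mB.
transitivity ((c^-1)%:E * nu ((fun w => mk_rn n.+1 (fun i => y i w)) @^-1` (B0 `*` B)))%E; first by [].
by rewrite e muleA -EFinM mulVf// mul1e.
Qed.

Lemma iid_std_gaussian_law d (Om : measurableType d) (P : probability Om R) n
  (y : 'I_n -> Om -> R) : iid_std_gaussian P y ->
  exists Y : Om -> rn R n, [/\ measurable_fun setT Y,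
    (forall w i, coordn (Y w) (val i) = y i w) &
    forall A, measurable A -> P (Y @^-1` A) = gauss_rn R n A].
Proof.
move=> [my H].
(* The family is extended by the constant 0 to all natural indices. *)
pose y' (i : nat) := if insub i is Some j then y j else cst 0.
have my' i : measurable_fun setT (y' i).
  by rewrite /y'; case: insub => // ; exact: measurable_cst.
have y'E (i : 'I_n) : y' i = y i by rewrite /y' valK.
exists (fun w => mk_rn n (fun i => y' i w)); split.
- exact: measurable_mk_rn.
- by move=> w i; rewrite coordn_mk_rn ?ltn_ord//= y'E.
move=> A mA; rewrite (@law_mk_rn _ _ n y' P 1)// ?mul1e// => B mB.
rewrite mul1e -(H (fun i => B i))//; congr (P _); apply/seteqP; split => w /=.
  by move=> h i _; rewrite /= -y'E; exact: h.
by move=> h i ni; have := h (Ordinal ni) I; rewrite /= -y'E.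
Qed.
End Law.

(** * Exponential and second moments *)

Section Moments.
Variable R : realType.
Notation mu := (@lebesgue_measure R).
Notation gam := (@normal_prob R 0 1).
Notation phi := (@normal_pdf R 0 1).

(** Completing the square: [expR (l * x)] times the standard density is [expR (l ^ 2 / 2)] times the
    density centred at [l]. *)
Lemma normal_mgf (l : R) : (\int[gam]_x (expR (l * x))%:E = (expR (l ^+ 2 / 2))%:E)%E.
Proof.
have mE : measurable_fun setT (fun x : R => (expR (l * x))%:E).
  by apply/measurable_EFinP; apply: measurableT_comp => //; exact: measurable_funM.
rewrite ge0_integral_normal_prob//.
transitivity (\int[mu]_x ((expR (l ^+ 2 / 2))%:E * (normal_pdf l 1 x)%:E))%E.
  apply: eq_integral => x _; rewrite -!EFinM; congr EFin.
  rewrite normal_pdf01E normal_pdfE ?oner_eq0// /normal_fun.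
  rewrite !(mulrCA _ (normal_peak 1)) -!expRD; congr (_ * expR _).
  by rewrite expr1n; field.
rewrite ge0_integralZl//.
- by rewrite integral_normal_pdf mule1.
- by apply/measurable_EFinP; exact: measurable_normal_pdf.
- by move=> x _; rewrite lee_fin normal_pdf_ge0.
Qed.

Lemma normal_sqr_le : (\int[gam]_x (x ^+ 2)%:E <= (102 / 100)%:E)%E.
Proof.
(* [x^2 <= (expR (t * x^2) - 1) / t], whose integral is [(s - 1) / t]. *)
pose s : R := 101 / 100.
(* The choice of [t] below makes [t x^2 - x^2 / 2 = - x^2 / (2 s^2)], so the integrand becomes [s]
   times the centred normal density of standard deviation [s]. *)
have s0 : s != 0 by rewrite gt_eqF// /s; lra.
pose t : R := (1 - (s ^+ 2)^-1) / 2.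
have tE : t = 201 / 20402 by rewrite /t /s; field.
have mE : measurable_fun setT (fun x : R => (expR (t * x ^+ 2))%:E).
  by apply/measurable_EFinP; apply: measurableT_comp => //; exact: measurable_funM.
have E : (\int[gam]_x (expR (t * x ^+ 2))%:E = s%:E)%E.
  rewrite ge0_integral_normal_prob//.
  transitivity (\int[mu]_x (s%:E * (normal_pdf 0 s x)%:E))%E.
    apply: eq_integral => x _; rewrite -!EFinM; congr EFin.
    rewrite normal_pdf01E normal_pdfE// /normal_fun subr0.
    have -> : normal_peak s = s^-1 * normal_peak 1.
      rewrite /normal_peak expr1n mul1r -mulrnAr sqrtrM ?sqr_ge0// sqrtr_sqr.
      by rewrite ger0_norm ?invfM// /s; lra.
    rewrite mulrCA -expRD.
    have -> p q : s * (s^-1 * p * q) = p * q by rewrite -mulrA mulVKf.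
    congr (_ * expR _).
    by rewrite /t mulr2n; field.
  rewrite ge0_integralZl//.
  - by rewrite integral_normal_pdf mule1.
  - by apply/measurable_EFinP; exact: measurable_normal_pdf.
  - by move=> x _; rewrite lee_fin normal_pdf_ge0.
  - by rewrite lee_fin /s; lra.
have t0 : 0 < t by rewrite tE; lra.
have mX : measurable_fun setT (fun x : measurableTypeR R => (x ^+ 2)%:E).
  exact/measurable_EFinP.
have h : (1 + t%:E * \int[gam]_x (x ^+ 2)%:E <= s%:E)%E.
  have g1 : (\int[gam]_x (cst 1%E x) = 1)%E.
    by rewrite integral_cst//= mul1e; exact: (@probability_setT _ _ _ gam).
  rewrite -E -{1}g1 -ge0_integralZl//; last 2 first.
  - by move=> x _; rewrite lee_fin sqr_ge0.
  - by rewrite lee_fin ltW.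
  rewrite -ge0_integralD//; last 2 first.
  - by move=> x _; rewrite mule_ge0 ?lee_fin ?sqr_ge0// ltW.
  - exact: emeasurable_funM.
  apply: ge0_le_integral => //.
  - by move=> x _; rewrite adde_ge0// mule_ge0 ?lee_fin ?sqr_ge0// ltW.
  - by apply: emeasurable_funD => //; exact: emeasurable_funM.
  - by move=> x _; rewrite -EFinM -EFinD lee_fin expR_ge1Dx.
have I0 : (0 <= \int[gam]_x (x ^+ 2)%:E)%E by apply: integral_ge0 => x _; rewrite lee_fin sqr_ge0.
move: h I0; case: (integral _ _ _) => [r| |]//.
  rewrite -EFinM -EFinD !lee_fin tE /s; lra.
by rewrite gt0_muley ?lte_fin.
Qed.

Lemma lebesgue_integral_opp (f : R -> \bar R) : measurable_fun setT f -> (forall x, 0 <= f x)%E ->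
  (\int[mu]_x f (- x)%R = \int[mu]_x f x)%E.
Proof.
move=> mf f0.
have mo : measurable_fun setT ((fun x => -1 * x + 0) : measurableTypeR R -> measurableTypeR R).
  exact: measurable_affine.
pose o : {mfun measurableTypeR R >-> measurableTypeR R} :=
  HB.pack ((fun x => -1 * x + 0) : measurableTypeR R -> measurableTypeR R)
   (isMeasurableFun.Build _ _ _ _ _ mo).
transitivity (\int[pushforward mu o]_x f x)%E.
  rewrite ge0_integral_pushforward//.
  by apply: eq_integral => x _ /=; rewrite mulN1r addr0.
apply: eq_measure_integral => A mA _.
have n1 : (-1 : R) != 0 by rewrite oppr_eq0 oner_neq0.
by have := lebesgue_measure_affine 0 n1 mA; rewrite normrN1 invr1 mul1e.
Qed.

Lemma normal_integral_opp (f : R -> \bar R) : measurable_fun setT f -> (forall x, 0 <= f x)%E ->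
  (\int[gam]_x f (- x)%R = \int[gam]_x f x)%E.
Proof.
move=> mf f0.
have mo : measurable_fun setT (fun x : measurableTypeR R => f (- x)%R).
  by apply: (measurableT_comp mf); exact: oppr_measurable.
rewrite !ge0_integral_normal_prob//.
rewrite -[RHS]lebesgue_integral_opp.
- by apply: eq_integral => x _; rewrite !normal_pdf01E sqrrN.
- by apply: emeasurable_funM => //; apply/measurable_EFinP; exact: measurable_normal_pdf.
- by move=> x; rewrite mule_ge0// lee_fin normal_pdf_ge0.
Qed.

(** Adding the reflected integral cancels the cross term, so only the second moment enters. *)
Lemma normal_affine_sqr_le (e a : R) :
  (\int[gam]_x ((a * x + e) ^+ 2)%:E <= (e ^+ 2 + 102 / 100 * a ^+ 2)%:E)%E.
Proof.
have mA (b : R) : measurable_fun setT (fun x : measurableTypeR R => ((b * x + e) ^+ 2)%:E).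
  apply/measurable_EFinP; apply: measurable_funX; exact: measurable_affine.
set J := integral _ _ _.
have JJ : (J + J = 2%:E * ((e ^+ 2)%:E + (a ^+ 2)%:E * \int[gam]_x (x ^+ 2)%:E))%E.
  have J2 : J = (\int[gam]_x ((- a * x + e) ^+ 2)%:E)%E.
    rewrite /J -normal_integral_opp; [|exact: mA|by move=> x; rewrite lee_fin sqr_ge0].
    by apply: eq_integral => x _; rewrite mulrN mulNr.
  transitivity (\int[gam]_x ((- a * x + e) ^+ 2)%:E + \int[gam]_x ((a * x + e) ^+ 2)%:E)%E.
    by rewrite -J2.
  rewrite -ge0_integralD//; try exact: mA; try by move=> x _; rewrite lee_fin sqr_ge0.
  have g1 : (\int[gam]_x (cst (e ^+ 2)%:E x) = (e ^+ 2)%:E)%E.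
    rewrite integral_cst//= -[RHS]mule1; congr (_ * _)%E; exact: (@probability_setT _ _ _ gam).
  have mX : measurable_fun setT (fun x : measurableTypeR R => (x ^+ 2)%:E).
    exact/measurable_EFinP.
  rewrite -{1}g1 -ge0_integralZl//; last 2 first.
  - by move=> x _; rewrite lee_fin sqr_ge0.
  - by rewrite lee_fin sqr_ge0.
  rewrite -ge0_integralD//; last 3 first.
  - by move=> x _; rewrite lee_fin sqr_ge0.
  - by move=> x _; rewrite mule_ge0 ?lee_fin ?sqr_ge0.
  - exact: emeasurable_funM.
  rewrite -ge0_integralZl//; last 2 first.
  - by apply: emeasurable_funD => //; exact: emeasurable_funM.
  - by move=> x _; rewrite adde_ge0 ?mule_ge0 ?lee_fin ?sqr_ge0.
  by apply: eq_integral => x _; rewrite -[RHS]/((2 * (e ^+ 2 + a ^+ 2 * x ^+ 2))%:E) -EFinD; congr EFin; ring.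
have q := normal_sqr_le.
have : (J + J <= (2 * (e ^+ 2 + 102 / 100 * a ^+ 2))%:E)%E.
  rewrite JJ (EFinM 2) lee_pmul2l// EFinD; apply: leeD2l.
  have -> : (102 / 100 * a ^+ 2)%:E = ((a ^+ 2)%:E * (102 / 100)%:E)%E by rewrite -EFinM mulrC.
  by apply: lee_wpmul2l => //; rewrite lee_fin sqr_ge0.
have : (0 <= J)%E by apply: integral_ge0 => x _; rewrite lee_fin sqr_ge0.
by case: J {JJ} => [r| |]//; rewrite -EFinD !lee_fin; lra.
Qed.

Lemma gauss_rn_mgf n (a : nat -> R) (l : R) :
  (\int[gauss_rn R n]_x (expR (l * \sum_(i < n) a i * coordn x i))%:E =
   (expR (l ^+ 2 / 2 * \sum_(i < n) a i ^+ 2))%:E)%E.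
Proof.
transitivity (\int[gauss_rn R n]_x (\prod_(i < n) expR (l * a i * coordn x i))%:E)%E.
  apply: eq_integral => x _; congr EFin; rewrite mulr_sumr expR_sum.
  by apply: eq_bigr => i _; rewrite mulrA.
rewrite (@integral_prod_gauss_rn R n (fun i t => expR (l * a i * t))); last 2 first.
- by move=> i; apply: measurableT_comp => //; exact: measurable_funM.
- by move=> i x; exact: expR_ge0.
under eq_bigr do rewrite normal_mgf.
rewrite prodEFin mulr_sumr expR_sum; congr EFin.
by apply: eq_bigr => i _; rewrite exprMn; congr expR; ring.
Qed.
End Moments.

(** * Large cells by pigeonhole *)

Section Counting.
Context d (T : measurableType d) (R : realType) (P : probability T R).

Lemma measure_exists_le (C : eqType) (s : seq C) (A : C -> set T) :
  (forall c, measurable (A c)) ->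
  measurable [set x | exists2 c, c \in s & A c x] /\
  (P [set x | exists2 c, c \in s & A c x] <= \sum_(c <- s) P (A c))%E.
Proof.
move=> mA; elim: s => [|c s [IHm IH]].
  rewrite (_ : [set x | _] = set0); last by apply/seteqP; split=> x // -[].
  by rewrite big_nil measure0.
rewrite (_ : [set x | _] = A c `|` [set x | exists2 c, c \in s & A c x]).
  split; first exact: measurableU.
  rewrite big_cons (le_trans (measureU2 _ _ _))//; exact: leeD2l.
apply/seteqP; split => x.
  by move=> [e]; rewrite inE => /predU1P[-> ?|? ?]; [left|right; exists e].
by move=> [Ac|[e es Ae]]; [exists c|exists e]; rewrite ?mem_head// inE es orbT.
Qed.

Lemma markov_le (f : T -> R) (a D : R) : measurable_fun setT f -> (forall x, 0 <= f x) ->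
  0 < a -> (\int[P]_x (f x)%:E <= D%:E)%E -> (P [set x | (a < f x)%R] <= (D / a)%:E)%E.
Proof.
move=> mf f0 a0 fD.
have mA : measurable [set x | a < f x].
  have := mf measurableT `]a, +oo[%classic (measurable_itv _).
  by rewrite setTI /preimage/=; under eq_set do rewrite in_itv/= andbT.
suff : (P [set x | (a < f x)%R] * a%:E <= D%:E)%E.
  rewrite -[P _]fineK ?fin_num_measure// -EFinM !lee_fin => h.
  by rewrite ler_pdivlMr.
apply: le_trans fD.
rewrite -[X in P X]setIT -integral_indic// -ge0_integralZr//; try (by rewrite lee_fin ltW); try exact/measurable_EFinP/measurable_indic.
apply: ge0_le_integral => //.
- by move=> x _; rewrite mule_ge0 ?lee_fin// ltW.
- by apply: emeasurable_funM => //; exact/measurable_EFinP/measurable_indic.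
- exact/measurable_EFinP.
move=> x _; rewrite -EFinM lee_fin indicE.
by case: (boolP (x \in _)) => [|_]; rewrite ?inE ?mul0r//= mul1r => /ltW.
Qed.

Lemma geometric_sum_le (k : R) B : 0 <= k <= 3^-1 -> \sum_(i < B) k ^+ i.+1 <= 3 / 2 * k.
Proof.
move=> /andP[k0 k3]; elim: B => [|B IH]; first by rewrite big_ord0; lra.
rewrite big_ord_recl.
under eq_bigr => i _ do rewrite lift0 exprS.
rewrite -mulr_sumr expr1; move: IH; set S := \sum_(i < B) _ => IH.
have : k * S <= k * (3 / 2 * 3^-1) by rewrite ler_wpM2l// (le_trans IH)//; lra.
lra.
Qed.

(** Enumerates the integers from [- B] to [B] by a finite type, so that cells are indexed by finite
    functions; [Negz b] is [- b.+1], whence one code fewer on the negative side. *)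
Definition int_code B (i : 'I_(B.+1 + B)) : int :=
  match fintype.split i with inl a => Posz a | inr b => Negz b end.

Lemma int_codeP B (z : int) : (`|z| <= B)%N -> exists i : 'I_(B.+1 + B), int_code i = z.
Proof.
case: z => [a|b] h.
  have h' : (a < B.+1)%N by [].
  by exists (lshift B (Ordinal h')); rewrite /int_code (unsplitK (inl _)).
have h' : (b < B)%N by [].
by exists (rshift B.+1 (Ordinal h')); rewrite /int_code (unsplitK (inr _)).
Qed.

Lemma int_code_lshift B (i : 'I_B.+1) : int_code (lshift B i) = Posz i.
Proof. by rewrite /int_code (unsplitK (inl _)). Qed.

Lemma int_code_rshift B (i : 'I_B) : int_code (rshift B.+1 i) = Negz i.
Proof. by rewrite /int_code (unsplitK (inr _)). Qed.

Lemma int_code_sum B (k : R) : 0 <= k <= 3^-1 ->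
  \sum_(i < B.+1 + B) k ^+ `|int_code i|%N <= 1 + 3 * k.
Proof.
move=> hk; rewrite big_split_ord big_ord_recl.
rewrite int_code_lshift expr0.
set S1 := \sum_(i < B) _; set S2 := \sum_(i < B) _.
have e1 : S1 = \sum_(i < B) k ^+ i.+1.
  by apply: eq_bigr => i _; rewrite int_code_lshift.
have e2 : S2 = \sum_(i < B) k ^+ i.+1.
  by apply: eq_bigr => i _; rewrite int_code_rshift.
rewrite e1 e2; have := @geometric_sum_le k B hk; set S := \sum_(i < B) _ => h.
by change (1 + S + S <= 1 + 3 * k); lra.
Qed.

(** Countably many measurable fibres suffice, which avoids choosing a sigma-algebra on [C]. *)
Lemma measurable_fun_fibers (C : countType) (g : T -> C) (h : C -> R) :
  (forall c, measurable [set x | g x = c]) -> measurable_fun setT (fun x => h (g x)).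
Proof.
move=> mg _ Y mY; rewrite setTI.
rewrite (_ : _ @^-1` Y = \bigcup_c ([set x | g x = c] `&` [set x | Y (h c)])).
  apply: countable_bigcupT_measurable; first exact: countableP.
  move=> c; apply: measurableI => //.
  have [Yc|nYc] := pselect (Y (h c)).
    by rewrite (_ : [set x | _] = setT)//; apply/seteqP; split.
  by rewrite (_ : [set x | _] = set0)//; apply/seteqP; split.
by apply/seteqP; split => [x Yx|x [c _ [/= <-]]//]; exists (g x).
Qed.

(* A cell [c] of weighted size [sum L |c| <= 5/4 D] satisfies
   [1 <= expR (5/4 D) * prod (expR (- L)) ^ |c|], so there are at most
   [expR (5/4 D) * prod (1 + 3 expR (- L))] of them, and by Markov they cover a
   set of probability at least 1/5. *)
Lemma large_cell (J : finType) (dig : J -> T -> int) (L : J -> R) (D : R) :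
  (forall j k, measurable [set x | dig j x = k]) ->
  (forall j, 2 <= L j) -> 0 < D ->
  (\sum_j (L j)%:E * \int[P]_x ((`|dig j x|%N)%:R)%:E <= D%:E)%E ->
  exists r : J -> int,
    ((expR (- (5 / 4 * D) - 3 * \sum_j expR (- L j)) / 5)%:E <= P [set x | forall j, dig j x = r j])%E.
Proof.
move=> md L2 D0 hD.
have mdr j : measurable_fun setT (fun x => (`|dig j x|%N)%:R : R).
  exact: (measurable_fun_fibers (fun z : int => (`|z|%N)%:R) (md j)).
have L0 j : 0 <= L j by rewrite (le_trans _ (L2 j)).
pose f x := \sum_j L j * (`|dig j x|%N)%:R.
have f0 x : 0 <= f x by apply: sumr_ge0 => j _; rewrite mulr_ge0.
have mf : measurable_fun setT f.
  by apply: measurable_sum => j; apply: measurable_funM.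
have fD : (\int[P]_x (f x)%:E <= D%:E)%E.
  apply: le_trans hD; under eq_integral do rewrite /f -sumEFin.
  rewrite ge0_integral_sum//.
  - apply: lee_sum => j _; under eq_integral do rewrite EFinM.
    have mj : measurable_fun setT (fun x => ((`|dig j x|%N)%:R : R)%:E).
      by apply/measurable_EFinP; exact: mdr.
    by rewrite ge0_integralZl// lee_fin.
  - by move=> j; apply/measurable_EFinP; apply: measurable_funM.
  - by move=> j x _; rewrite lee_fin mulr_ge0.
pose D' := 5 / 4 * D.
have D'0 : 0 < D' by rewrite mulr_gt0// divr_gt0.
have mG' : measurable [set x | D' < f x].
  have := mf measurableT `]D', +oo[%classic (measurable_itv _).
  by rewrite setTI /preimage/=; under eq_set do rewrite in_itv/= andbT.
have PG' : (P [set x | (D' < f x)%R] <= (4 / 5)%:E)%E.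
  apply: (le_trans (markov_le mf f0 D'0 fD)).
  by rewrite lee_fin /D' invfM mulrCA mulfV ?gt_eqF// mulr1 invf_div.
have PG : ((1 / 5)%:E <= P (~` [set x | (D' < f x)%R]))%E.
  rewrite probability_setC//.
  have -> : (1 / 5)%:E = (1 - (4/5)%:E :> \bar R)%E by rewrite -EFinB; congr EFin; field.
  exact: leeB.
(* As every weight is at least 1, a point of weighted size at most [D'] has all digits bounded by
   [B]. *)
pose B := Num.truncn D'.
pose C := {ffun J -> 'I_(B.+1 + B)}.
pose cell (c : C) := [set x | forall j, dig j x = int_code (c j)].
have mcell c : measurable (cell c).
  rewrite (_ : cell c = \bigcap_(j in setT) [set x | dig j x = int_code (c j)]).
    by apply: fin_bigcap_measurable => //; exact: finite_finset.
  by apply/seteqP; split => x /= h j; [move=> _|]; exact: h.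
pose good (c : C) := \sum_j L j * (`|int_code (c j)|%N)%:R <= D'.
pose p (c : C) := fine (P (cell c)).
have pE c : P (cell c) = (p c)%:E by rewrite fineK// fin_num_measure.
have p0 c : 0 <= p c by rewrite fine_ge0.
pose w (c : C) := \prod_j expR (- L j) ^+ `|int_code (c j)|%N.
have wE c : w c = expR (- \sum_j L j * (`|int_code (c j)|%N)%:R).
  by rewrite -sumrN expR_sum; apply: eq_bigr => j _; rewrite -expRM_natl; congr expR; ring.
pose c0 : C := [ffun=> ord0].
(* [cm] is a most probable cell; the remaining estimates bound the number of good cells. *)
have [cm _ cmP] := @Order.TotalTheory.arg_maxP _ R C c0 predT p isT.
have h1 : (P (~` [set x | (D' < f x)%R]) <= (\sum_(c <- enum [pred c | good c]) p c)%:E)%E.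
  have [mE leE] := @measure_exists_le C (enum [pred c | good c]) cell mcell.
  apply: (@le_trans _ _ (P [set x | exists2 c, c \in enum [pred c | good c] & cell c x])).
    apply: le_measure; rewrite ?inE//; first exact: measurableC.
    move=> x /= /negP; rewrite -leNgt => fx.
    have hB j : (`|dig j x| <= B)%N.
      rewrite /B truncn_ge_nat ?(ltW D'0)//; apply: le_trans fx.
      rewrite /f (bigD1 j)//= ler_wpDr//; first by apply: sumr_ge0 => i _; rewrite mulr_ge0.
      by rewrite ler_peMl// (le_trans _ (L2 j))//; lra.
    pose c : C := [ffun j => sval (cid (int_codeP (hB j)))].
    have cE j : int_code (c j) = dig j x.
      by rewrite ffunE; case: cid.
    exists c; first by rewrite mem_enum inE /good; under eq_bigr do rewrite cE.
    by move=> j; rewrite cE.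
  by apply: le_trans leE _; rewrite -sumEFin; under eq_bigr do rewrite pE.
have h2 : \sum_(c <- enum [pred c | good c]) p c <= \sum_c p cm * (expR D' * w c).
  rewrite big_enum/= [leRHS](bigID good)/= ler_wpDr//.
    by apply: sumr_ge0 => c _; rewrite mulr_ge0// mulr_ge0 ?expR_ge0// wE expR_ge0.
  apply: ler_sum => c gc; rewrite (le_trans (cmP c isT))// ler_peMr// wE -expRD.
  by rewrite -[leLHS]expR0 ler_expR subr_ge0.
have h3 : \sum_c p cm * (expR D' * w c) <= p cm * expR (D' + 3 * \sum_j expR (- L j)).
  under eq_bigr do rewrite mulrA.
  rewrite -mulr_sumr expRD -mulrA ler_wpM2l// ler_wpM2l ?expR_ge0//.
  (* The sum over all cells of a product over digits factors into a product of geometric sums. *)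
  rewrite -(bigA_distr_bigA (fun j (i : 'I_(B.+1 + B)) => expR (- L j) ^+ `|int_code i|%N)).
  rewrite mulr_sumr expR_sum; apply: ler_prod => j _; apply/andP; split.
    by apply: sumr_ge0 => i _; rewrite exprn_ge0 ?expR_ge0.
  apply: le_trans (expR_ge1Dx _); apply: int_code_sum; rewrite expR_ge0/=.
  rewrite -[leRHS]invrK expRN lef_pV2 ?posrE ?expR_gt0//.
  by rewrite (le_trans _ (expR_ge1Dx _))//; have := L2 j; lra.
exists (fun j => int_code (cm j)).
rewrite -[P _]/(P (cell cm)) pE lee_fin ler_pdivrMr//.
have h4 : 1 / 5 <= p cm * expR (D' + 3 * \sum_j expR (- L j)).
  by rewrite -lee_fin (le_trans PG)// (le_trans h1)// lee_fin (le_trans h2).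
have e0 := expR_gt0 (D' + 3 * \sum_j expR (- L j)).
rewrite -opprD expRN -/D' -(ler_pM2r e0) mulVf ?gt_eqF//; lra.
Qed.

(** Irrelevant digits vanish identically, so they can be given a huge weight free of charge; their
    total counting cost is then at most the extra 1 in the exponent. *)
Lemma large_cell_relevant (J : finType) (rel : pred J) (dig : J -> T -> int) (L : J -> R) (D : R) :
  (forall j k, measurable [set x | dig j x = k]) ->
  (forall j x, ~~ rel j -> dig j x = 0) ->
  (forall j, 2 <= L j) -> 0 < D ->
  (\sum_(j | rel j) (L j)%:E * \int[P]_x ((`|dig j x|%N)%:R)%:E <= D%:E)%E ->
  exists r : J -> int,
    ((expR (- (5 / 4 * D) - 3 * (\sum_(j | rel j) expR (- L j)) - 1) / 5)%:E <=
     P [set x | forall j, dig j x = r j])%E.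
Proof.
move=> md d0 L2 D0 hD.
(* With this weight [#|J| <= (1 + La) / 3 <= expR La / 3]. *)
pose La : R := 2 + 3 * #|J|%:R.
pose L' j := if rel j then L j else La.
have La2 : 2 <= La by rewrite /La lerDl mulr_ge0.
have L'2 j : 2 <= L' j by rewrite /L'; case: ifP.
have [|r hr] := @large_cell J dig L' D md L'2 D0.
  rewrite (bigID rel)/= [X in (_ + X)%E]big1 ?adde0; last first.
    move=> j nj; rewrite integral0_eq ?mule0// => x _.
    by rewrite d0//.
  by rewrite (eq_bigr (fun j => (L j)%:E * \int[P]_x ((`|dig j x|%N)%:R)%:E)%E)// => j rj; rewrite /L' rj.
exists r; apply: le_trans hr; rewrite lee_fin ler_pM2r// ler_expR.
have -> : \sum_j expR (- L' j) = \sum_(j | rel j) expR (- L j) + \sum_(j | ~~ rel j) expR (- L' j).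
  by rewrite (bigID rel)/=; congr (_ + _); apply: eq_bigr => j rj; rewrite /L' rj.
suff : \sum_(j | ~~ rel j) expR (- L' j) <= 1 / 3 by lra.
apply: (@le_trans _ _ (\sum_(j : J) expR (- La))).
  rewrite [leRHS](bigID rel)/= ler_wpDl//; first by apply: sumr_ge0 => j _; exact: expR_ge0.
  by apply: ler_sum => j nj; rewrite /L' (negbTE nj).
rewrite sumr_const -[X in X <= _]mulr_natl expRN.
have eL := expR_gt0 La.
rewrite -(ler_pM2r eL) -mulrA mulVf ?gt_eqF// mulr1.
apply: (@le_trans _ _ (1 / 3 * (1 + La))).
  by rewrite /La; lra.
by rewrite ler_wpM2l// expR_ge1Dx.
Qed.
End Counting.

(** * Quantization of Gaussian walks *)

Section Truncation.
Variable R : realType.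

(** Rounding towards zero makes the digit vanish on the whole interval (-1, 1), so that small
    quantities have no cost. *)
Definition truncz (u : R) : int :=
  if 0 <= u then (Num.truncn u)%:Z else - (Num.truncn (- u))%:Z.

Lemma truncn_eq0 (v : R) : (Num.truncn v == 0%N) = (v < 1).
Proof. by rewrite -leqn0 leqNgt truncn_gt0 -ltNge. Qed.

Lemma truncz_abs u : (`|truncz u| = Num.truncn `|u|)%N.
Proof.
rewrite /truncz; case: (leP 0 u) => u0; first by rewrite ger0_norm.
by rewrite abszN ltr0_norm.
Qed.

Lemma truncz_normB u : `|u - (truncz u)%:~R| = `|u| - (Num.truncn `|u|)%:R.
Proof.
have h (v : R) : 0 <= v -> `|v - (Num.truncn v)%:R| = v - (Num.truncn v)%:R.
  by move=> v0; rewrite ger0_norm// subr_ge0 truncn_le.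
rewrite /truncz; case: (leP 0 u) => u0; first by rewrite (ger0_norm u0) -pmulrn h.
by rewrite (ltr0_norm u0) mulrNz -pmulrn opprK -normrN opprD h// oppr_ge0 ltW.
Qed.

Lemma truncz_itv (u : R) : (Num.truncn `|u|)%:R <= `|u| < (Num.truncn `|u|)%:R + 1.
Proof. by rewrite natr1 truncn_itv. Qed.

Lemma truncz_dist u : `|u - (truncz u)%:~R| <= 1.
Proof. by rewrite truncz_normB; have := truncz_itv u; lra. Qed.

(** With [k] the truncation of [|u|], one has [u^2 - (|u| - k)^2 = 2 k |u| - k^2 >= k^2 >= k]. *)
Lemma truncz_drop u : (u - (truncz u)%:~R) ^+ 2 + (`|truncz u|%N)%:R <= u ^+ 2.
Proof.
rewrite -real_normK ?num_real// truncz_normB truncz_abs -[u ^+ 2]real_normK ?num_real//.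
have /andP[] := truncz_itv u; set k := Num.truncn _ => h1 _.
have h2 : (k%:R : R) <= k%:R ^+ 2 by rewrite -natrX ler_nat; case: (k) => // k'; rewrite leq_pmulr.
have h3 : 0 <= (k%:R : R) by [].
nra.
Qed.

Lemma truncz_le_sqr u : (`|truncz u|%N)%:R <= u ^+ 2.
Proof. by have := truncz_drop u; have := sqr_ge0 (u - (truncz u)%:~R); lra. Qed.

Lemma truncz_le_exp u l : 1 <= l -> (`|truncz u|%N)%:R <= expR (l * (`|u| - 1)).
Proof.
move=> l1; rewrite truncz_abs; have /andP[h1 h2] := truncz_itv u.
have [u1|u1] := ltP `|u| 1.
  by rewrite (_ : Num.truncn _ = 0%N) ?expR_ge0//; apply/eqP; rewrite truncn_eq0 u1.
apply: (le_trans h1); apply: (@le_trans _ _ (expR (`|u| - 1))).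
  by apply: le_trans (expR_ge1Dx _); lra.
by rewrite ler_expR ler_peMl// subr_ge0.
Qed.

Lemma truncz_half_diff (u v : R) : truncz u = truncz v -> `|u - v| <= 2.
Proof.
move=> e; have -> : u - v = (u - (truncz u)%:~R) - (v - (truncz v)%:~R) by rewrite e; ring.
apply: (le_trans (ler_normB _ _)); have := truncz_dist u; have := truncz_dist v; lra.
Qed.

Lemma measurable_truncz_fiber (z : int) : measurable [set u : R | truncz u = z].
Proof.
have hp (u : R) (k : nat) : 0 <= u -> (Num.truncn u = k) <-> (k%:R <= u < k.+1%:R).
  by move=> u0; split=> [/eqP|H]; [rewrite truncn_eq//|apply/eqP; rewrite truncn_eq].
case: z => [[|k]|k].
- rewrite (_ : [set u | _] = `]-1, 1[%classic); first exact: measurable_itv.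
  apply/seteqP; split => u /=; rewrite in_itv/= -ltr_norml.
    move=> e; have := truncz_abs u; rewrite e/= => /esym/eqP; rewrite truncn_eq0; lra.
  move=> u1; have : (`|truncz u| = 0)%N by rewrite truncz_abs; apply/eqP; rewrite truncn_eq0 u1.
  by move/eqP; rewrite absz_eq0 => /eqP.
- rewrite (_ : [set u | _] = `[k.+1%:R, k.+2%:R[%classic); first exact: measurable_itv.
  apply/seteqP; split => u /=; rewrite in_itv/= /truncz.
    case: (leP 0 u) => [u0 [] /hp|u0]; first exact.
    by case: (Num.truncn _).
  move=> /andP[h1 h2]; have u0 : 0 <= u by exact: le_trans h1.
  by rewrite u0; congr Posz; apply/hp; rewrite ?h1.
- rewrite (_ : [set u | _] = `]- k.+2%:R, - k.+1%:R]%classic); first exact: measurable_itv.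
  apply/seteqP; split => u /=; rewrite in_itv/= /truncz.
    case: (leP 0 u) => [//|u0]; rewrite NegzE => /oppr_inj [] /hp; rewrite oppr_ge0 => /(_ (ltW u0)); lra.
  move=> /andP[h1 h2]; have u0 : u < 0 by rewrite (le_lt_trans h2)// oppr_lt0.
  rewrite leNgt u0/= NegzE; congr (- Posz _); apply/hp; lra.
Qed.
End Truncation.

(** * Sigma-delta quantization and its energy bound *)

Section SigmaDelta.
Variables (R : realType) (a : nat -> R) (w : R) (M : nat).
Hypothesis w0 : 0 < w.
Notation gam := (@normal_prob R 0 1).

(* Sigma-delta quantization of the walk: at the multiples of [M] the state is
   reset by an integer multiple of [w] so as to stay in [-w, w]. *)
Fixpoint sd_state (y : nat -> R) (t : nat) : R :=
  if t is t'.+1 then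
    let u := sd_state y t' + a t' * y t' in
    if (M %| t)%N then u - w * (truncz (u / w))%:~R else u
  else 0.

(** The digit of index [t] is the reset made on passing to time [t.+1]; it depends on the
    coordinates up to [t] included. *)
Definition sd_digit (y : nat -> R) (t : nat) : int :=
  if (M %| t.+1)%N then truncz ((sd_state y t + a t * y t) / w) else 0.

Lemma sd_stateS y t : sd_state y t.+1 = sd_state y t + a t * y t - w * (sd_digit y t)%:~R.
Proof. by rewrite /= /sd_digit; case: ifP => // _; rewrite mulr0 subr0. Qed.

Lemma sd_stateE y t :
  sd_state y t = \sum_(i < t) a i * y i - w * (\sum_(i < t) sd_digit y i)%:~R.
Proof.
elim: t => [|t IH]; first by rewrite !big_ord0 mulr0 subr0.
by rewrite sd_stateS IH !big_ord_recr/= intrD; ring.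
Qed.

Lemma sd_state_le y t : (M %| t)%N -> `|sd_state y t| <= w.
Proof.
case: t => [|t] Mt; first by rewrite /= normr0 ltW.
rewrite sd_stateS /sd_digit Mt; set u := sd_state y t + a t * y t.
have -> : u - w * (truncz (u / w))%:~R = w * (u / w - (truncz (u / w))%:~R) by field; rewrite gt_eqF.
by rewrite normrM gtr0_norm// ler_piMr// ?truncz_dist// ltW.
Qed.

(* A reset by [w * z] releases the energy [w ^ 2 * |z|], by [truncz_drop]. *)
Lemma sd_drop y t : sd_state y t.+1 ^+ 2 + w ^+ 2 * (`|sd_digit y t|%N)%:R <=
  (a t * y t + sd_state y t) ^+ 2.
Proof.
rewrite sd_stateS /sd_digit; case: ifP => _; last first.
  by rewrite mulr0z mulr0 subr0 absz0 mulr0 addr0 [a t * _ + _]addrC.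
rewrite [a t * _ + _]addrC; set u := sd_state y t + a t * y t.
have h := truncz_drop (u / w).
have e1 : u - w * (truncz (u / w))%:~R = w * (u / w - (truncz (u / w))%:~R) by field; rewrite gt_eqF.
have e2 : u ^+ 2 = w ^+ 2 * (u / w) ^+ 2 by field; rewrite gt_eqF.
by rewrite e1 [X in _ <= X]e2 exprMn -mulrDr ler_wpM2l// sqr_ge0.
Qed.

Lemma sd_state_ext y y' t : (forall i, (i < t)%N -> y i = y' i) -> sd_state y t = sd_state y' t.
Proof.
elim: t => [//|t IH] H; rewrite /= IH; first by rewrite H.
by move=> i it; apply: H; exact: ltnW.
Qed.

Lemma sd_digit_ext y y' t : (forall i, (i <= t)%N -> y i = y' i) -> sd_digit y t = sd_digit y' t.
Proof.
move=> H; rewrite /sd_digit (@sd_state_ext y y' t); first by rewrite H.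
by move=> i it; apply: H; exact: ltnW.
Qed.

(** State and digits are treated together because the next state involves the current digit. *)
Lemma measurable_sd n t : measurable_fun setT (fun x : rn R n => sd_state (coordn x) t) /\
  forall z, measurable [set x : rn R n | sd_digit (coordn x) t = z].
Proof.
have step s : measurable_fun setT (fun x : rn R n => sd_state (coordn x) s) ->
    forall z, measurable [set x : rn R n | sd_digit (coordn x) s = z].
  move=> ms z; rewrite /sd_digit; case: (boolP (M %| s.+1)%N) => _.
    have mu_ : measurable_fun setT (fun x : rn R n => (sd_state (coordn x) s + a s * coordn x s) / w).
      apply: measurable_funM => //; apply: measurable_funD => //.
      by apply: measurable_funM => //; exact: measurable_coordn.
    have := mu_ measurableT _ (measurable_truncz_fiber z).
    by rewrite setTI.
  have [->|nz] := eqVneq 0 z.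
    by rewrite (_ : [set x | _] = setT)//; apply/seteqP; split.
  by rewrite (_ : [set x | _] = set0)//; apply/seteqP; split => // x /= /eqP; rewrite (negbTE nz).
suff H : measurable_fun setT (fun x : rn R n => sd_state (coordn x) t) by split => //; exact: step.
elim: t => [|t IH]; first exact: measurable_cst.
under eq_fun do rewrite sd_stateS.
apply: measurable_funB.
  apply: measurable_funD => //.
  by apply: measurable_funM => //; exact: measurable_coordn.
apply: measurable_funM => //.
exact: (measurable_fun_fibers (fun z : int => z%:~R) (step _ IH)).
Qed.

(** Induction on time: given the past, [sd_drop] bounds the new energy by the square of an affine
    function of the fresh Gaussian, whose mean exceeds the old energy by at most
    [102/100 * a n ^ 2]. *)
Lemma sd_energy n :
  (\int[gauss_rn R n]_x (sd_state (coordn x) n ^+ 2 + w ^+ 2 * \sum_(t < n) (`|sd_digit (coordn x) t|%N)%:R)%:E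
   <= (102 / 100 * \sum_(t < n) a t ^+ 2)%:E)%E.
Proof.
have w2 : 0 <= w ^+ 2 by rewrite sqr_ge0.
pose F n (x : rn R n) := sd_state (coordn x) n ^+ 2 + w ^+ 2 * \sum_(t < n) (`|sd_digit (coordn x) t|%N)%:R.
have F0 k x : 0 <= F k x by rewrite addr_ge0 ?sqr_ge0// mulr_ge0// sumr_ge0.
have mF k : measurable_fun setT (F k).
  apply: measurable_funD; first by apply: measurable_funX; case: (measurable_sd k k).
  apply: measurable_funM => //; apply: measurable_sum => t.
  apply: (measurable_fun_fibers (fun z : int => (`|z|%N)%:R)).
  by case: (measurable_sd k t).
suff : (\int[gauss_rn R n]_x (F n x)%:E <= (102 / 100 * \sum_(t < n) a t ^+ 2)%:E)%E by [].
elim: n => [|n IH].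
  rewrite integral0_eq ?big_ord0 ?mulr0// => x _.
  by rewrite /F/= expr0n big_ord0 mulr0 addr0.
rewrite ge0_integral_gauss_rn_recr; [|exact/measurable_EFinP|by move=> x; rewrite lee_fin].
apply: (@le_trans _ _ (\int[gauss_rn R n]_x ((F n x)%:E + (102 / 100 * a n ^+ 2)%:E))%E).
  apply: ge0_le_integral => //.
  - by move=> x _; apply: integral_ge0 => t _; rewrite lee_fin.
  - apply: (measurable_fun_fubini_tonelli_G (fun z => (F n.+1 z)%:E)) => //.
    have h : measurable_fun setT (fun z : rn R n.+1 => (F n.+1 z)%:E) by exact/measurable_EFinP.
      exact: h.
    by move=> z; have := F0 n.+1 z; rewrite -lee_fin.
  - by apply: emeasurable_funD => //; exact/measurable_EFinP.
  move=> x _.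
  pose c := w ^+ 2 * \sum_(t < n) (`|sd_digit (coordn x) t|%N)%:R.
  have c0 : 0 <= c by rewrite mulr_ge0// sumr_ge0.
  have mA : measurable_fun setT (fun t : measurableTypeR R => ((a n * t + sd_state (coordn x) n) ^+ 2)%:E).
    by apply/measurable_EFinP; apply: measurable_funX; exact: measurable_affine.
  apply: (@le_trans _ _ (\int[gam]_t (((a n * t + sd_state (coordn x) n) ^+ 2)%:E + c%:E))%E).
    apply: ge0_le_integral => //.
    - by move=> t _; rewrite lee_fin.
    - have := measurableT_comp (mF n.+1) (measurable_pair2 x).
      by move=> h; exact/measurable_EFinP.
    - exact: emeasurable_funD.
    move=> t _; rewrite -EFinD lee_fin /F.
    (* The earlier states and digits of the prolonged path [tx] are those of [x], since they do not
       see its last coordinate. *)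
    pose tx : rn R n.+1 := (t, x).
    have e1 s : (s <= n)%N -> sd_state (coordn tx) s = sd_state (coordn x) s.
      by move=> sn; apply: sd_state_ext => i it /=; rewrite ltn_eqF// (leq_trans it).
    have -> : \sum_(i < n.+1) (`|sd_digit (coordn tx) i|%N)%:R =
       \sum_(i < n) (`|sd_digit (coordn x) i|%N)%:R + (`|sd_digit (coordn tx) n|%N)%:R :> R.
      rewrite big_ord_recr; congr (_ + _).
      apply: eq_bigr => i _; congr ((`|_|%N)%:R); apply: sd_digit_ext => k ki /=.
      by rewrite ltn_eqF//; exact: leq_ltn_trans ki (ltn_ord i).
    rewrite mulrDr -/c addrCA [leRHS]addrC lerD2l.
    have cE : coordn tx n = t by rewrite /= eqxx.
    by have := sd_drop (coordn tx) n; rewrite cE (e1 n (leqnn n)).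
  rewrite ge0_integralD//; last by move=> t _; rewrite lee_fin sqr_ge0.
  rewrite (@integral_cst _ _ _ gam)//= (_ : gam setT = 1%E); last exact: probability_setT.
  rewrite mule1 /F -EFinD -/c.
  apply: (le_trans (leeD2r _ (normal_affine_sqr_le _ _))).
  by rewrite -EFinD lee_fin; lra.
rewrite ge0_integralD//; last 3 first.
- by move=> x _; rewrite lee_fin.
- exact/measurable_EFinP.
- by move=> x _; rewrite lee_fin mulr_ge0// sqr_ge0.
rewrite integral_cst//= (_ : gauss_rn R n setT = 1%E); last exact: probability_setT.
rewrite mule1 big_ord_recr/= mulrDr EFinD; exact: leeD2r.
Qed.

Lemma sd_digit_sum n :
  (\sum_(t < n) \int[gauss_rn R n]_x ((`|sd_digit (coordn x) t|%N)%:R)%:E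
   <= (102 / 100 * (\sum_(t < n) a t ^+ 2) / w ^+ 2)%:E)%E.
Proof.
have w2 : 0 < w ^+ 2 by rewrite exprn_gt0.
have md t : measurable_fun setT (fun x : rn R n => ((`|sd_digit (coordn x) t|%N)%:R : R)%:E).
  apply/measurable_EFinP; apply: (measurable_fun_fibers (fun z : int => (`|z|%N)%:R)).
  by case: (measurable_sd n t).
rewrite -ge0_integral_sum//.
have mS : measurable_fun setT (fun x : rn R n => (\sum_(t < n) ((`|sd_digit (coordn x) t|%N)%:R : R)%:E)%E).
  by apply: emeasurable_sum.
rewrite [X in (_ <= X%:E)%E]mulrC EFinM lee_pdivlMl// -ge0_integralZl//; last 2 first.
- by move=> x _; rewrite sume_ge0.
- by rewrite lee_fin ltW.
apply: le_trans (sd_energy n); apply: ge0_le_integral => //.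
- by move=> x _; rewrite mule_ge0 ?sume_ge0// lee_fin ltW.
- by apply: emeasurable_funM => //; exact: emeasurable_sum.
- apply/measurable_EFinP; apply: measurable_funD.
    by apply: measurable_funX; case: (measurable_sd n n).
  apply: measurable_funM => //; apply: measurable_sum => t.
  apply: (measurable_fun_fibers (fun z : int => (`|z|%N)%:R)).
  by case: (measurable_sd n t).
by move=> x _; rewrite sumEFin -EFinM lee_fin lerDr sqr_ge0.
Qed.
End SigmaDelta.

Lemma measurable_forall d (T : measurableType d) (C : countType) (A : C -> set T) :
  (forall c, measurable (A c)) -> measurable [set x | forall c, A c x].
Proof.
move=> mA; rewrite -[X in measurable X]setCK; apply: measurableC.
rewrite (_ : ~` _ = \bigcup_c ~` A c).
  apply: countable_bigcupT_measurable; first exact: countableP.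
  by move=> c; exact: measurableC.
apply/seteqP; split => x /=.
  by move=> /existsNP[c nA]; exists c.
by move=> [c _ nA] /(_ c).
Qed.

Lemma measurable_impl d (T : measurableType d) (b : bool) (A : set T) :
  measurable A -> measurable [set x | b -> A x].
Proof.
move=> mA; case: b.
  by rewrite (_ : [set x | _] = A)//; apply/seteqP; split => x /=; [exact|].
by rewrite (_ : [set x | _] = setT)//; apply/seteqP; split.
Qed.

Lemma measurable_norm_le d (T : measurableType d) (R : realType) (f : T -> R) (c : R) :
  measurable_fun setT f -> measurable [set x | `|f x| <= c].
Proof.
move=> mf; have := mf measurableT `[- c, c]%classic (measurable_itv _).
by rewrite setTI /preimage/=; under eq_set do rewrite in_itv/= -ler_norml.
Qed.

(** * Expected digits of linear forms and of single coordinates *)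

Section LinearDigits.
Variable R : realType.

Lemma expR1_ge : 5 / 2 <= expR (1 : R).
Proof.
have -> : (1 : R) = 8%:R * (1 / 8) by field.
rewrite expRM_natl; apply: (@le_trans _ _ ((9 / 8) ^+ 8)); first by lra.
have h : 9 / 8 <= expR (1 / 8 : R) by apply: le_trans (expR_ge1Dx _); lra.
by rewrite lerXn2r// ?nnegrE ?expR_ge0//; lra.
Qed.

Lemma expR_nat_ge (k : nat) : (5 / 2) ^+ k <= expR (k%:R : R).
Proof.
rewrite -[k%:R]mulr1 expRM_natl; have h := expR1_ge.
by rewrite lerXn2r// ?nnegrE ?expR_ge0//; lra.
Qed.

Lemma expRN10_le : expR (- 10 : R) <= 105 / 10 ^+ 6.
Proof.
rewrite expRN -[leRHS]invrK lef_pV2 ?posrE ?expR_gt0 ?invr_gt0//; try lra.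
by apply: le_trans (expR_nat_ge 10); lra.
Qed.

Lemma measurable_linear n (a : nat -> R) k :
  measurable_fun setT (fun x : rn R n => \sum_(i < k) a i * coordn x i).
Proof.
by apply: measurable_sum => i; apply: measurable_funM => //; exact: measurable_coordn.
Qed.

Lemma measurable_truncz d (T : measurableType d) (f : T -> R) z :
  measurable_fun setT f -> measurable [set x | truncz (f x) = z].
Proof. by move=> mf; have := mf measurableT _ (measurable_truncz_fiber z); rewrite setTI. Qed.

(** Chernoff bound with the optimal parameter [l = b / s2]; the hypothesis [s2 <= b ^ 2] gives
    [l * b >= 1], as [truncz_le_exp] requires. *)
Lemma linear_digit n (a : nat -> R) (b s2 : R) : 0 < b -> 0 < s2 -> s2 <= b ^+ 2 ->
  \sum_(i < n) a i ^+ 2 <= s2 ->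
  (\int[gauss_rn R n]_x ((`|truncz ((\sum_(i < n) a i * coordn x i) / b)|%N)%:R)%:E
   <= (2 * expR (- (b ^+ 2 / (2 * s2))))%:E)%E.
Proof.
move=> b0 s0 sb as2.
pose l := b / s2.
have l0 : 0 < l by rewrite divr_gt0.
have lb : 1 <= l * b by rewrite /l mulrAC ler_pdivlMr// mul1r -expr2.
pose X (x : rn R n) := \sum_(i < n) a i * coordn x i.
have mX : measurable_fun setT X by exact: measurable_linear.
have mE c : measurable_fun setT (fun x => (expR (c * X x))%:E).
  by apply/measurable_EFinP; apply: measurableT_comp => //; exact: measurable_funM.
have E0 c x : (0 <= (expR (c * X x))%:E)%E by rewrite lee_fin expR_ge0.
have e0 : (0 <= (expR (- (l * b)))%:E)%E by rewrite lee_fin expR_ge0.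
apply: (@le_trans _ _ (\int[gauss_rn R n]_x ((expR (- (l * b)))%:E * ((expR (l * X x))%:E + (expR (- l * X x))%:E)))%E).
  apply: ge0_le_integral => //.
  - apply/measurable_EFinP; apply: (measurable_fun_fibers (fun z : int => (`|z|%N)%:R)) => z.
    by apply: measurable_truncz; exact: measurable_funM.
  - by apply: emeasurable_funM => //; exact: emeasurable_funD.
  move=> x _; rewrite -EFinD -EFinM lee_fin -/(X x).
  apply: (le_trans (truncz_le_exp (X x / b) lb)).
  have -> : l * b * (`|X x / b| - 1) = - (l * b) + l * `|X x|.
    by rewrite normrM normfV (gtr0_norm b0); field; rewrite gt_eqF.
  rewrite expRD ler_wpM2l ?expR_ge0//.
  have := expR_ge0 (l * X x); have := expR_ge0 (- l * X x).
  case: (leP 0 (X x)) => h; first by rewrite (ger0_norm h); lra.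
  by rewrite (ltr0_norm h) mulrN mulNr; lra.
rewrite ge0_integralZl//; last 2 first.
- exact: emeasurable_funD.
- by move=> x _; rewrite adde_ge0.
rewrite ge0_integralD// /X !gauss_rn_mgf sqrrN -EFinD -EFinM lee_fin.
rewrite -mulr2n -[_ *+ 2]mulr_natl mulrCA ler_wpM2l// -expRD ler_expR.
have -> : - (b ^+ 2 / (2 * s2)) = - (l * b) + l ^+ 2 / 2 * s2.
  by rewrite /l; field; rewrite gt_eqF.
by rewrite lerD2l ler_wpM2l// divr_ge0// sqr_ge0.
Qed.

(** A walk whose only nonzero coefficient is the [i]-th, with period [n.+1], is never reset up to
    time [n]; its energy bound is the second moment of the coordinate. *)
Lemma coord_digit n i : (i < n)%N ->
  (\int[gauss_rn R n]_x ((`|truncz (coordn x i)|%N)%:R)%:E <= (102 / 100)%:E)%E.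
Proof.
move=> ni; pose a (k : nat) : R := (k == i)%:R.
have sumE (f : nat -> R) : \sum_(k < n) a k * f k = f i.
  rewrite (bigD1 (Ordinal ni))//= /a eqxx mul1r big1 ?addr0// => k ki.
  by rewrite (_ : (k == i :> nat) = false) ?mul0r//; apply: contra_neqF ki => /eqP e; apply/val_inj.
have := @sd_energy R a 1 n.+1 ltr01 n.
have -> : \sum_(t < n) a t ^+ 2 = 1.
  by rewrite -[RHS](sumE (fun=> 1)); apply: eq_bigr => k _; rewrite /a expr2 mulr1; case: (_ == _); rewrite ?mulr1 ?mulr0.
rewrite mulr1; apply: le_trans; apply: ge0_le_integral => //.
- by apply/measurable_EFinP; apply: (measurable_fun_fibers (fun z : int => (`|z|%N)%:R)) => z;
     apply: measurable_truncz; exact: measurable_coordn.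
- apply/measurable_EFinP; apply: measurable_funD.
    by apply: measurable_funX; case: (measurable_sd a 1 n.+1 n n).
  apply: measurable_funM => //; apply: measurable_sum => t.
  apply: (measurable_fun_fibers (fun z : int => (`|z|%N)%:R)).
  by case: (measurable_sd a 1 n.+1 n t).
move=> x _; rewrite lee_fin.
have d0 (t : 'I_n) : sd_digit a 1 n.+1 (coordn x) t = 0.
  by rewrite /sd_digit gtnNdvd// ltnS ltn_ord.
have Z1 : \sum_(t < n) sd_digit a 1 n.+1 (coordn x) t = 0 by apply: big1 => t _; exact: d0.
have Z2 : \sum_(t < n) (`|sd_digit a 1 n.+1 (coordn x) t|%N)%:R = 0 :> R.
  by apply: big1 => t _; rewrite d0.
by rewrite sd_stateE Z1 Z2 mulr0z !mulr0 subr0 addr0 sumE truncz_le_sqr.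
Qed.
End LinearDigits.

(** * Gaussian measure of the prefix body *)

Section PrefixBody.
Variables (R : realType) (m n k0 : nat) (a : 'I_m -> nat -> R) (S : {set 'I_n}) (N : R).
Hypothesis a1 : forall j i, `|a j i| <= 1.
Hypothesis aN : forall j, \sum_(i < n) a j i ^+ 2 <= N.
Hypothesis nN : n%:R <= 2 * N.
Hypothesis n0 : (0 < n)%N.
Hypothesis mk0 : (m <= 2 ^ k0)%N.
Hypothesis k0m : (0 < m)%N -> (2 ^ k0 < 2 * m)%N.

Let sm : R := Num.sqrt m%:R.
Let w := 64 * sm.
(** A block of level [s] has standard deviation of order [sm * 2 ^ (- (s+1) / 2)]. As 3/4 exceeds
    the inverse square root of 2, the thresholds decay more slowly than that, yet remain
    summable. *)
Let b (s : nat) := 16 * sm * (3 / 4) ^+ s.+1.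

Definition prefix_body : set (rn R n) :=
  [set x | (forall (j : 'I_m) (t : nat), (t <= n)%N ->
              `|\sum_(i < t) a j i * coordn x i| <= 112 * Num.sqrt m%:R) /\
           (forall i : 'I_n, i \in S -> `|coordn x i| <= 1)].

Lemma measurable_prefix_body : measurable prefix_body.
Proof.
apply: measurableI.
  apply: measurable_forall => j; apply: measurable_forall => t; apply: measurable_impl.
  by apply: measurable_norm_le; exact: measurable_linear.
apply: measurable_forall => i; apply: measurable_impl.
by apply: measurable_norm_le; exact: measurable_coordn.
Qed.

Let blk (j : 'I_m) (s q i : nat) : R :=
  if (q * 2 ^ (k0 - s.+1) <= i < q.+1 * 2 ^ (k0 - s.+1))%N then a j i else 0.

Let J : finType := ('I_m * 'I_n + 'I_m * 'I_k0 * 'I_n + 'I_n)%type.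

(* Three families of digits: the sigma-delta resets of row [j] at time [t], the
   [q]-th dyadic block of row [j] at level [s], and the coordinates in [S]. *)
Let rel (e : J) : bool :=
  match e with
  | inl (inl (j, t)) => (2 ^ k0 %| t.+1)%N
  | inl (inr ((j, s), q)) => (q.+1 * 2 ^ (k0 - s.+1) <= n)%N
  | inr i => i \in S
  end.

Let dig (e : J) (x : rn R n) : int :=
  match e with
  | inl (inl (j, t)) => sd_digit (a j) w (2 ^ k0) (coordn x) t
  | inl (inr ((j, s), q)) => if rel e then truncz ((\sum_(i < n) blk j s q i * coordn x i) / b s) else 0
  | inr i => if rel e then truncz (coordn x i) else 0
  end.

(** The number of blocks doubles with each level, so their weights grow with [s]; the other weights
    balance the expected size of a digit against its counting cost. *)
Let L (e : J) : R :=
  match e with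
  | inl (inl _) => 10
  | inl (inr ((j, s), q)) => 10 + 3 * s.+1%:R
  | inr i => 2
  end.

Let sm0 (j : 'I_m) : 0 < sm.
Proof. by rewrite sqrtr_gt0 ltr0n (leq_ltn_trans _ (ltn_ord j)). Qed.

Let b0 (j : 'I_m) s : 0 < b s.
Proof. by rewrite /b !mulr_gt0 ?(sm0 j)// exprn_gt0//; lra. Qed.

Lemma sum_window (f : nat -> R) (u v k : nat) : (u <= v)%N ->
  \sum_(i < k) (if (u <= i < v)%N then f i else 0) = \sum_(i < minn v k) f i - \sum_(i < minn u k) f i.
Proof.
move=> uv; elim: k => [|k IH]; first by rewrite !minn0 !big_ord0 subr0.
rewrite big_ord_recr/= IH.
have [ku|uk] := ltnP k u.
  rewrite /= addr0 ?(minn_idPr (ltnW (leq_trans ku uv))) ?(minn_idPr (ltnW ku)).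
  by rewrite ?(minn_idPr (leq_trans ku uv)) ?(minn_idPr ku) !big_ord_recr/=; ring.
have [kv|vk] := ltnP k v.
  rewrite /= ?(minn_idPr (ltnW kv)) ?(minn_idPl uk) ?(minn_idPr kv) ?(minn_idPl (leqW uk)).
  by rewrite big_ord_recr/=; ring.
by rewrite /= addr0 ?(minn_idPl vk) ?(minn_idPl uk) ?(minn_idPl (leqW vk)) ?(minn_idPl (leqW uk)).
Qed.

Lemma same_digits_prefix_body (x y : rn R n) :
  (forall e, dig e x = dig e y) -> prefix_body (half_diff x y).
Proof.
move=> dE; split; last first.
  move=> i iS; rewrite coordn_mk_rn// normrM (@ger0_norm _ 2^-1)// ler_pdivrMr// mul1r.
  by apply: truncz_half_diff; have := dE (inr i); rewrite /dig /rel iS.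
move=> j t tn; rewrite -/sm.
pose P k (z : rn R n) := \sum_(i < k) a j i * coordn z i.
have -> : \sum_(i < t) a j i * coordn (half_diff x y) i = (P t x - P t y) / 2.
  rewrite /P -sumrB mulr_suml; apply: eq_bigr => i _.
  by rewrite coordn_mk_rn ?(leq_trans (ltn_ord i))//; ring.
rewrite normrM (@ger0_norm _ 2^-1)// ler_pdivrMr//.
have w0 : 0 < w by rewrite mulr_gt0// (sm0 j).
(* The sigma-delta states contribute [w = 64 sm] and the blocks of the binary
   expansion of [t] at most [16 sm * sum (3/4) ^ s = 48 sm]: in total [112 sm]. *)
have claim s : (s <= k0)%N -> forall q, (q * 2 ^ (k0 - s) <= n)%N ->
   `|P (q * 2 ^ (k0 - s))%N x - P (q * 2 ^ (k0 - s))%N y| <= 2 * (w + \sum_(i < s) b i).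
  elim: s => [_ q|s IH sk q] qn.
    rewrite big_ord0 addr0 subn0; rewrite subn0 in qn.
    set T := (q * 2 ^ k0)%N in qn *.
    have dT : (2 ^ k0 %| T)%N by exact: dvdn_mull.
    have eP z : P T z = sd_state (a j) w (2 ^ k0) (coordn z) T +
        w * (\sum_(i < T) sd_digit (a j) w (2 ^ k0) (coordn z) i)%:~R.
      by rewrite sd_stateE subrK.
    have e : \sum_(i < T) sd_digit (a j) w (2 ^ k0) (coordn x) i =
             \sum_(i < T) sd_digit (a j) w (2 ^ k0) (coordn y) i.
      apply: eq_bigr => i _.
      by have := dE (inl (inl (j, Ordinal (leq_trans (ltn_ord i) qn)))).
    rewrite !eP e opprD addrACA subrr addr0.
    have := sd_state_le (a j) w0 (coordn x) dT; have := sd_state_le (a j) w0 (coordn y) dT.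
    by move=> h1 h2; apply: (le_trans (ler_normB _ _)); lra.
  have k1 : (k0 - s = (k0 - s.+1).+1)%N by rewrite -subSn.
  set h := (k0 - s.+1)%N in k1 qn *.
  have IHs q' := IH (ltnW sk) q'.
  have bs := ltW (b0 j s).
  have qE := odd_double_half q.
  have e2 : (q./2 * 2 ^ (k0 - s) = q./2.*2 * 2 ^ h)%N.
    by rewrite k1 expnS mulnA muln2.
  have le2 : (q./2 * 2 ^ (k0 - s) <= n)%N.
    by rewrite e2 (leq_trans _ qn)// leq_mul2r -{2}qE leq_addl orbT.
  have := IHs q./2 le2; rewrite e2 big_ord_recr/= => hq.
  (* Halving the mesh: an even multiple is already a point of the coarser grid, and an odd one is
     reached from the preceding even one by a single block. *)
  case: (boolP (odd q)) qE => oq qE; last first.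
    by rewrite -qE add0n; apply: (le_trans hq); lra.
  pose p := q./2.*2.
  have qp : q = p.+1 by rewrite -qE.
  have pn : (p < n)%N.
    by apply: leq_trans qn; rewrite qp leq_pmulr// expn_gt0.
  have := dE (inl (inr ((j, Ordinal sk), Ordinal pn))).
  rewrite /dig /rel /= -/h -qp qn => /truncz_half_diff.
  have X z : \sum_(i < n) blk j s p i * coordn z i = P (q * 2 ^ h)%N z - P (p * 2 ^ h)%N z.
    transitivity (\sum_(i < n) (if (p * 2 ^ h <= i < q * 2 ^ h)%N then a j i * coordn z i else 0)).
      apply: eq_bigr => i _; rewrite /blk -/h -qp; case: ifP => // _; exact: mul0r.
    rewrite (@sum_window (fun i => a j i * coordn z i)); last by rewrite leq_mul2r qp leqnSn orbT.
    rewrite (minn_idPl qn) (minn_idPl _)//; apply: leq_trans qn.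
    by rewrite leq_mul2r qp leqnSn orbT.
  rewrite !X -mulrBl normrM normfV (gtr0_norm (b0 j s)) ler_pdivrMr ?(b0 j s)// => hb.
  move: hq; rewrite -/p => hq.
  set A := P _ x in hb *; set B := P _ y in hb *.
  set A' := P _ x in hb hq *; set B' := P _ y in hb hq *.
  rewrite (_ : A - B = (A - A' - (B - B')) + (A' - B')); last by ring.
  apply: (le_trans (ler_normD _ _)); lra.
have := claim k0 (leqnn k0) t; rewrite subnn muln1 => /(_ tn) h; apply: (le_trans h).
suff : \sum_(i < k0) b i <= 48 * sm by rewrite /w; lra.
rewrite /b -mulr_sumr.
have g : \sum_(i < k0) (3 / 4 : R) ^+ i.+1 <= 3.
  have e k : \sum_(i < k) (3 / 4 : R) ^+ i.+1 = 3 - 3 * (3 / 4) ^+ k.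
    elim: k => [|k IH]; first by rewrite big_ord0 expr0; lra.
    by rewrite big_ord_recr/= IH exprS; lra.
  by rewrite e lerBlDr lerDl mulr_ge0// exprn_ge0//; lra.
have := ltW (sm0 j); nra.
Qed.

Lemma sum_dvd_count (d k : nat) (c : R) : (0 < d)%N ->
  \sum_(t < k | (d %| t.+1)%N) c = (k %/ d)%:R * c.
Proof.
move=> d0; elim: k => [|k IH]; first by rewrite big_ord0 div0n mul0r.
by rewrite big_mkcond big_ord_recr/= -big_mkcond IH divnS// natrD mulrDl addrC; case: ifP => _; rewrite ?mul1r ?mul0r.
Qed.

Lemma sum_lt_count (h k : nat) (c : R) : 0 <= c ->
  \sum_(q < k | (q < h)%N) c <= h%:R * c.
Proof.
move=> c0; have -> : \sum_(q < k | (q < h)%N) c = (minn k h)%:R * c.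
  elim: k => [|k IH]; first by rewrite big_ord0 min0n mul0r.
  rewrite big_mkcond big_ord_recr/= -big_mkcond IH.
  case: ifP => hk; first by rewrite (minn_idPl (ltnW hk)) (minn_idPl hk) -natr1 mulrDl mul1r.
  move/negbT: hk; rewrite -leqNgt => hk.
  by rewrite (minn_idPr hk) (minn_idPr (leqW hk)) addr0.
by rewrite ler_wpM2r// ler_nat geq_minr.
Qed.

(** All rows together have at most [m * n / 2 ^ (k0 - s - 1) <= n * 2 ^ (s + 1)] complete blocks of
    level [s], because [m <= 2 ^ k0]. *)
Let cost2 (c : nat -> R) : (forall s, 0 <= c s) ->
  \sum_(p : 'I_m * 'I_k0 * 'I_n | rel (inl (inr p))) c p.1.2 <=
  n%:R * \sum_(s < k0) 2 ^+ s.+1 * c s.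
Proof.
move=> c0; rewrite big_mkcond.
rewrite (eq_bigr (fun p : 'I_m * 'I_k0 * 'I_n =>
   (fun (js : 'I_m * 'I_k0) (q : 'I_n) => if (q.+1 * 2 ^ (k0 - js.2.+1) <= n)%N then c js.2 else 0) p.1 p.2)); last first.
  by move=> [[j s] q] _.
rewrite -(pair_bigA _ (fun (js : 'I_m * 'I_k0) (q : 'I_n) => if (q.+1 * 2 ^ (k0 - js.2.+1) <= n)%N then c js.2 else 0)).
rewrite -(pair_bigA _ (fun (j : 'I_m) (s : 'I_k0) => \sum_(q < n) if (q.+1 * 2 ^ (k0 - s.+1) <= n)%N then c s else 0))/=.
rewrite sumr_const card_ord -[X in X <= _]mulr_natl mulr_sumr mulr_sumr.
apply: ler_sum => s _; rewrite -big_mkcond/=.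
set h := (2 ^ (k0 - s.+1))%N.
have h0 : (0 < h)%N by rewrite expn_gt0.
under eq_bigl do rewrite -leq_divRL//.
apply: (@le_trans _ _ (m%:R * ((n %/ h)%:R * c s))).
  by rewrite ler_wpM2l// sum_lt_count.
rewrite !mulrA ler_wpM2r// -natrX -!natrM ler_nat.
apply: (@leq_trans (2 ^ k0 * (n %/ h))%N); first by rewrite leq_mul2r mk0 orbT.
have -> : (2 ^ k0 = 2 ^ s.+1 * h)%N by rewrite /h -expnD subnKC.
rewrite -mulnA mulnC leq_mul2r; apply/orP; right.
by rewrite mulnC leq_trunc_div.
Qed.

Let N0 : 0 <= N.
Proof. by have : 0 <= (n%:R : R) by []; move: nN; lra. Qed.

Let geom2 (k : R) : 0 <= k <= 3^-1 -> \sum_(s < k0) k ^+ s.+1 <= 1 / 2.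
Proof. by move=> hk; apply: (le_trans (geometric_sum_le k0 hk)); lra. Qed.

Let expR2 : expR (- 2 : R) <= 3^-1.
Proof.
rewrite expRN lef_pV2 ?posrE ?expR_gt0//.
by rewrite (le_trans _ (expR_ge1Dx _))//; lra.
Qed.

Let pow2_exp (s : nat) : (2 : R) ^+ s.+1 <= expR s.+1%:R.
Proof.
apply: le_trans (expR_nat_ge _ _); have h : (2 : R) <= 5 / 2 by lra.
by rewrite lerXn2r// nnegrE; lra.
Qed.

Let geom_exp (c l : R) : 3 <= l -> \sum_(s < k0) 2 ^+ s.+1 * expR (c - l * s.+1%:R) <= expR c / 2.
Proof.
move=> l3.
apply: (@le_trans _ _ (\sum_(s < k0) expR c * expR (- 2) ^+ s.+1)).
  apply: ler_sum => s _.
  apply: (@le_trans _ _ (expR s.+1%:R * expR (c - l * s.+1%:R))).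
    by rewrite ler_wpM2r ?expR_ge0 ?pow2_exp.
  rewrite -expRM_natl -!expRD ler_expR.
  have : 0 <= (s.+1%:R : R) by [].
  nra.
rewrite -mulr_sumr ler_wpM2l ?expR_ge0//; have := @geom2 (expR (- 2)).
by rewrite expR_ge0 expR2 mul1r => /(_ isT).
Qed.

Let md e z : measurable [set x | dig e x = z].
Proof.
have mif (c : bool) (f : rn R n -> R) : measurable_fun setT f ->
    measurable [set x | (if c then truncz (f x) else 0) = z].
  move=> mf; case: c; first exact: measurable_truncz.
  have [->|nz] := eqVneq 0 z.
    by rewrite (_ : [set x | _] = setT)//; apply/seteqP; split.
  by rewrite (_ : [set x | _] = set0)//; apply/seteqP; split => // x /= /eqP; rewrite (negbTE nz).
case: e => [[[j t]|[[j s] q]]|i] /=.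
- by case: (measurable_sd (a j) w (2 ^ k0) n t).
- apply: (mif _ (fun x => (\sum_(i < n) blk j s q i * coordn x i) / b s)).
  by apply: measurable_funM => //; exact: measurable_linear.
- by apply: (mif _ (fun x => coordn x i)); exact: measurable_coordn.
Qed.

Let dig0 e x : ~~ rel e -> dig e x = 0.
Proof.
case: e => [[[j t]|[[j s] q]]|i] /= /negbTE h.
- by rewrite /sd_digit h.
- by rewrite h.
- by rewrite h.
Qed.

Let I e : \bar R := (\int[gauss_rn R n]_x ((`|dig e x|%N)%:R)%:E)%E.

Let I0 e : (0 <= I e)%E.
Proof. by apply: integral_ge0 => x _; rewrite lee_fin. Qed.

(** The bound for one row carries a factor [1 / w ^ 2 = 1 / (64 ^ 2 * m)], so summing over the [m]
    rows removes [m]. *)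
Let cost_sd : (\sum_(p : 'I_m * 'I_n | rel (inl (inl p))) (L (inl (inl p)))%:E * I (inl (inl p))
   <= (102 / 10 * N / 64 ^+ 2)%:E)%E.
Proof.
apply: (@le_trans _ _ (\sum_(p : 'I_m * 'I_n) (fun j t => 10%:E * I (inl (inl (j, t)))) p.1 p.2)%E).
  rewrite big_mkcond; apply: lee_sum => -[j t] _ /=; case: ifP => // _.
  by rewrite mule_ge0// lee_fin.
rewrite -(pair_bigA _ (fun j t => (10%:E * I (inl (inl (j, t))))%E)).
apply: (@le_trans _ _ (\sum_(j < m) (102 / 10 * N / 64 ^+ 2 / m%:R)%:E)%E).
  apply: lee_sum => j _.
  rewrite -ge0_sume_distrr; last by move=> t _; exact: I0.
  have m0 : 0 < (m%:R : R) by rewrite ltr0n (leq_ltn_trans _ (ltn_ord j)).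
  have w0 : 0 < w by rewrite mulr_gt0// (sm0 j).
  apply: (@le_trans _ _ (10%:E * (102 / 100 * (\sum_(t < n) a j t ^+ 2) / w ^+ 2)%:E)%E).
    by apply: lee_wpmul2l => //; exact: sd_digit_sum.
  rewrite -EFinM lee_fin /w exprMn /sm sqr_sqrtr// invfM.
  have h := aN j; set A := \sum_(t < n) _ in h *.
  have mi : 0 <= (m%:R)^-1 :> R by rewrite invr_ge0.
  have -> : 10 * (102 / 100 * A * ((64 ^+ 2)^-1 / m%:R)) = (102 / 10 / 64 ^+ 2) * A * (m%:R)^-1 by field; rewrite gt_eqF.
  have -> : 102 / 10 * N / 64 ^+ 2 / m%:R = (102 / 10 / 64 ^+ 2) * N * (m%:R)^-1 by field; rewrite gt_eqF.
  have K0 : 0 <= 102 / 10 / 64 ^+ 2 :> R by lra.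
  exact: ler_wpM2r mi _ _ (ler_wpM2l K0 h).
rewrite sumEFin lee_fin sumr_const card_ord -[X in X <= _]mulr_natl.
have [m0|m0] := posnP m.
  have -> : (m%:R : R) = 0 by rewrite m0.
  by rewrite mul0r; have := N0; lra.
by rewrite mulrC divfK// pnatr_eq0 -lt0n.
Qed.

Let cost_blk : (\sum_(p : 'I_m * 'I_k0 * 'I_n | rel (inl (inr p))) (L (inl (inr p)))%:E * I (inl (inr p))
   <= (n%:R * expR (- 20))%:E)%E.
Proof.
pose c (s : nat) : R := 2 * expR (- 20 - 5 * s.+1%:R).
have c0 s : 0 <= c s by rewrite mulr_ge0// expR_ge0.
apply: (@le_trans _ _ (\sum_(p : 'I_m * 'I_k0 * 'I_n | rel (inl (inr p))) (c p.1.2)%:E)%E); last first.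
  rewrite sumEFin lee_fin (le_trans (cost2 c0))// ler_wpM2l//.
  rewrite /c; under eq_bigr do rewrite mulrCA.
  rewrite -mulr_sumr; have := @geom_exp (- 20) 5; lra.
apply: lee_sum => -[[j s] q] h.
have m0 : (0 < m)%N by rewrite (leq_ltn_trans _ (ltn_ord j)).
have hq : (q.+1 * 2 ^ (k0 - s.+1) <= n)%N by [].
pose s2 : R := 2 ^+ (k0 - s.+1).
have s20 : 0 < s2 by rewrite exprn_gt0.
(* The ratio of squared threshold to block length is at least [128 * (9/8) ^ (s+1)], because
   [2 ^ k0 <= 2 m]; Bernoulli's inequality makes this linear in [s]. *)
have big : 2 * (64 + 8 * s.+1%:R) * s2 <= b s ^+ 2.
  have e1 : b s ^+ 2 = 256 * m%:R * (9 / 16) ^+ s.+1.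
    have q16 : (3 / 4 : R) ^+ 2 = 9 / 16 by lra.
    have -> : (256 : R) = 16 ^+ 2 by lra.
    have qs : ((3 / 4 : R) ^+ s.+1) ^+ 2 = (9 / 16) ^+ s.+1 by rewrite -exprM mulnC exprM q16.
    by rewrite /b [_ ^+ 2]exprMn qs exprMn /sm sqr_sqrtr.
  have bern k : 1 + k%:R / 8 <= (9 / 8 : R) ^+ k.
    elim: k => [|k IH]; first by rewrite expr0; lra.
    have k0' : 0 <= (k%:R : R) by [].
    by rewrite exprS -natr1; nra.
  have mm : (2 : R) ^+ k0 <= 2 * m%:R by rewrite -natrX -natrM ler_nat ltnW// k0m.
  have e2 : (2 : R) ^+ k0 = s2 * 2 ^+ s.+1 by rewrite /s2 -exprD subnK.
  have e3 : (9 / 16 : R) ^+ s.+1 * 2 ^+ s.+1 = (9 / 8) ^+ s.+1 by rewrite -exprMn; congr (_ ^+ _); lra.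
  have := bern s.+1; set B := (9 / 8 : R) ^+ s.+1 in e3 * => hB.
  rewrite e1; set X := (9 / 16 : R) ^+ s.+1 in e3 *.
  have X0 : 0 <= X by rewrite exprn_ge0//; lra.
  have h1 : s2 * B <= 2 * m%:R * X by rewrite -e3 [X * _]mulrC mulrA -e2 ler_wpM2r.
  have h2 : s2 * (1 + s.+1%:R / 8) <= s2 * B by rewrite ler_wpM2l// ltW.
  lra.
have s0 : 0 <= (s.+1%:R : R) by [].
have Lb : (I (inl (inr ((j, s), q))) <= (2 * expR (- (64 + 8 * s.+1%:R)))%:E)%E.
  rewrite /I /= hq.
  apply: (le_trans (@linear_digit R n (blk j s q) (b s) s2 (b0 j s) s20 _ _)).
  - by apply: le_trans big; nra.
  - apply: (@le_trans _ _ (\sum_(i < n) (if (q * 2 ^ (k0 - s.+1) <= i < q.+1 * 2 ^ (k0 - s.+1))%N then 1 else 0))).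
      apply: ler_sum => i _; rewrite /blk; case: ifP => _; last by rewrite expr0n.
      by rewrite -real_normK ?num_real// expr_le1.
    rewrite (@sum_window (fun=> 1)); last by rewrite leq_mul2r leqnSn orbT.
    rewrite (minn_idPl hq) (minn_idPl _); last by rewrite (leq_trans _ hq)// leq_mul2r leqnSn orbT.
    by rewrite !sumr_const !card_ord -natrB ?leq_mul2r ?leqnSn ?orbT// -mulnBl subSnn mul1n /s2 natrX.
  rewrite lee_fin ler_pM2l// ler_expR lerN2 ler_pdivlMr ?mulr_gt0//.
  by apply: le_trans big; rewrite le_eqVlt; apply/orP; left; apply/eqP; ring.
apply: (@le_trans _ _ ((L (inl (inr ((j, s), q))))%:E * (2 * expR (- (64 + 8 * s.+1%:R)))%:E)%E).
  by apply: lee_wpmul2l => //; rewrite lee_fin /=; lra.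
rewrite -EFinM lee_fin /c mulrCA ler_pM2l//=.
apply: (@le_trans _ _ (expR (10 + 3 * s.+1%:R) * expR (- (64 + 8 * s.+1%:R)))).
  by rewrite ler_wpM2r ?expR_ge0//; apply: le_trans (expR_ge1Dx _); lra.
by rewrite -expRD ler_expR; lra.
Qed.

Let cost_coord : (\sum_(i < n | rel (inr i)) (L (inr i))%:E * I (inr i) <= (204 / 100 * #|S|%:R)%:E)%E.
Proof.
apply: (@le_trans _ _ (\sum_(i < n | i \in S) (204 / 100)%:E)%E).
  apply: lee_sum => i iS.
  have -> : (204 / 100)%:E = (2%:E * (102 / 100)%:E :> \bar R)%E by rewrite -EFinM; congr EFin; field.
  have iS' : i \in S := iS.
  have dE x : dig (inr i) x = truncz (coordn x i) by rewrite /dig /rel iS'.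
  have Ii : (I (inr i) <= (102 / 100)%:E)%E.
    by rewrite /I; under eq_integral => x _ do rewrite dE; exact: coord_digit.
  by apply: lee_wpmul2l => //; rewrite lee_fin.
by rewrite sumEFin lee_fin sumr_const -[X in X <= _]mulr_natr.
Qed.

Lemma prefix_body_measure :
  ((expR (- (42 / 10 ^+ 4 * N) - 4 * #|S|%:R - 1) / 5)%:E <= gauss_rn R n prefix_body)%E.
Proof.
pose D := 102 / 10 * N / 64 ^+ 2 + n%:R * expR (- 20) + 204 / 100 * #|S|%:R.
have nR : 0 < (n%:R : R) by rewrite ltr0n.
have D0 : 0 < D.
  rewrite /D ltr_wpDr// ?mulr_ge0//; try lra.
  rewrite ltr_wpDl//; last by rewrite mulr_gt0// expR_gt0.
  by have := N0; lra.
have L2 e : 2 <= L e.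
  case: e => [[[j t]|[[j s] q]]|i] /=; try lra.
  by have : 0 <= (s.+1%:R : R) by []; lra.
have hD : (\sum_(e | rel e) (L e)%:E * I e <= D%:E)%E.
  have -> : (\sum_(e | rel e) (L e)%:E * I e =
     \sum_(p | rel (inl (inl p))) (L (inl (inl p)))%:E * I (inl (inl p)) +
     \sum_(p | rel (inl (inr p))) (L (inl (inr p)))%:E * I (inl (inr p)) +
     \sum_(i | rel (inr i)) (L (inr i))%:E * I (inr i))%E.
    by rewrite big_sumType; congr (_ + _)%E; exact: big_sumType.
  rewrite (_ : D%:E = ((102 / 10 * N / 64 ^+ 2)%:E + (n%:R * expR (- 20))%:E + (204 / 100 * #|S|%:R)%:E)%E); last by rewrite -!EFinD.
  apply: leeD; last exact: cost_coord.
  by apply: leeD; [exact: cost_sd|exact: cost_blk].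
have [r hr] := @large_cell_relevant _ _ R (gauss_rn R n) J rel dig L D md dig0 L2 D0 hD.
pose cell := [set x | forall e, dig e x = r e].
have mcell : measurable cell by apply: measurable_forall => e; exact: md.
(* The counting cost: at most [n] relevant resets, at most [n * 2 ^ (s+1)] relevant blocks of level
   [s], and the coordinates in [S]. *)
have kap : \sum_(e | rel e) expR (- L e) <= n%:R * (3 / 2 * expR (- 10)) + #|S|%:R / 3.
  rewrite big_sumType big_sumType/=; apply: lerD; last first.
    rewrite sumr_const -[_ *+ _]mulr_natl ler_wpM2l//.
  rewrite (_ : 3 / 2 * expR (- 10) = expR (- 10) + expR (- 10) / 2); last by field.
  rewrite mulrDr; apply: lerD.
    rewrite big_mkcond.
    rewrite (eq_bigr (fun p : 'I_m * 'I_n => (fun (j : 'I_m) (t : 'I_n) =>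
       if (2 ^ k0 %| t.+1)%N then expR (- 10) else 0 : R) p.1 p.2)); last by move=> [j t].
    rewrite -(pair_bigA _ (fun (j : 'I_m) (t : 'I_n) => if (2 ^ k0 %| t.+1)%N then expR (- 10) else 0 : R))/=.
    rewrite sumr_const card_ord -[X in X <= _]mulr_natl -big_mkcond/= sum_dvd_count ?expn_gt0//.
    rewrite mulrA ler_wpM2r ?expR_ge0// -natrM ler_nat.
    by rewrite (leq_trans _ (leq_trunc_div n (2 ^ k0)))// mulnC leq_mul2l mk0 orbT.
  pose c (s : nat) : R := expR (- 10 - 3 * s.+1%:R).
  rewrite (eq_bigr (fun p : 'I_m * 'I_k0 * 'I_n => c p.1.2)); last first.
    by move=> [[j s] q] _; rewrite /c opprD.
  have c0 s : 0 <= c s by exact: expR_ge0.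
  by apply: (le_trans (cost2 c0)); rewrite ler_wpM2l//; apply: geom_exp.
have le1 : (gauss_rn R n cell <= gauss_rn R n prefix_body)%E.
  have bi (A : set (rn R n)) : measurable A -> bounded_mfun (\1_A : rn R n -> R).
    move=> mA; split; first exact: measurable_indic.
    by exists 1 => x; rewrite indicE; case: (_ \in _) => /=; rewrite ?lexx ?ler01.
  have mB := measurable_prefix_body.
  have := @prekopa_leindler_rn R n _ _ _ (bi _ mcell) (bi _ mcell) (bi _ mB).
  have pE (A : set (rn R n)) : measurable A -> (\int[gauss_rn R n]_x (\1_A x)%:E = gauss_rn R n A)%E.
    by move=> mA; rewrite integral_indic// setIT.
  rewrite !pE//.
  have fE (A : set (rn R n)) : measurable A -> gauss_rn R n A = (fine (gauss_rn R n A))%:E.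
    by move=> mA; rewrite fineK// fin_num_measure.
  rewrite (fE _ mcell) (fE _ mB) -EFinM -EFin_expe !lee_fin => H.
  have {}H : fine (gauss_rn R n cell) * fine (gauss_rn R n cell) <= fine (gauss_rn R n prefix_body) ^+ 2.
    apply: H => x y; rewrite !indicE.
    case: (boolP (x \in cell)) => [|_]; last by rewrite mul0r mulr_ge0 ?sqr_ge0// expR_ge0.
    case: (boolP (y \in cell)) => [|_]; last by rewrite mulr0 mulr_ge0 ?sqr_ge0// expR_ge0.
    rewrite !inE => cy cx; rewrite mem_set; last first.
      by apply: same_digits_prefix_body => e; rewrite cx cy.
    (* The exponential of the nonnegative cost is at least 1 and is discarded here. *)
    rewrite !mulr1 expr1n mul1r -expR0 ler_expR sumr_ge0// => i _.
    by rewrite divr_ge0// sqr_ge0.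
  by rewrite -ler_sqr ?nnegrE ?fine_ge0.
apply: (le_trans _ le1); apply: (le_trans _ hr).
(* The coefficient of [N] is about [5/4 * 10.2 / 4096 + 9.5e-5], near 0.0032, and that of [#|S|] is
   [5/4 * 2.04 + 1 = 3.55]. *)
rewrite lee_fin ler_pM2r// ler_expR.
have e10 := @expRN10_le R.
have e20 : expR (- 20 : R) <= (105 / 10 ^+ 6) ^+ 2.
  rewrite (_ : - 20 = 2%:R * (- 10)); last by lra.
  by rewrite expRM_natl lerXn2r// ?nnegrE ?expR_ge0//; lra.
have h1 : n%:R * expR (- 20) <= 2 * N * (105 / 10 ^+ 6) ^+ 2.
  by apply: ler_pM => //; exact: expR_ge0.
have h2 : n%:R * (3 / 2 * expR (- 10)) <= 2 * N * (3 / 2 * (105 / 10 ^+ 6)).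
  by have e0 := expR_ge0 (- 10 : R); apply: ler_pM => //; lra.
have S0 : 0 <= (#|S|%:R : R) by [].
have := N0; rewrite /D; lra.
Qed.

End PrefixBody.

(** * Concentration *)

Section FarPoints.
Variable R : realType.

Lemma bounded_mfun_indic d (T : measurableType d) (A : set T) (c : R) : 0 <= c -> measurable A ->
  bounded_mfun (fun x => c * \1_A x : R).
Proof.
move=> c0 mA; split; first by apply: measurable_funM => //; exact: measurable_indic.
exists c => x; rewrite indicE; case: (_ \in _); rewrite ?mulr1 ?mulr0 ?lexx c0//.
Qed.

Lemma integral_scaled_indic d (T : measurableType d) (P : probability T R) (A : set T) (c : R) : 0 <= c ->
  measurable A -> (\int[P]_x (c * \1_A x)%:E = c%:E * P A)%E.
Proof.
move=> c0 mA; under eq_integral do rewrite EFinM.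
rewrite ge0_integralZl// ?lee_fin//; last exact/measurable_EFinP/measurable_indic.
by rewrite integral_indic// setIT.
Qed.

Lemma rat_approx (x e : R) : 0 < e -> exists q : rat, `|x - ratr q| <= e.
Proof.
move=> e0; have [q] : exists q : rat, ratr q \in `]x - e, x + e[ by apply: rat_in_itvoo; lra.
rewrite in_itv/= => /andP[h1 h2]; exists q; rewrite ler_norml; lra.
Qed.

(** The inequality produces the cost [|x + y|^2 / 4]; symmetry of [K] allows [y] to be replaced by
    [- y], which turns it into a squared distance to [K]. *)
Lemma concentration_rn n (K F : set (rn R n)) (rho : R) : measurable K -> measurable F ->
  (forall x, K x -> K (mk_rn n (fun i => - coordn x i))) ->
  (forall x z, F x -> K z -> rho <= \sum_(i < n) (coordn x i - coordn z i) ^+ 2) ->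
  (gauss_rn R n F * gauss_rn R n K <= (expR (- (rho / 4)))%:E)%E.
Proof.
move=> mK mF sK FK.
have c0 : 0 <= expR (rho / 4) by exact: expR_ge0.
have := @prekopa_leindler_rn R n _ _ _ (bounded_mfun_indic c0 mF) (bounded_mfun_indic ler01 mK)
  (bounded_mfun_indic ler01 (@measurableT _ (rn R n))).
rewrite !integral_scaled_indic// !mul1e => H.
have {}H : ((expR (rho / 4))%:E * (gauss_rn R n F * gauss_rn R n K) <= 1%:E)%E.
  rewrite muleA; have -> : 1%:E = (gauss_rn R n setT ^+ 2 :> \bar R)%E.
    have -> : gauss_rn R n setT = 1%E by exact: probability_setT.
    by rewrite expe2 mule1.
  apply: H => x y; rewrite !indicE in_setT /= !mul1r expr1n mul1r.
  case: (boolP (x \in F)) => [|_]; last by rewrite mulr0 mul0r expR_ge0.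
  case: (boolP (y \in K)) => [|_]; last by rewrite mulr0 expR_ge0.
  rewrite !inE => Ky Fx; rewrite !mulr1 ler_expR /half_sum_cost -mulr_suml ler_pM2r//.
  apply: (le_trans (FK _ _ Fx (sK _ Ky))); apply: ler_sum => i _.
  by rewrite coordn_mk_rn// opprK.
rewrite expRN -lee_pdivlMl ?expR_gt0// in H *.
by move: H; rewrite mule1.
Qed.

Lemma far_set n (K : set (rn R n)) (N : R) : measurable K -> 0 < N ->
  (forall x, K x -> K (mk_rn n (fun i => - coordn x i))) ->
  exists F : set (rn R n), [/\ measurable F,
   (forall x, ~ F x -> exists2 z, K z & \sum_(i < n) (coordn x i - coordn z i) ^+ 2 <= 2445 / 10 ^+ 5 * N) &
   (gauss_rn R n F * gauss_rn R n K <= (expR (- (594 / 10 ^+ 5 * N)))%:E)%E].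
Proof.
move=> mK N0 sK.
pose nu := N / 10 ^+ 4 / 101.
have nu0 : 0 < nu by rewrite !divr_gt0// exprn_gt0.
(* Distances to [K] are tested on rational points so as to get a measurable set. *)
pose dist (x : rn R n) (q : {ffun 'I_n -> rat}) := \sum_(i < n) (coordn x i - ratr (q i)) ^+ 2.
pose near q := exists2 z, K z & dist z q <= nu.
pose F := [set x | forall q, near q -> 241 / 10 ^+ 4 * N <= dist x q].
have mdist q : measurable_fun setT (fun x => dist x q).
  apply: measurable_sum => i; apply: measurable_funX; apply: measurable_funB => //.
  exact: measurable_coordn.
have mF : measurable F.
  apply: (@measurable_forall _ _ _ (fun q => [set x | near q -> 241 / 10 ^+ 4 * N <= dist x q])) => q.
  have [nq|nnq] := pselect (near q).
    rewrite (_ : [set x | _] = (fun x => dist x q) @^-1` `[241 / 10 ^+ 4 * N, +oo[).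
      by rewrite -[X in measurable X]setTI; apply: mdist => //; exact: measurable_itv.
    by apply/seteqP; split => x /=; rewrite in_itv/= andbT; [exact|].
  rewrite (_ : [set x | _] = setT)//; apply/seteqP; split => // x _ /= nq.
  by case: (nnq nq).
(* Young's inequality with the weights 1.01 and 101. The choice of [nu] makes the second term cost
   at most [N / 10 ^ 4]. *)
have split2 (u v : R) : (u + v) ^+ 2 <= 101 / 100 * u ^+ 2 + 101 * v ^+ 2.
  have := sqr_ge0 (u / 10 - 10 * v); rewrite !sqrrD exprMn; nra.
exists F; split => //.
- move=> x /existsNP[q /not_implyP[[z Kz zq]] /negP]; rewrite -ltNge => xq.
  exists z => //.
  apply: (@le_trans _ _ (101 / 100 * dist x q + 101 * dist z q)).
    rewrite /dist !mulr_sumr -big_split/=; apply: ler_sum => i _.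
    have -> : coordn x i - coordn z i = (coordn x i - ratr (q i)) + (ratr (q i) - coordn z i) by ring.
    by rewrite (_ : (coordn z i - ratr (q i)) ^+ 2 = (ratr (q i) - coordn z i) ^+ 2)//; ring.
  have : 101 * dist z q <= 101 * nu by rewrite ler_wpM2l.
  have -> : 101 * nu = N / 10 ^+ 4 by rewrite /nu; field.
  lra.
(* A point of [F] has squared distance at least [(0.0241 - 0.0001) N / 1.01 >= 0.02376 N] to [K]. *)
have -> : 594 / 10 ^+ 5 * N = (2376 / 10 ^+ 5 * N) / 4 by field.
apply: concentration_rn => // x z Fx Kz.
(* This gives [e <= 1] and [n * e <= nu], hence [n * e ^ 2 <= nu]. *)
pose e := nu / (n%:R + nu + 1).
have nn : 0 <= (n%:R : R) by [].
have en : 0 < n%:R + nu + 1 by lra.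
have e0 : 0 < e by rewrite divr_gt0.
have [q qP] : exists q : {ffun 'I_n -> rat}, forall i : 'I_n, `|coordn z i - ratr (q i)| <= e.
  exists [ffun i : 'I_n => sval (cid (rat_approx (coordn z i) e0))] => i.
  by rewrite ffunE; case: cid.
have dz : dist z q <= nu.
  apply: (@le_trans _ _ (\sum_(i < n) e ^+ 2)).
    apply: ler_sum => i _; rewrite -real_normK ?num_real//.
    by rewrite lerXn2r ?nnegrE ?(ltW e0).
  rewrite sumr_const card_ord -[X in X <= _]mulr_natl.
  have h1 : e * (n%:R + nu + 1) = nu by rewrite /e divfK// gt_eqF.
  have h2 : e <= 1 by rewrite /e ler_pdivrMr//; lra.
  have h3 : n%:R * e ^+ 2 <= n%:R * e by rewrite ler_wpM2l// expr2 ler_piMr// ltW.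
  have : 0 <= e * (nu + 1) by rewrite mulr_ge0 ?(ltW e0)//; lra.
  nra.
have := Fx q (ex_intro2 _ _ z Kz dz).
have : dist x q <= 101 / 100 * (\sum_(i < n) (coordn x i - coordn z i) ^+ 2) + 101 * dist z q.
  rewrite /dist !mulr_sumr -big_split/=; apply: ler_sum => i _.
  by have -> : coordn x i - ratr (q i) = (coordn x i - coordn z i) + (coordn z i - ratr (q i)) by ring.
have : 101 * dist z q <= 101 * nu by rewrite ler_wpM2l.
have -> : 101 * nu = N / 10 ^+ 4 by rewrite /nu; field.
set A := \sum_(i < n) _; lra.
Qed.
End FarPoints.

(** * Number of large Gaussian entries *)

Section GaussianTail.
Variable R : realType.
Notation mu := (@lebesgue_measure R).
Notation gam := (@normal_prob R 0 1).
Notation phi := (@normal_pdf R 0 1).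

(** On the grid of mesh 1/4, [expR (- x^2 / 2)] at [x = k / 4] is the power [k * k] of
    [expR (- 1/32)], and 31/32 is a rational lower bound for this base. *)
Let pw (k : nat) : R := (31 / 32) ^+ k.

(* [1 / sqrt (2 pi) >= 0.3535] as [pi <= 4], and [expR (- 1/32) >= 31/32]. *)
Lemma normal_pdf_grid_ge (x : R) (k : nat) : 0 <= x <= k%:R / 4 -> 3535 / 10 ^+ 4 * pw (k * k) <= phi x.
Proof.
move=> /andP[x0 xk]; rewrite normal_pdf01E; apply: ler_pM.
- lra.
- by rewrite /pw exprn_ge0//; lra.
- rewrite /normal_peak expr1n mul1r -[X in X <= _]invrK lef_pV2; last 2 first.
  + by rewrite posrE invr_gt0; lra.
  + by rewrite posrE sqrtr_gt0 pmulrn_lgt0// pi_gt0.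
  have p4 : pi *+ 2 <= (3535 / 10 ^+ 4)^-1 ^+ 2 :> R.
    have := @pihalf_lt2 R; rewrite -mulr_natl => h.
    have -> : (3535 / 10 ^+ 4)^-1 ^+ 2 = 10 ^+ 8 / 3535 ^+ 2 :> R by field.
    lra.
  have r0 : 0 <= (3535 / 10 ^+ 4)^-1 :> R by rewrite invr_ge0; lra.
  move: p4 r0; move: (3535 / 10 ^+ 4)^-1 => c p4 r0.
  by rewrite -(ger0_norm r0) -sqrtr_sqr; exact: ler_wsqrtr.
- apply: (@le_trans _ _ (expR (- (k%:R / 4) ^+ 2 / 2))).
    have -> : - (k%:R / 4) ^+ 2 / 2 = (k * k)%:R * (- (1 / 32)) :> R by rewrite natrM; field.
    rewrite expRM_natl /pw; have h : 31 / 32 <= expR (- (1 / 32) : R) by apply: le_trans (expR_ge1Dx _); lra.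
    by rewrite lerXn2r// ?nnegrE ?expR_ge0//; lra.
  rewrite ler_expR; have : x ^+ 2 <= (k%:R / 4) ^+ 2 by rewrite lerXn2r ?nnegrE// (le_trans x0).
  lra.
Qed.

(* The powers of 31/32 are abstracted so that [lra] does not evaluate them. *)
Lemma pw_bounds_abstract (p : nat -> R) :
  (forall k l, p (k + l)%N = p k * p l) -> (forall k, 0 <= p k) ->
  31 / 32 <= p 1%N -> 8807 / 10 ^+ 4 <= p 4%N -> 751 / 10 ^+ 3 <= p 9%N ->
  7279 / 10 ^+ 4 <= p 10%N ->
  [/\ 762 / 10 ^+ 4 <= p 81%N, 416 / 10 ^+ 4 <= p 100%N, 213 / 10 ^+ 4 <= p 121%N,
  1026 / 10 ^+ 5 <= p 144%N & 463 / 10 ^+ 5 <= p 169%N].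
Proof.
have n20 : 5298 / 10 ^+ 4 <= (7279 / 10 ^+ 4) * (7279 / 10 ^+ 4) :> R by clear; lra.
have n40 : 2806 / 10 ^+ 4 <= (5298 / 10 ^+ 4) * (5298 / 10 ^+ 4) :> R by clear; lra.
have n80 : 787 / 10 ^+ 4 <= (2806 / 10 ^+ 4) * (2806 / 10 ^+ 4) :> R by clear; lra.
have n81 : 762 / 10 ^+ 4 <= (787 / 10 ^+ 4) * (31 / 32) :> R by clear; lra.
have n100 : 416 / 10 ^+ 4 <= (787 / 10 ^+ 4) * (5298 / 10 ^+ 4) :> R by clear; lra.
have n120 : 220 / 10 ^+ 4 <= (416 / 10 ^+ 4) * (5298 / 10 ^+ 4) :> R by clear; lra.
have n121 : 213 / 10 ^+ 4 <= (220 / 10 ^+ 4) * (31 / 32) :> R by clear; lra.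
have n140 : 1165 / 10 ^+ 5 <= (220 / 10 ^+ 4) * (5298 / 10 ^+ 4) :> R by clear; lra.
have n144 : 1026 / 10 ^+ 5 <= (1165 / 10 ^+ 5) * (8807 / 10 ^+ 4) :> R by clear; lra.
have n160 : 617 / 10 ^+ 5 <= (1165 / 10 ^+ 5) * (5298 / 10 ^+ 4) :> R by clear; lra.
have n169 : 463 / 10 ^+ 5 <= (617 / 10 ^+ 5) * (751 / 10 ^+ 3) :> R by clear; lra.
have zb1 : 0 <= 31 / 32 :> R by clear; lra.
have zb4 : 0 <= 8807 / 10 ^+ 4 :> R by clear; lra.
have zb9 : 0 <= 751 / 10 ^+ 3 :> R by clear; lra.
have zb10 : 0 <= 7279 / 10 ^+ 4 :> R by clear; lra.
have zb20 : 0 <= 5298 / 10 ^+ 4 :> R by clear; lra.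
have zb40 : 0 <= 2806 / 10 ^+ 4 :> R by clear; lra.
have zb80 : 0 <= 787 / 10 ^+ 4 :> R by clear; lra.
have zb100 : 0 <= 416 / 10 ^+ 4 :> R by clear; lra.
have zb120 : 0 <= 220 / 10 ^+ 4 :> R by clear; lra.
have zb140 : 0 <= 1165 / 10 ^+ 5 :> R by clear; lra.
have zb160 : 0 <= 617 / 10 ^+ 5 :> R by clear; lra.
move=> step q b1 b4 b9 b10.
have mul k l s (u v t : R) : (k + l = s)%N -> u <= p k -> v <= p l -> 0 <= u -> 0 <= v -> t <= u * v -> t <= p s.
  by move=> <- h1 h2 u0 v0 tu; rewrite step (le_trans tu)// ler_pM.
have b20 : 5298 / 10 ^+ 4 <= p 20%N := mul 10%N 10%N 20%N _ _ _ erefl b10 b10 zb10 zb10 n20.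
have b40 : 2806 / 10 ^+ 4 <= p 40%N := mul 20%N 20%N 40%N _ _ _ erefl b20 b20 zb20 zb20 n40.
have b80 : 787 / 10 ^+ 4 <= p 80%N := mul 40%N 40%N 80%N _ _ _ erefl b40 b40 zb40 zb40 n80.
have b81 : 762 / 10 ^+ 4 <= p 81%N := mul 80%N 1%N 81%N _ _ _ erefl b80 b1 zb80 zb1 n81.
have b100 : 416 / 10 ^+ 4 <= p 100%N := mul 80%N 20%N 100%N _ _ _ erefl b80 b20 zb80 zb20 n100.
have b120 : 220 / 10 ^+ 4 <= p 120%N := mul 100%N 20%N 120%N _ _ _ erefl b100 b20 zb100 zb20 n120.
have b121 : 213 / 10 ^+ 4 <= p 121%N := mul 120%N 1%N 121%N _ _ _ erefl b120 b1 zb120 zb1 n121.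
have b140 : 1165 / 10 ^+ 5 <= p 140%N := mul 120%N 20%N 140%N _ _ _ erefl b120 b20 zb120 zb20 n140.
have b144 : 1026 / 10 ^+ 5 <= p 144%N := mul 140%N 4%N 144%N _ _ _ erefl b140 b4 zb140 zb4 n144.
have b160 : 617 / 10 ^+ 5 <= p 160%N := mul 140%N 20%N 160%N _ _ _ erefl b140 b20 zb140 zb20 n160.
have b169 : 463 / 10 ^+ 5 <= p 169%N := mul 160%N 9%N 169%N _ _ _ erefl b160 b9 zb160 zb9 n169.
by split.
Qed.

Lemma pw_bounds : [/\ 762 / 10 ^+ 4 <= pw 81, 416 / 10 ^+ 4 <= pw 100, 213 / 10 ^+ 4 <= pw 121,
  1026 / 10 ^+ 5 <= pw 144 & 463 / 10 ^+ 5 <= pw 169].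
Proof.
apply: pw_bounds_abstract.
- by move=> k l; rewrite /pw exprD.
- by move=> k; rewrite /pw exprn_ge0//; lra.
- by rewrite /pw expr1.
- by rewrite /pw; lra.
- by rewrite /pw; lra.
- by rewrite /pw; lra.
Qed.

Lemma normal_prob_quarter_ge (u c : R) : 0 <= c ->
  (forall x, u <= x < u + 4^-1 -> c <= phi x) ->
  ((c / 4)%:E <= gam `[u, (u + 4^-1)%R[)%E.
Proof.
move=> c0 cphi; rewrite /normal_prob.
apply: (@le_trans _ _ (\int[mu]_(x in `[u, (u + 4^-1)%R[) (cst c%:E x))%E).
  rewrite integral_cst//.
  have := lebesgue_measure_itv `[u, (u + 4^-1)%R[; rewrite /= ?lte_fin => ->.
  rewrite ifT; last by rewrite ltrDl invr_gt0.
  by rewrite -EFinB -EFinM lee_fin addrAC subrr add0r.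
apply: ge0_le_integral => //.
by apply/measurable_EFinP; apply: (@measurable_funS _ _ _ _ setT) => //; exact: measurable_normal_pdf.
Qed.

Lemma normal_prob_itv_ge (k : nat) :
  ((3535 / 10 ^+ 4 * pw (k.+1 * k.+1) / 4)%:E <= gam `[(k%:R / 4)%R, (k%:R / 4 + 4^-1)%R[)%E.
Proof.
apply: normal_prob_quarter_ge.
  apply: mulr_ge0; first by lra.
  by apply: exprn_ge0; lra.
move=> x /andP[h1 h2]; apply: normal_pdf_grid_ge.
have k0 : 0 <= (k%:R : R) / 4 by rewrite divr_ge0.
rewrite (le_trans k0 h1)/= -natr1 mulrDl mul1r; exact: ltW.
Qed.

Lemma measurable_abs_ge2 : measurable [set x : R | 2 <= `|x|].
Proof.
rewrite (_ : [set x | _] = ~` `]-2, 2[); first by apply: measurableC; exact: measurable_itv.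
apply/seteqP; split => x /=; rewrite in_itv/= -ltr_norml leNgt; first by move=> /negP.
by move/negP.
Qed.

(** A lower Riemann sum over the five cells of length 1/4 covering [2, 13/4), with the density taken
    at the right ends; reflection doubles it. *)
Lemma normal_tail2 : ((272 / 10 ^+ 4)%:E <= gam [set x : R | (2 <= `|x|)%R])%E.
Proof.
pose A (k : nat) : set R := `[k%:R / 4, k%:R / 4 + 4^-1[%classic.
have mA k : measurable (A k) by exact: measurable_itv.
pose U := A 8%N `|` A 9%N `|` A 10%N `|` A 11%N `|` A 12%N.
have mU : measurable U by do 4 (apply: measurableU => //).
pose V : set R := (fun x : R => -1 * x + 0) @^-1` U.
have mV : measurable V.
  by rewrite -[X in measurable X]setTI; exact: (measurable_affine (-1) 0 measurableT mU).
have gV : gam V = gam U.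
  have eI (W : set R) : measurable W -> (\int[gam]_x (\1_W x)%:E = gam W)%E.
    by move=> mV'; rewrite integral_indic// setIT.
  rewrite -(eI _ mU) -(eI _ mV) -[RHS]normal_integral_opp.
  - apply: eq_integral => x _.
    rewrite !indicE; congr ((_ : bool)%:R%:E); have -> : - x = -1 * x + 0 by ring.
    by apply/idP/idP; rewrite !inE.
  - by apply/measurable_EFinP; exact: measurable_indic.
  - by move=> x; rewrite lee_fin.
have djA i j : (i < j)%N -> A i `&` A j = set0.
  move=> ij; apply/seteqP; split => // x []; rewrite /A/= !in_itv/= => /andP[_ h1] /andP[h2 _].
  have : (i.+1%:R : R) <= j%:R by rewrite ler_nat.
  by rewrite -natr1; clear -h1 h2; lra.
have gU : ((136 / 10 ^+ 4)%:E <= gam U)%E.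
  rewrite /U !measureU//; try (by rewrite ?setIUl !djA// ?setU0);
    try (do ?apply: measurableU; exact: mA).
  have [q1 q2 q3 q4 q5] := pw_bounds.
  apply: (@le_trans _ _ ((3535 / 10 ^+ 4 * pw 81 / 4)%:E + (3535 / 10 ^+ 4 * pw 100 / 4)%:E +
     (3535 / 10 ^+ 4 * pw 121 / 4)%:E + (3535 / 10 ^+ 4 * pw 144 / 4)%:E + (3535 / 10 ^+ 4 * pw 169 / 4)%:E)%E).
    rewrite -!EFinD lee_fin; move: q1 q2 q3 q4 q5; clear.
    by move: (pw 81) (pw 100) (pw 121) (pw 144) (pw 169) => *; lra.
  by do 4 (apply: leeD; last exact: normal_prob_itv_ge); exact: normal_prob_itv_ge.
have dj : U `&` V = set0.
  have Upos x : U x -> 0 < x.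
    by rewrite /U /A /= !in_itv/=; move=> [[[[|]|]|]|] /andP[h _]; clear -h; lra.
  by apply/seteqP; split => // x [/Upos h1 /Upos h2]; clear -h1 h2; lra.
have h1 : ((272 / 10 ^+ 4)%:E <= gam (U `|` V))%E.
  have eU : gam (U `|` V) = (gam U + gam V)%E by apply: measureU.
  have e : (272 / 10 ^+ 4)%:E = ((136 / 10 ^+ 4)%:E + (136 / 10 ^+ 4)%:E)%E :> \bar R.
    by rewrite -EFinD; congr EFin; clear; lra.
  by rewrite eU gV e; exact: (leeD gU gU).
apply: (le_trans h1); apply: le_measure; rewrite ?inE.
- exact: measurableU.
- exact: measurable_abs_ge2.
have U2 x : U x -> 2 <= x.
  by rewrite /U /A /= !in_itv/=; move=> [[[[|]|]|]|] /andP[h _]; clear -h; lra.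
move=> x [/U2 h|/U2 h] /=; first by rewrite (le_trans h)// ler_norm.
by rewrite -normrN (le_trans _ (ler_norm _))//; clear -h; lra.
Qed.

Lemma lee_prod_nneg n (F G : 'I_n -> \bar R) : (forall i, 0 <= F i)%E -> (forall i, F i <= G i)%E ->
  (\prod_(i < n) F i <= \prod_(i < n) G i)%E.
Proof.
move=> F0 FG; have : (0 <= \prod_(i < n) F i <= \prod_(i < n) G i)%E.
  elim/big_ind2: _ => [|a b c d /andP[a0 ab] /andP[c0 cd]|i _].
  - by rewrite lee01 lexx.
  - by rewrite mule_ge0//=; exact: lee_pmul.
  - by rewrite F0 FG.
by case/andP.
Qed.

(** Chernoff bound for the lower tail at [l = 1/25]: the exponent is at least
    [(0.0272 / 26 - 0.02446 / 25) N], which exceeds [6e-5 N]. The set [A] is the exceptional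
    event. *)
Lemma count_tail n (I : {set 'I_n}) :
  exists A : set (rn R n), [/\ measurable A,
    (forall x, ~ A x -> 2446 / 10 ^+ 5 * #|I|%:R < (#|[set i in I | 2 <= `|coordn x i|]|%:R : R)) &
    (gauss_rn R n A <= (expR (- (6 / 10 ^+ 5 * #|I|%:R)))%:E)%E].
Proof.
pose l : R := 4 / 100.
pose B : set R := [set x | 2 <= `|x|].
have mB : measurable B by exact: measurable_abs_ge2.
pose II (i : nat) : bool := [exists j in I, val j == i].
have IIE (i : 'I_n) : II i = (i \in I).
  apply/existsP/idP => [[j /andP[jI /eqP/val_inj <-]]//|iI]; by exists i; rewrite iI/=.
pose g (i : nat) (t : R) : R := if II i then expR (- l * \1_B t) else 1.
have mg i : measurable_fun setT (g i).
  rewrite /g; case: (II i) => //; apply: measurableT_comp => //; apply: measurable_funM => //.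
have g0 i t : 0 <= g i t by rewrite /g; case: ifP => // _; exact: expR_ge0.
have gI i : II i -> (\int[gam]_t (g i t)%:E <= (expR (- (272 / 10 ^+ 4 * (l / (1 + l)))))%:E)%E.
  move=> iI; rewrite /g iI.
  (* Both sides agree when the indicator is 0; when it is 1 this is [1 + l <= expR l]. *)
  have e1 t : expR (- l * \1_B t) <= 1 - (l / (1 + l)) * \1_B t.
    rewrite indicE; case: (_ \in _); rewrite ?mulr1 ?mulr0 ?expR0 ?subr0//.
    rewrite expRN; have -> : 1 - l / (1 + l) = (1 + l)^-1 by rewrite /l; field.
    by rewrite lef_pV2 ?posrE ?expR_gt0 ?expR_ge1Dx// /l; lra.
  have l1 : 0 <= l / (1 + l) by apply: divr_ge0; rewrite /l; lra.
  have h : (\int[gam]_t (expR (- l * \1_B t))%:E + (l / (1 + l))%:E * gam B <= 1%:E)%E.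
    have mE : measurable_fun setT (fun t : measurableTypeR R => (expR (- l * \1_B t))%:E).
      by have := mg i; rewrite /g iI => h; exact/measurable_EFinP.
    have mI0 : measurable_fun setT (fun t : measurableTypeR R => (\1_B t : R)%:E).
      by apply/measurable_EFinP; exact: measurable_indic.
    have mI2 : measurable_fun setT (fun t : measurableTypeR R => ((l / (1 + l))%:E * (\1_B t : R)%:E)%E).
      exact: emeasurable_funM.
    have E0 (x : R) : (0 <= (expR (- l * \1_B x))%:E)%E by rewrite lee_fin expR_ge0.
    have E1 (x : R) : (0 <= (l / (1 + l))%:E * (\1_B x : R)%:E)%E by rewrite mule_ge0// lee_fin.
    have -> : gam B = (\int[gam]_t (\1_B t : R)%:E)%E by rewrite integral_indic// setIT.
    rewrite -ge0_integralZl//; try exact: mI0.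
    rewrite -ge0_integralD//; try exact: mE; try exact: mI2; try (by move=> x _; exact: E0); try (by move=> x _; exact: E1).
    apply: (@le_trans _ _ (\int[gam]_x (cst 1%E x))%E).
      apply: ge0_le_integral => //.
      - by move=> x _; rewrite adde_ge0.
      - exact: emeasurable_funD.
      - by move=> x _; rewrite -EFinM -EFinD lee_fin; have := e1 x; lra.
    by rewrite integral_cst//= mul1e; have -> : gam setT = 1%E by exact: (@probability_setT _ _ _ gam).
  have t2 := normal_tail2; rewrite -/B in t2.
  have : (\int[gam]_t (expR (- l * \1_B t))%:E + (l / (1 + l))%:E * (272 / 10 ^+ 4)%:E <= 1%:E)%E.
    by apply: le_trans h; apply: leeD2l; apply: lee_wpmul2l.
  rewrite -EFinM => h2.
  apply: (@le_trans _ _ (1 - l / (1 + l) * (272 / 10 ^+ 4))%:E).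
    by rewrite EFinB leeBrDr.
  by rewrite lee_fin; apply: le_trans (expR_ge1Dx _); lra.
pose c := 2446 / 10 ^+ 5 * (#|I|%:R : R).
pose f (x : rn R n) := \prod_(i < n) g i (coordn x i).
have mf : measurable_fun setT f.
  by apply: measurable_prod => i _; apply: measurableT_comp => //; exact: measurable_coordn.
have f0 x : 0 <= f x by exact: prodr_ge0.
have fE x : f x = expR (- (l * #|[set i in I | 2 <= `|coordn x i|]|%:R)).
  rewrite /f -sum1_card natr_sum mulr_sumr -sumrN expR_sum.
  rewrite [RHS]big_mkcond; apply: eq_bigr => i _; rewrite /g IIE inE mulr1 indicE.
  case: (i \in I) => //=; case: (boolP (2 <= _)) => h.
    by rewrite mem_set//= mulr1.
  by rewrite memNset/= ?mulr0 ?expR0//; exact/negP.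
have Ef : (\int[gauss_rn R n]_x (f x)%:E <= (expR (- (272 / 10 ^+ 4 * (l / (1 + l)) * #|I|%:R)))%:E)%E.
  rewrite integral_prod_gauss_rn//.
  apply: (@le_trans _ _ (\prod_(i < n) (if i \in I then expR (- (272 / 10 ^+ 4 * (l / (1 + l)))) else 1)%:E)%E).
    apply: lee_prod_nneg => i; first by apply: integral_ge0 => t _; rewrite lee_fin.
    case: ifP => iI; first by apply: gI; rewrite IIE.
    rewrite /g IIE iI integral_cst//= mul1e.
    by have -> : gam setT = 1%E by exact: (@probability_setT _ _ _ gam).
  rewrite prodEFin lee_fin -big_mkcond/= prodr_const -expRM_natl ler_expR.
  by rewrite mulrN mulrC.
pose A := [set x | expR (- (l * c)) <= f x].
have mA : measurable A.
  have := mf measurableT `[expR (- (l * c)), +oo[%classic (measurable_itv _).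
  by rewrite setTI /preimage/=; under eq_set do rewrite in_itv/= andbT.
exists A; split => //.
  move=> x /negP; rewrite -ltNge fE ltr_expR ltrN2 ltr_pM2l//.
  by rewrite /l; lra.
have key : ((expR (- (l * c)))%:E * gauss_rn R n A <= \int[gauss_rn R n]_x (f x)%:E)%E.
  rewrite -[X in gauss_rn R n X]setIT -integral_indic// -ge0_integralZl//; last first.
    exact/measurable_EFinP/measurable_indic.
  apply: ge0_le_integral => //.
  - by apply: emeasurable_funM => //; exact/measurable_EFinP/measurable_indic.
  - exact/measurable_EFinP.
  move=> x _; rewrite -EFinM lee_fin indicE; case: (boolP (x \in A)) => [|_].
    by rewrite inE mulr1.
  by rewrite mulr0.
have := le_trans key Ef; rewrite -lee_pdivlMl ?expR_gt0// -expRN opprK -EFinM -expRD => /le_trans; apply.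
have l26 : l / (1 + l) = 1 / 26 by rewrite /l; field.
rewrite lee_fin ler_expR l26 /c /l; have : 0 <= (#|I|%:R : R) by [].
by move: (#|I|%:R : R); clear => N N0; lra.
Qed.
End GaussianTail.

(** * The projection step *)

Lemma continuous_sumR (T : topologicalType) (R : realType) (J : Type) (r : seq J) (P : pred J) (f : J -> T -> R) :
  (forall i, continuous (f i)) -> continuous (fun v => \sum_(i <- r | P i) f i v).
Proof.
move=> cf; elim: r => [|i r IH].
  rewrite (_ : (fun v => _) = fun=> 0); first by move=> v; exact: cvg_cst.
  by apply/funext => v; rewrite big_nil.
rewrite (_ : (fun v => _) = fun v => if P i then f i v + \sum_(j <- r | P j) f j v else \sum_(j <- r | P j) f j v).
  by case: (P i) => // v; apply: cvgD; [exact: cf|exact: IH].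
by apply/funext => v; rewrite big_cons.
Qed.

Section Projection.
Variables (R : realType) (m n : nat) (A : 'M[R]_(m, n)) (x : 'I_n -> R).
Hypothesis A1 : forall j i, -1 <= A j i <= 1.
Hypothesis x1 : forall i, -1 < x i < 1.
Let I := nonneg_idx x.

(* [z = T g] with [g i = (1 - x i) * z i]. *)
Definition prefix_bounded (z : 'I_n -> R) := forall (j : 'I_m) (t : 'I_n), t \in I ->
  `|\sum_(i in I | (i <= t)%N) (1 - x i) * z i * A j i| <= 112 * Num.sqrt m%:R.

Let x1n i : 1 - x i != 0.
Proof. by have /andP[_ h] := x1 i; rewrite gt_eqF// subr_gt0. Qed.

(** Since [x i < 1], the scaling [T] is invertible, and membership in [K] can be expressed on [z]
    itself. *)
Lemma feasibleP (z : 'I_n -> R) : feasible A x z <->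
  [/\ forall i, i \notin I -> z i = 0, prefix_bounded z & forall i, i \in I -> `|z i| <= 1].
Proof.
split.
  move=> [[g [g0 gQ] gz] z1]; split.
  - by move=> i iI; rewrite -gz /Tmap g0// mul0r.
  - move=> j t tI; rewrite (eq_bigr (fun i => g i * A j i)); first exact: gQ.
    by move=> i _; rewrite -gz /Tmap mulrC [_ * (g i / _)]mulrC divfK ?x1n// mulrC.
  - by move=> i iI; rewrite ler_norml; exact: z1.
move=> [z0 zp z1]; split; last by move=> i iI; rewrite -ler_norml; exact: z1.
exists (fun i => (1 - x i) * z i); last first.
  by apply/funext => i; rewrite /Tmap mulrAC divff ?x1n// mul1r.
by split=> [i iI|//]; rewrite z0// mulr0.
Qed.

(** A continuous function attains its minimum on a compact set; vanishing outside [I] makes the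
    feasible set bounded in all of the ambient space. *)
Lemma exists_proj (y : 'I_n -> R) : exists z, is_proj A x y z.
Proof.
pose C : set 'rV[R]_n := [set v | feasible A x (fun i => v ord0 i)].
have cc i : continuous (fun v : 'rV[R]_n => v ord0 i : R) by move=> v; exact: coord_continuous.
have clN (f : 'rV[R]_n -> R) (c : R) : continuous f -> closed [set v | `|f v| <= c].
  move=> cf; apply: (@closed_comp _ _ (fun v => `|f v|) [set r | r <= c]); last exact: closed_le.
  by move=> v _; apply: continuous_comp; [exact: cf|exact: norm_continuous].
have cS (P : pred 'I_n) (c : 'I_n -> R) : continuous (fun v : 'rV[R]_n => \sum_(i | P i) c i * v ord0 i).
  apply: continuous_sumR => i v.
  by apply: (@continuousM _ _ (fun=> c i) (fun v : 'rV[R]_n => v ord0 i)); [exact: cst_continuous|exact: cc].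
have clC : closed C.
  (* Vanishing is written as [|v i| <= 0], so that every constraint bounds the absolute value of a
     linear form. *)
  rewrite (_ : C = (\bigcap_(i in [set i | i \notin I]) [set v | `|v ord0 i| <= 0]) `&`
     ((\bigcap_(jt in [set jt : 'I_m * 'I_n | jt.2 \in I])
        [set v | `|\sum_(i | (i \in I) && (i <= jt.2)%N) ((1 - x i) * A jt.1 i) * v ord0 i| <= 112 * Num.sqrt m%:R]) `&`
     (\bigcap_(i in [set i | i \in I]) [set v | `|v ord0 i| <= 1]))).
    apply: closedI; first by apply: closed_bigI => i _; exact: clN.
    apply: closedI; last by apply: closed_bigI => i _; exact: clN.
    by apply: closed_bigI => -[j t] _; apply: clN; exact: cS.
  have sE (v : 'rV[R]_n) (j : 'I_m) (t : 'I_n) : \sum_(i in I | (i <= t)%N) (1 - x i) * v ord0 i * A j i =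
     \sum_(i | (i \in I) && (i <= t)%N) ((1 - x i) * A j i) * v ord0 i.
    by apply: eq_bigr => i _; rewrite mulrAC.
  apply/seteqP; split => v.
    move=> /feasibleP[v0 vp v1]; split; first by move=> i /= iI; rewrite v0// normr0.
    split; last by move=> i /= iI; exact: v1.
    by move=> [j t] /= tI; rewrite -sE; exact: vp.
  move=> [/= v0 [vp v1]]; apply/feasibleP; split.
  - by move=> i iI; apply/eqP; rewrite -normr_le0; exact: v0.
  - by move=> j t tI; rewrite sE; exact: (vp (j, t)).
  - exact: v1.
have Ccpt : compact C.
  apply: (@subclosed_compact _ _ [set v : 'rV[R]_n | forall i, `[-1, 1]%classic (v ord0 i)]) => //.
    have H := @rV_compact R n (fun=> `[-1, 1]%classic) (fun=> @segment_compact R _ _).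
    exact: H.
  move=> v /feasibleP[v0 _ v1] i; rewrite /= in_itv/= -ler_norml.
  by have [iI|iI] := boolP (i \in I); [exact: v1|rewrite v0// normr0].
have C0 : C !=set0.
  exists 0; apply/feasibleP; split.
  - by move=> i _; rewrite mxE.
  - move=> j t _; rewrite big1 ?normr0 ?mulr_ge0 ?sqrtr_ge0// => i _.
    by rewrite mxE mulr0 mul0r.
  - by move=> i _; rewrite mxE normr0.
pose D (v : 'rV[R]_n) : R := \sum_(i in I) (y i - v ord0 i) ^+ 2.
have cD : continuous D.
  apply: continuous_sumR => i v.
  have cB : {for v, continuous (fun v : 'rV[R]_n => y i - v ord0 i)}.
    by apply: (@continuousB _ _ _ (fun=> y i) (fun v : 'rV[R]_n => v ord0 i)); [exact: cst_continuous|exact: cc].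
  exact: (continuousM cB cB).
have [c cC cmin] := @compact_EVT_min _ R D C C0 Ccpt (continuous_subspaceT cD).
exists (fun i => c ord0 i); split; first by rewrite inE in cC.
move=> w fw; rewrite /distI ler_wsqrtr//.
have := cmin (\row_i w i); rewrite inE /D => h.
apply: le_trans (h _) _.
  by rewrite /C /=; rewrite (_ : (fun i => _) = w)//; apply/funext => i; rewrite mxE.
by under eq_bigr do rewrite mxE.
Qed.

(** In a convex problem the inactive constraints do not affect the minimizer, so the competitor [z]
    may violate the cube at the entries that are not tight. *)
Lemma proj_dist_le (y xs z : 'I_n -> R) : is_proj A x y xs ->
  (forall i, i \notin I -> z i = 0) -> prefix_bounded z ->
  (forall i, i \in I -> `|xs i| = 1 -> `|z i| <= 1) ->
  \sum_(i in I) (y i - xs i) ^+ 2 <= \sum_(i in I) (y i - z i) ^+ 2.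
Proof.
move=> [/feasibleP[xs0 xsp xs1] xmin] z0 zp z1.
(* [t = prod th] is a step small enough to stay in the cube at the entries that
   are not tight; at the tight ones convexity suffices. *)
pose th i : R := if (i \in I) && (`|xs i| < 1) then (1 - `|xs i|) / (1 + `|z i - xs i|) else 1.
have den i : 0 < 1 + `|z i - xs i| by rewrite ltr_pwDl.
have th01 i : 0 < th i <= 1.
  rewrite /th; case: ifP => [/andP[_ h]|_]; last by rewrite ltr01 lexx.
  rewrite divr_gt0 ?subr_gt0//= ler_pdivrMr// mul1r.
  by have := normr_ge0 (xs i); have := normr_ge0 (z i - xs i); lra.
pose t := \prod_i th i.
have t0 : 0 < t by apply: prodr_gt0 => i _; case/andP: (th01 i).
have tle i : t <= th i.
  rewrite /t (bigD1 i)//= ler_piMr//; first by case/andP: (th01 i) => /ltW.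
  by apply: prodr_ile1 => k; case/andP: (th01 k) => /ltW -> ->.
have t1 : t <= 1 by apply: prodr_ile1 => k; case/andP: (th01 k) => /ltW -> ->.
pose w i := (1 - t) * xs i + t * z i.
have fw : feasible A x w.
  apply/feasibleP; split.
  - by move=> i iI; rewrite /w xs0// z0// !mulr0 addr0.
  - move=> j s sI.
    rewrite (_ : \sum_(i in I | _) _ = (1 - t) * (\sum_(i in I | (i <= s)%N) (1 - x i) * xs i * A j i) +
        t * (\sum_(i in I | (i <= s)%N) (1 - x i) * z i * A j i)); last first.
      by rewrite !mulr_sumr -big_split/=; apply: eq_bigr => i _; rewrite /w; ring.
    apply: (le_trans (ler_normD _ _)); rewrite !normrM (ger0_norm (ltW t0)) ger0_norm ?subr_ge0//.
    have h1 := xsp j s sI; have h2 := zp j s sI.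
    set c := 112 * _ in h1 h2 *.
    rewrite (_ : c = (1 - t) * c + t * c); last by ring.
    by apply: lerD; [rewrite ler_wpM2l// subr_ge0|rewrite ler_wpM2l// ltW].
  - move=> i iI; have [e|ne] := eqVneq `|xs i| 1.
      apply: (le_trans (ler_normD _ _)); rewrite !normrM (ger0_norm (ltW t0)) ger0_norm ?subr_ge0//.
      by have := z1 i iI e; rewrite e; have := t0; nra.
    have xlt : `|xs i| < 1 by rewrite lt_neqAle ne xs1.
    have -> : w i = xs i + t * (z i - xs i) by rewrite /w; ring.
    apply: (le_trans (ler_normD _ _)); rewrite normrM (ger0_norm (ltW t0)).
    have := tle i; rewrite /th iI xlt/= ler_pdivlMr//.
    by have := normr_ge0 (z i - xs i); have := t0; nra.
have := xmin w fw; rewrite /distI ler_sqrt; last by apply: sumr_ge0 => i _; exact: sqr_ge0.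
have : \sum_(i in I) (y i - w i) ^+ 2 <=
   (* Convexity of the squared distance, proved termwise with the explicit remainder
      [t (1 - t) (xs i - z i)^2]. *)
   (1 - t) * (\sum_(i in I) (y i - xs i) ^+ 2) + t * (\sum_(i in I) (y i - z i) ^+ 2).
  rewrite !mulr_sumr -big_split/=; apply: ler_sum => i _; rewrite /w.
  have -> : (1 - t) * (y i - xs i) ^+ 2 + t * (y i - z i) ^+ 2 =
     (y i - ((1 - t) * xs i + t * z i)) ^+ 2 + t * (1 - t) * (xs i - z i) ^+ 2 by ring.
  rewrite lerDl; apply: mulr_ge0; last exact: sqr_ge0.
  by apply: mulr_ge0; [exact: ltW|rewrite subr_ge0].
rewrite -/I; set a := \sum_(i in I) _; set b := \sum_(i in I) _; set c := \sum_(i in I) _.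
move=> h1 h2; rewrite -(ler_pM2l t0); lra.
Qed.

(** At least half of the tight entries share a sign, and the flip makes that sign positive when
    needed. An entry 1 moves [x i] exactly to 1, and [#|I| >= n / 2] accounts for the final
    factor. *)
Lemma good_output_of_tight (eps : R) (y x' : 'I_n -> R) : 0 < eps ->
  (n <= 2 * #|I|)%N ->
  (forall xs, is_proj A x y xs -> eps * #|I|%:R <= #|[set i in I | `|xs i| == 1]|%:R) ->
  ppc_main eps A x y x' -> good_output eps 112 A x x'.
Proof.
move=> eps0 nI tight [xs [pxs x'E]]; rewrite -/I in x'E.
have [/feasibleP[xs0 xsp xs1] _] := pxs.
set f := flip eps I xs in x'E.
have fpm : (f = xs) \/ (f = fun i => - xs i) by rewrite /f /flip; case: ifP => _; [right|left].
have f1 i : i \in I -> `|f i| <= 1.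
  by move=> iI; case: fpm => ->; rewrite ?normrN; exact: xs1.
have f0 i : i \notin I -> f i = 0.
  by move=> iI; case: fpm => ->; rewrite xs0// oppr0.
have fp : prefix_bounded f.
  case: fpm => -> // j t tI; rewrite -normrN -sumrN.
  by under eq_bigr do rewrite mulrN mulNr opprK; exact: xsp.
have ones : eps / 2 * #|I|%:R <= #|[set i in I | f i == 1]|%:R.
  rewrite /f /flip; case: ifPn => [lt|]; last by rewrite -leNgt.
  have h := tight xs pxs.
  have sub : (#|[set i in I | (`|xs i| == 1)%R]| <= #|[set i in I | (xs i == 1)%R]| + #|[set i in I | (- xs i == 1)%R]|)%N.
    apply: leq_trans (leq_card_setU _ _); apply: subset_leq_card; apply/fintype.subsetP => i.
    rewrite !inE => /andP[-> /=]; case: (leP 0 (xs i)) => h0; first by rewrite ger0_norm// => ->.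
    by rewrite ltr0_norm// => ->; rewrite orbT.
  have : (#|[set i in I | (`|xs i| == 1)%R]|%:R <= #|[set i in I | (xs i == 1)%R]|%:R + #|[set i in I | (- xs i == 1)%R]|%:R :> R).
    by rewrite -natrD ler_nat.
  lra.
have dif i : x' i - x i = (1 - x i) * f i.
  rewrite x'E; case: ifPn => iI; first by ring.
  by rewrite f0// mulr0 subrr.
split; [|split].
- move=> i; have /andP[xl xu] := x1 i; rewrite x'E; case: ifPn => iI; last by rewrite !ltW.
  have x0 : 0 <= x i by move: iI; rewrite /I inE.
  (* The lower bound uses [0 <= x i]: the smallest possible value is [2 * x i - 1]. *)
  have := f1 i iI; rewrite ler_norml => /andP[fl fu]; apply/andP; split; nra.
- apply: (@le_trans _ _ (eps / 2 * #|I|%:R)).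
    have : (n%:R : R) <= 2 * #|I|%:R by rewrite -natrM ler_nat.
    nra.
  apply: (le_trans ones); rewrite ler_nat; apply: subset_leq_card; apply/fintype.subsetP => i.
  rewrite [in X in X -> _]inE => /andP[iI /eqP e]; rewrite inE; apply/orP; left; rewrite x'E iI e; apply/eqP; ring.
- move=> l ln j.
  have -> : \sum_(i : 'I_n | (i < l)%N) A j i * (x' i - x i) =
     \sum_(i in I | (i < l)%N) (1 - x i) * f i * A j i.
    rewrite [RHS]big_mkcondl/=; apply: eq_bigr => i _; rewrite dif; case: ifPn => iI; first by ring.
    by rewrite f0//; ring.
  have [/existsP[t0 t0P]|/existsPn none] := boolP [exists t : 'I_n, (t \in I) && (t < l)%N]; last first.
    rewrite big1 ?normr0 ?mulr_ge0 ?sqrtr_ge0// => i h.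
    by have := none i; rewrite h.
  (* The prefix of length [l] is the one ending at the largest index of [I] below [l]. *)
  have [t /andP[tI tl] tmax] := @arg_maxnP _ t0 (fun t : 'I_n => (t \in I) && (t < l)%N) val t0P.
  have -> : \sum_(i in I | (i < l)%N) (1 - x i) * f i * A j i =
     \sum_(i in I | (i <= t)%N) (1 - x i) * f i * A j i.
    apply: eq_bigl => i; case: (boolP (i \in I)) => //= iI.
    apply/idP/idP => [il|it]; last by rewrite (leq_ltn_trans it).
    by apply: tmax; rewrite iI il.
  exact: fp.
Qed.
End Projection.

(** * Tight coordinates of the projection *)

(** Generating function of the subsets by size, used in the union bound over tight sets. *)
Lemma sum_subsets_pow (R : realType) n (k : R) :
  \sum_(S : {set 'I_n}) k ^+ #|S| = (1 + k) ^+ n.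
Proof.
rewrite [1 + k]addrC -[in RHS](card_ord n) -prodr_const.
rewrite bigA_distr; apply: eq_bigr => S _.
by rewrite -big_mkcond/= prodr_const.
Qed.

Section Tight.
Variables (R : realType) (m n : nat) (A : 'M[R]_(m, n)) (x : 'I_n -> R).
Hypothesis n0 : (0 < n)%N.
Hypothesis A1 : forall j i, -1 <= A j i <= 1.
Hypothesis x1 : forall i, -1 < x i < 1.
Let I := nonneg_idx x.
Hypothesis nI : (n <= 2 * #|I|)%N.

(** Zero coefficients outside [I] let the whole sample in dimension [n] be used instead of its
    restriction to [I]. *)
Definition row_coef (j : 'I_m) (k : nat) : R :=
  if insub k is Some i then if i \in I then (1 - x i) * A j i else 0 else 0.

Lemma row_coefE j (i : 'I_n) : row_coef j i = if i \in I then (1 - x i) * A j i else 0.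
Proof. by rewrite /row_coef valK. Qed.

Lemma weight_le1 j i : i \in I -> `|(1 - x i) * A j i| <= 1.
Proof.
rewrite inE => x0; have /andP[xl xu] := x1 i.
have h : `|A j i| <= 1 by rewrite ler_norml A1.
rewrite normrM ger0_norm; last by lra.
by have := normr_ge0 (A j i); nra.
Qed.

Lemma row_coef_le1 j k : `|row_coef j k| <= 1.
Proof.
rewrite /row_coef; case: insubP => [i _ _|_]; last by rewrite normr0.
by case: ifP => iI; rewrite ?normr0// weight_le1.
Qed.

Lemma row_coef_sqr j : \sum_(i < n) row_coef j i ^+ 2 <= #|I|%:R.
Proof.
rewrite -sum1_card natr_sum [leRHS]big_mkcond; apply: ler_sum => i _.
rewrite row_coefE; case: ifP => iI; last by rewrite expr0n.
by rewrite -real_normK ?num_real// expr_le1// weight_le1.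
Qed.

Lemma prefix_body_opp (S : {set 'I_n}) (z : rn R n) : prefix_body row_coef S z ->
  prefix_body row_coef S (mk_rn n (fun i => - coordn z i)).
Proof.
move=> [z1 z2]; split=> [j t tn|i iS]; last by rewrite coordn_mk_rn// normrN z2.
have := z1 j t tn; rewrite -normrN -sumrN; congr (`|_| <= _); apply: eq_bigr => i _.
by rewrite coordn_mk_rn ?mulrN// (leq_trans (ltn_ord i)).
Qed.

Definition on_nonneg (z : rn R n) (i : 'I_n) : R := if i \in I then coordn z i else 0.

Lemma prefix_body_bounded (S : {set 'I_n}) (z : rn R n) : prefix_body row_coef S z ->
  prefix_bounded A x (on_nonneg z).
Proof.
move=> [z1 _] j t tI.
have := z1 j t.+1 (ltn_ord t); congr (`|_| <= _).
rewrite (big_ord_widen n (fun i => row_coef j i * coordn z i) (ltn_ord t)).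
rewrite [RHS]big_mkcondl; apply: eq_bigr => i _.
by rewrite row_coefE /on_nonneg /I; case: ifP => _; rewrite ?mul0r//; ring.
Qed.

Lemma exists_pow2 : exists k0, (m <= 2 ^ k0)%N /\ ((0 < m)%N -> (2 ^ k0 < 2 * m)%N).
Proof.
exists (up_log 2 m); split; first exact: up_logP.
move=> m0; have [m1|m1] := leqP m 1.
  by have -> : m = 1%N by apply/eqP; rewrite eqn_leq m1.
have /andP[h _] := up_log_bounds (isT : (1 < 2)%N) m1.
rewrite -[X in (2 ^ X)%N](prednK (_ : 0 < up_log 2 m)%N) ?up_log_gt0// expnS.
by rewrite ltn_pmul2l.
Qed.

Let N : R := #|I|%:R.

Let nN : n%:R <= 2 * N.
Proof. by rewrite /N -natrM ler_nat. Qed.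

Let N0 : 0 < N.
Proof. by have : 0 < (n%:R : R); [rewrite ltr0n|move: nN; lra]. Qed.

(** Dividing the concentration bound by the measure of the body leaves the rate
    [0.00594 - 0.0042 = 0.00174]; the factor 5 is absorbed by [expR 2]. *)
Lemma far_body (S : {set 'I_n}) : exists F : set (rn R n), [/\ measurable F,
   (forall y, ~ F y -> exists2 z, prefix_body row_coef S z &
      \sum_(i < n) (coordn y i - coordn z i) ^+ 2 <= 2445 / 10 ^+ 5 * N) &
   (gauss_rn R n F <= (expR (3 - 174 / 10 ^+ 5 * N + 4 * #|S|%:R))%:E)%E].
Proof.
have [k0 [mk k0m]] := exists_pow2.
have mK := measurable_prefix_body row_coef S.
have hK := @prefix_body_measure R m n k0 row_coef S N row_coef_le1 row_coef_sqr nN n0 mk k0m.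
have [F [mF FP Fm]] := far_set mK N0 (@prefix_body_opp S).
exists F; split => //.
set q := expR _ / 5 in hK.
have q0 : 0 < q by rewrite divr_gt0// expR_gt0.
have h : (gauss_rn R n F * q%:E <= (expR (- (594 / 10 ^+ 5 * N)))%:E)%E.
  by apply: le_trans Fm; apply: lee_wpmul2l.
have : gauss_rn R n F = (fine (gauss_rn R n F))%:E by rewrite fineK// fin_num_measure.
move: h; case: (gauss_rn R n F) => // f; rewrite -EFinM !lee_fin => h _.
rewrite -(ler_pM2r q0); apply: (le_trans h).
have e5 : expR (- 2 : R) <= 5^-1.
  rewrite expRN lef_pV2 ?posrE ?expR_gt0//.
  by have := @expR_nat_ge R 2; rewrite expr2; lra.
apply: (@le_trans _ _ (expR (3 - 174 / 10 ^+ 5 * N + 4 * #|S|%:R) *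
   (expR (- (42 / 10 ^+ 4 * N) - 4 * #|S|%:R - 1) * expR (- 2)))).
  rewrite -!expRD ler_expR.
  by lra.
by rewrite /q; do 2 (rewrite ler_wpM2l ?expR_ge0//).
Qed.

(** Small enough for the union bound over tight sets, and such that [eps * n <= 1] whenever
    [n <= 2 * 10 ^ 5]. *)
Let eps : R := 1 / 2 / 10 ^+ 5.

Lemma large_case d (Om : measurableType d) (P : probability Om R) (y : 'I_n -> Om -> R) :
  iid_std_gaussian P y -> 2 * 10 ^+ 5 <= (n%:R : R) ->
  exists E : set Om, [/\ measurable E,
    (forall w, E w -> forall xs, is_proj A x (fun i => y i w) xs ->
        eps * #|I|%:R <= #|[set i in I | `|xs i| == 1]|%:R) &
    ((1 - expR (- (2 / 10 ^+ 5 * n%:R)))%:E <= P E)%E].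
Proof.
move=> iid nbig.
have [Y [mY YE Ylaw]] := iid_std_gaussian_law iid.
have [C [mC CP Cm]] := count_tail R I.
pose F S := sval (cid (far_body S)).
have FP S := svalP (cid (far_body S)).
have mF S : measurable (F S) by have [] := FP S.
pose s := enum [pred S : {set 'I_n} | #|S|%:R <= eps * N].
have [mU leU] := measure_exists_le (gauss_rn R n) s mF.
set U := [set z | _] in mU leU.
pose Bad := C `|` U.
have mBad : measurable Bad by exact: measurableU.
(* The size restriction is relaxed by the factor [expR (10 * (eps * N - #|S|)) >= 1]. The sum over
   all subsets is then [(1 + expR (- 10)) ^ n], and the rate only falls from 0.00174 to 0.00146. *)
have sumF : \sum_(S <- s) expR (3 - 174 / 10 ^+ 5 * N + 4 * #|S|%:R) <= expR (3 - 146 / 10 ^+ 5 * N).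
  rewrite big_enum/=.
  apply: (@le_trans _ _ (\sum_(S : {set 'I_n}) expR (3 - 174 / 10 ^+ 5 * N + 4 * (eps * N) + 10 * (eps * N)) * expR (- 10) ^+ #|S|)).
    rewrite [leRHS](bigID (fun S : {set 'I_n} => #|S|%:R <= eps * N))/= ler_wpDr//.
      by apply: sumr_ge0 => S _; rewrite mulr_ge0 ?exprn_ge0 ?expR_ge0.
    apply: ler_sum => S hS; rewrite -expRM_natl -expRD ler_expR.
    have {}hS : #|S|%:R <= eps * N := hS.
    by lra.
  rewrite -mulr_sumr sum_subsets_pow.
  apply: (@le_trans _ _ (expR (3 - 174 / 10 ^+ 5 * N + 4 * (eps * N) + 10 * (eps * N)) * expR (n%:R * expR (- 10)))).
    rewrite ler_wpM2l ?expR_ge0// expRM_natl lerXn2r ?nnegrE ?expR_ge0 ?addr_ge0 ?expR_ge0//.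
    exact: expR_ge1Dx.
  rewrite -expRD ler_expR.
  have h1 : n%:R * expR (- 10) <= 2 * N * (105 / 10 ^+ 6).
    by apply: ler_pM; [exact: ler0n|exact: expR_ge0|exact: nN|exact: expRN10_le].
  move: h1; rewrite /eps; move: (n%:R * expR (- 10)) N0; move: N; move=> N' t N0'; lra.
have Nbig : 10 ^+ 5 <= N by move: nbig nN; move: (n%:R : R) N; move=> u v; lra.
clear nbig.
have badm : (gauss_rn R n Bad <= (expR (- (2 / 10 ^+ 5 * n%:R)))%:E)%E.
  apply: (le_trans (measureU2 _ _ _)) => //.
  apply: (@le_trans _ _ ((expR (- (6 / 10 ^+ 5 * N)))%:E + (expR (3 - 146 / 10 ^+ 5 * N))%:E)%E).
    apply: leeD => //; apply: (le_trans leU).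
    apply: (@le_trans _ _ (\sum_(S <- s) (expR (3 - 174 / 10 ^+ 5 * N + 4 * #|S|%:R))%:E)%E).
      by apply: lee_sum => S _; have [] := FP S.
    by rewrite sumEFin lee_fin.
  rewrite -EFinD lee_fin.
  apply: (@le_trans _ _ (expR 1 * expR (- (6 / 10 ^+ 5 * N)))).
    apply: (@le_trans _ _ (2 * expR (- (6 / 10 ^+ 5 * N)))).
      have : expR (3 - 146 / 10 ^+ 5 * N) <= expR (- (6 / 10 ^+ 5 * N)).
        by rewrite ler_expR; move: Nbig; move: N; clear sumF => N'; lra.
      by move: (expR _) (expR _); clear sumF Nbig => u v; lra.
    by rewrite ler_wpM2r ?expR_ge0//; have := @expR1_ge R; move: (expR 1); clear sumF Nbig => u; lra.
  rewrite -expRD ler_expR; clear sumF; move: Nbig nN; move: (n%:R : R) N; move=> u v; lra.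
exists (Y @^-1` (~` Bad)); split.
- by rewrite -[X in measurable X]setTI; apply: mY => //; exact: measurableC.
- move=> w; rewrite /Bad /= not_orE => -[nC nU] xs pxs.
  rewrite leNgt; apply/negP => lt.
  set S := [set i in I | _] in lt.
  have Ss : S \in s by rewrite mem_enum inE ltW.
  have nF : ~ F S (Y w) by move=> FS; apply: nU; exists S.
  have [_ FS _] := FP S.
  have [z zK zd] := FS _ nF.
  have [_ zS] := zK.
  have le1 := @proj_dist_le _ _ _ A x x1 (fun i => y i w) xs (on_nonneg z) pxs.
  have {}le1 : \sum_(i in I) (y i w - xs i) ^+ 2 <= \sum_(i in I) (y i w - on_nonneg z i) ^+ 2.
    apply: le1; last 2 first.
    - exact: (prefix_body_bounded zK).
    - move=> i iI e; rewrite /on_nonneg /I iI; apply: zS; rewrite inE iI e eqxx//.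
    - by move=> i iI; rewrite /on_nonneg /I (negbTE iI).
  have le2 : \sum_(i in I) (y i w - on_nonneg z i) ^+ 2 <= 2445 / 10 ^+ 5 * N.
    apply: le_trans zd; rewrite big_mkcond; apply: ler_sum => i _.
    rewrite /on_nonneg; case: (boolP (i \in I)) => iI /=; last exact: sqr_ge0.
    by rewrite YE.
  (* Each entry of the sample of size at least 2 is at distance at least 1 from the cube. *)
  have le3 : #|[set i in I | (2 <= `|coordn (Y w) i|)%R]|%:R <= \sum_(i in I) (y i w - xs i) ^+ 2.
    rewrite -sum1_card natr_sum big_mkcond [leRHS]big_mkcond; apply: ler_sum => i _.
    rewrite inE; case: (boolP (i \in I)) => //= iI; case: ifP => h; last exact: sqr_ge0.
    rewrite YE in h.
    have [/(feasibleP A x1)[_ _ xs1] _] := pxs.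
    have h1 := xs1 i iI.
    have h2 : 1 <= `|y i w - xs i| by have := lerB_dist (y i w) (xs i); clear lt le1 le2 Nbig sumF badm; lra.
    by rewrite -[leRHS]real_normK ?num_real// expr_ge1.
  have le4 := CP (Y w) nC.
  (* The contradiction is [0.02446 N < 0.02445 N]. *)
  have := lt_le_trans le4 (le_trans le3 (le_trans le1 le2)).
  by clear zd le1 le2 le3 le4 lt Nbig sumF badm; rewrite -/N; move: N N0; move=> N' N0'; lra.
- rewrite Ylaw; last exact: measurableC.
  rewrite probability_setC// EFinB; apply: leeB => //.
Qed.

Lemma small_case d (Om : measurableType d) (P : probability Om R) (y : 'I_n -> Om -> R) (eta : R) :
  iid_std_gaussian P y -> (n%:R : R) < 2 * 10 ^+ 5 -> 0 <= eta ->
  (eta%:E <= normal_prob 0 1 (`[2%R, 3%R]%classic : set R))%E ->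
  (eta%:E <= normal_prob 0 1 (`[(- (1 / 2 / 10 ^+ 5))%R, (1 / 2 / 10 ^+ 5)%R]%classic : set R))%E ->
  exists E : set Om, [/\ measurable E,
    (forall w, E w -> forall xs, is_proj A x (fun i => y i w) xs ->
        eps * #|I|%:R <= #|[set i in I | `|xs i| == 1]|%:R) &
    ((eta ^+ n)%:E <= P E)%E].
Proof.
move=> [my iid] nsmall eta0 h23 hd.
have [i0 i0I] : exists i0, i0 \in I.
  apply/set0Pn; rewrite -card_gt0; case: (posnP #|I|) => // I0.
  by move: nI; rewrite I0 muln0 leqNgt n0.
pose dl : R := 1 / 2 / 10 ^+ 5.
have dl0 : 0 <= dl by rewrite /dl; lra.
pose B (i : 'I_n) : set R := if i == i0 then `[2, 3]%classic else `[- dl, dl]%classic.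
have mB i : measurable (B i) by rewrite /B; case: ifP => _; exact: measurable_itv.
exists (\bigcap_i (y i @^-1` B i)); split.
- rewrite (_ : \bigcap_i _ = [set w | forall i, B i (y i w)]); last first.
    by apply/seteqP; split => w h i; [exact: h|move=> _; exact: h].
  apply: (@measurable_forall _ _ _ (fun i => y i @^-1` B i)) => i.
  by rewrite -[X in measurable X]setTI; exact: my.
- move=> w Ew xs pxs.
  have [/(feasibleP A x1)[xs0 _ xs1] _] := pxs.
  have yB i : B i (y i w) by exact: Ew.
  have y0 : 2 <= y i0 w <= 3 by have := yB i0; rewrite /B eqxx /= in_itv.
  have yi i : i != i0 -> `|y i w| <= dl.
    by move=> ii0; have := yB i; rewrite /B (negbTE ii0) /= in_itv/= -ler_norml.
  pose z i : R := if i \in I then y i w else 0.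
  have zp : prefix_bounded A x z.
    move=> j t tI.
    have m0 : (0 < m)%N by rewrite (leq_ltn_trans _ (ltn_ord j)).
    apply: (le_trans (ler_norm_sum _ _ _)).
    apply: (@le_trans _ _ (\sum_i (if i == i0 then 3 else dl))).
      rewrite big_mkcond; apply: ler_sum => i _.
      have b0 : 0 <= (if i == i0 then 3 else dl) by case: ifP.
      case: ifP => // /andP[iI _].
      have -> : (1 - x i) * z i * A j i = ((1 - x i) * A j i) * y i w by rewrite /z iI; ring.
      rewrite normrM (@le_trans _ _ (1 * `|y i w|))//.
        by rewrite ler_wpM2r// weight_le1.
      rewrite mul1r; case: eqP => [->|/eqP ne]; last exact: yi.
      by case/andP: y0 => h1 h2; rewrite ger0_norm//; lra.
    (* One entry contributes at most 3 and the others together at most 1, well below [112 * sqrt m]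
       as [m >= 1]. *)
    apply: (@le_trans _ _ (3 + n%:R * dl)).
      rewrite (bigD1 i0)//= eqxx lerD2l.
      apply: (@le_trans _ _ (\sum_(i < n) dl)).
        rewrite [leRHS](bigD1 i0)//= -[leLHS]add0r lerD//.
        by apply: ler_sum => i ne; rewrite (negbTE ne).
      by rewrite sumr_const card_ord mulr_natl.
    have ndl : n%:R * dl <= 1.
      have : n%:R * dl <= 2 * 10 ^+ 5 * dl by rewrite ler_wpM2r// ltW.
      have -> : 2 * 10 ^+ 5 * dl = 1 by rewrite /dl; field.
      by [].
    have sm1 : 1 <= Num.sqrt (m%:R : R) by rewrite -[leLHS]sqrtr1 ler_wsqrtr// ler1n.
    move: ndl sm1; move: (n%:R * dl) (Num.sqrt _); move=> u v; lra.
  have [[i iI]|none] := pselect (exists2 i, i \in I & `|xs i| = 1).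
    move=> e; apply: (@le_trans _ _ 1).
      have : eps * #|I|%:R <= eps * n%:R.
        by rewrite ler_wpM2l// ler_nat -[leqRHS](card_ord n) max_card.
      have : eps * n%:R <= eps * (2 * 10 ^+ 5).
        by rewrite ler_wpM2l ?ltW//; rewrite /eps; lra.
      have -> : eps * (2 * 10 ^+ 5) = 1 by rewrite /eps; field.
      by move=> h1 h2; exact: le_trans h2 h1.
    by rewrite ler1n card_gt0; apply/set0Pn; exists i; rewrite inE iI e eqxx.
  exfalso.
  have := @proj_dist_le _ _ _ A x x1 (fun i => y i w) xs z pxs.
  (* Without tight entries the sample itself is an admissible competitor at distance 0, so the
     projection would equal it on [I], although its entry at [i0] is at least 2. *)
  have -> : \sum_(i in nonneg_idx x) (y i w - z i) ^+ 2 = 0.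
    by apply: big1 => i iI; rewrite /z /I iI subrr expr0n.
  move=> /(_ _ zp _) h.
  have {}h : \sum_(i in nonneg_idx x) (y i w - xs i) ^+ 2 <= 0.
    apply: h; first by move=> i iI; rewrite /z /I (negbTE iI).
    by move=> i iI e; case: none; exists i.
  have h0 : (y i0 w - xs i0) ^+ 2 <= 0.
    apply: le_trans h; rewrite (bigD1 i0)//= lerDl; apply: sumr_ge0 => i _; exact: sqr_ge0.
  have e0 : y i0 w - xs i0 = 0 by apply/eqP; rewrite -sqrf_eq0 eq_le h0 sqr_ge0.
  have := xs1 i0 i0I; rewrite ler_norml => /andP[_ h1]; case/andP: y0 => h2 _.
  by lra.
- rewrite iid//.
  have -> : (eta ^+ n)%:E = (\prod_(i < n) eta%:E)%E by rewrite prodEFin prodr_const card_ord.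
  apply: lee_prod_nneg => i; first by rewrite lee_fin.
  by rewrite /B; case: ifP.
Qed.

Lemma ppc_main_exists y : exists x', ppc_main eps A x y x'.
Proof.
have [xs pxs] := exists_proj A x1 y.
by eexists (fun i => if _ then _ else _), xs; split; [exact: pxs|move=> i; reflexivity].
Qed.

End Tight.

(** * Assembly: the two ranges of [n] and the two signs *)

Lemma normal_prob_itv_gt0 (R : realType) (u v : R) : u < v ->
  (0 < normal_prob 0 1 (`[u, v]%classic : set R))%E.
Proof.
move=> uv; pose c : R := normal_peak 1 * expR (- (`|u| + `|v|) ^+ 2 / 2).
have c0 : 0 < c by rewrite mulr_gt0 ?expR_gt0// normal_peak_gt0// oner_neq0.
apply: (@lt_le_trans _ _ (\int[@lebesgue_measure R]_(x in `[u, v]) (cst c%:E x))%E).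
  rewrite integral_cst//.
  have := lebesgue_measure_itv `[u, v]; rewrite /= ?lte_fin uv => ->.
  by rewrite -EFinB -EFinM lte_fin mulr_gt0// subr_gt0.
rewrite /normal_prob; apply: ge0_le_integral => //.
- by move=> x _; rewrite lee_fin ltW.
- by apply/measurable_EFinP; apply: (@measurable_funS _ _ _ _ setT) => //; exact: measurable_normal_pdf.
move=> x /=; rewrite in_itv/= => /andP[ux xv]; rewrite lee_fin normal_pdf01E.
rewrite ler_wpM2l ?normal_peak_ge0// ler_expR ler_wpM2r// lerN2.
rewrite -[leLHS]real_normK ?num_real//.
rewrite lerXn2r ?nnegrE ?addr_ge0// ler_norml.
have := ler_norm u; have := ler_norm (- u); have := ler_norm v; have := ler_norm (- v).
by rewrite !normrN; lra.
Qed.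

Lemma good_output_opp (R : realType) m n (eps C : R) (A : 'M[R]_(m, n)) (x x' x'' : 'I_n -> R) :
  (forall i, x' i = - x'' i) -> good_output eps C A (fun i => - x i) x'' -> good_output eps C A x x'.
Proof.
move=> xE [g1 [g2 g3]]; split; [|split].
- by move=> i; rewrite xE; have := g1 i; lra.
- apply: (le_trans g2); rewrite ler_nat; apply: subset_leq_card; apply/fintype.subsetP => i.
  rewrite [in X in X -> _]inE => /orP[] /eqP e; rewrite inE; apply/orP; [right|left].
    by rewrite xE e.
  by rewrite xE e opprK.
- move=> l ln j; have := g3 l ln j; rewrite -normrN -sumrN.
  by congr (`|_| <= _); apply: eq_bigr => i _; rewrite xE; ring.
Qed.

Lemma main_case (R : realType) : exists c : R, 0 < c /\
  forall (m n : nat), (0 < n)%N ->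
  forall (A : 'M[R]_(m, n)), (forall j i, -1 <= A j i <= 1) ->
  forall (x : 'I_n -> R), (forall i, -1 < x i < 1) -> (n <= 2 * #|nonneg_idx x|)%N ->
  forall (d : measure_display) (Om : measurableType d) (P : probability Om R)
         (y : 'I_n -> Om -> R), iid_std_gaussian P y ->
  exists E : set Om, measurable E /\
    (forall w, E w ->
       (exists x', ppc_main (1 / 2 / 10 ^+ 5) A x (fun i => y i w) x') /\
       (forall x', ppc_main (1 / 2 / 10 ^+ 5) A x (fun i => y i w) x' ->
          good_output (1 / 2 / 10 ^+ 5) 112 A x x')) /\
    ((1 - expR (- c * n%:R))%:E <= P E)%E.
Proof.
pose dl : R := 1 / 2 / 10 ^+ 5.
have dl0 : 0 < dl by rewrite /dl; lra.
have p1 : (0 < normal_prob 0 1 (`[2%R, 3%R]%classic : set R))%E.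
  by apply: normal_prob_itv_gt0; lra.
have p2 : (0 < normal_prob 0 1 (`[(- dl)%R, dl]%classic : set R))%E.
  by apply: normal_prob_itv_gt0; lra.
have gfin (a b : R) : normal_prob 0 1 (`[a, b]%classic : set R) =
    (fine (normal_prob 0 1 (`[a, b]%classic : set R)))%:E.
  by rewrite fineK// fin_num_measure//; exact: measurable_itv.
have gle1 (a b : R) : fine (normal_prob 0 1 (`[a, b]%classic : set R)) <= 1.
  by rewrite -lee_fin -gfin; apply: probability_le1; exact: measurable_itv.
rewrite gfin lte_fin in p1; rewrite gfin lte_fin in p2.
pose eta := Num.min (fine (normal_prob 0 1 (`[2%R, 3%R]%classic : set R)))
                    (fine (normal_prob 0 1 (`[(- dl)%R, dl]%classic : set R))).
have eta0 : 0 < eta by rewrite lt_min p1 p2.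
have eta1 : eta <= 1 by rewrite ge_min gle1.
pose T : R := 2 * 10 ^+ 5.
have T0 : 0 < T by rewrite /T; lra.
pose k := (Num.truncn T).+1.
have kT : T < k%:R by exact: truncnS_gt.
(* The first bound serves large [n]; the second gives [1 - expR (- c n) <= c n <= eta ^ k <= eta ^
   n] for [n < T]. *)
pose c := Num.min (2 / 10 ^+ 5) (eta ^+ k / T).
exists c; split.
  by rewrite lt_min; apply/andP; split; [lra|rewrite divr_gt0// exprn_gt0].
move=> m n n0 A A1 x x1 nI d Om P y iid.
have nR : 0 <= (n%:R : R) by [].
suff [E [mE HE PE]] : exists E : set Om, [/\ measurable E,
    (forall w, E w -> forall xs, is_proj A x (fun i => y i w) xs ->
        dl * #|nonneg_idx x|%:R <= #|[set i in nonneg_idx x | `|xs i| == 1]|%:R) &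
    ((1 - expR (- c * n%:R))%:E <= P E)%E].
  exists E; split => //; split => // w Ew; split; first exact: ppc_main_exists.
  move=> x' hx'; apply: (good_output_of_tight x1 dl0 nI _ hx').
  exact: HE.
have [nsmall|nbig] := ltP (n%:R : R) T; last first.
  have [E [mE HE PE]] := large_case n0 A1 x1 nI iid nbig.
  exists E; split => //; apply: le_trans PE; rewrite lee_fin lerD2l lerN2 ler_expR mulNr lerN2.
  by rewrite ler_wpM2r// ge_min lexx.
have e1 : (eta%:E <= normal_prob 0 1 (`[2%R, 3%R]%classic : set R))%E.
  by rewrite gfin lee_fin ge_min lexx.
have e2 : (eta%:E <= normal_prob 0 1 (`[(- dl)%R, dl]%classic : set R))%E.
  by rewrite gfin lee_fin ge_min lexx orbT.
have [E [mE HE PE]] := small_case n0 A1 x1 nI iid nsmall (ltW eta0) e1 e2.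
exists E; split => //; apply: le_trans PE; rewrite lee_fin.
apply: (@le_trans _ _ (c * n%:R)).
  by have := expR_ge1Dx (- c * n%:R); lra.
apply: (@le_trans _ _ (eta ^+ k / T * T)).
  apply: ler_pM => //; last exact: ltW.
  - rewrite le_min; apply/andP; split; first by lra.
    by apply: divr_ge0; [apply: exprn_ge0; exact: ltW|exact: ltW].
  - by rewrite ge_min lexx orbT.
rewrite divfK ?gt_eqF//.
have nk : (n <= k)%N by rewrite -(ler_nat R) ltW// (lt_trans nsmall).
by apply: ler_wiXn2l => //; exact: ltW.
Qed.

Theorem theorem4p1 (R : realType) :
  exists eps : R, 0 < eps /\
  exists C : R, 0 < C /\
  exists c : R, 0 < c /\
  forall (m n : nat), (m <= n)%N ->
  forall (A : 'M[R]_(m, n)), (forall j i, -1 <= A j i <= 1) ->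
  forall (x : 'I_n -> R), (forall i, -1 < x i < 1) ->
  forall (d : measure_display) (Omega : measurableType d) (P : probability Omega R)
         (y : 'I_n -> Omega -> R),
  iid_std_gaussian P y ->
  exists E : set Omega, measurable E /\
    (forall w, E w ->
       (exists x', ppc_output eps A x (fun i => y i w) x') /\
       (forall x', ppc_output eps A x (fun i => y i w) x' -> good_output eps C A x x')) /\
    (P E >= (1 - expR (- c * n%:R))%:E)%E.
Proof.
exists (1 / 2 / 10 ^+ 5); split; first by lra.
exists 112; split; first by lra.
have [c [c0 H]] := main_case R.
exists c; split => // m n _ A A1 x x1 d Omega P y iid.
(* For [n = 0] the required probability is 0 and the empty event suffices. *)
have [n0|n0] := posnP n.
  exists set0; split => //; split => //.
  by rewrite n0 mulr0 expR0 subrr measure0.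
rewrite /ppc_output; case: (boolP (2 * #|nonneg_idx x| < n)%N) => [lt|]; last by rewrite -leqNgt => nI; exact: H.
have x1N i : -1 < - x i < 1 by have := x1 i; lra.
(* Negating [x] makes every negative entry nonnegative, so the negated vector falls under the main
   case. *)
have nI : (n <= 2 * #|nonneg_idx (fun i => - x i)|)%N.
  have sub : (#|~: nonneg_idx x| <= #|nonneg_idx (fun i => - x i)|)%N.
    apply: subset_leq_card; apply/fintype.subsetP => i.
    by rewrite !inE -ltNge oppr_ge0 => /ltW.
  have := cardsC (nonneg_idx x); rewrite card_ord => cI.
  apply: leq_trans (_ : 2 * #|~: nonneg_idx x| <= _)%N; last by rewrite leq_mul2l sub orbT.
  have half (a b k : nat) : (a + b = k -> 2 * a < k -> k <= 2 * b)%N.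
    by move=> <-; rewrite !mul2n -!addnn ltn_add2l leq_add2r; exact: ltnW.
  exact: half cI lt.
have [E [mE [HE PE]]] := H m n n0 A A1 _ x1N nI d Omega P y iid.
exists E; split => //; split => // w Ew; have [[x'' h1] h2] := HE w Ew; split.
  by exists (fun i => - x'' i), x''.
move=> x' [u [hu xE]]; exact: good_output_opp xE (h2 u hu).
Qed.
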